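(* Let $\mathcal{A}$ be a finite arrangement of affine hyperplanes in $\mathbb{R}^d$ whose face poset $P_{\mathcal{A}}$ has length $d$. Then $\{z_*(\tau_R)\}_{R\in\mathcal{B}}$ is a basis of $\widetilde H_{d-1}(L_{\mathcal{A}}\setminus\{\hat 0\};\mathbb{Z})$.
   Context: Cells: for $x,y\in\mathbb{R}^d$ write $x\equiv y$ if for every $H\in\mathcal{A}$, $x$ and $y$ lie in the same one of the three pieces $H$, and the two components of $\mathbb{R}^d\setminus H$; cells are the equivalence classes. $P_{\mathcal{A}}$ is the poset of cells ordered by inclusion of closures; its maximal elements are the regions. $\mathcal{B}$ is the set of bounded regions. $\overline{\overline{P}}_{\mathcal{A}}$ is $P_{\mathcal{A}}$ with its regions removed. For $R\in\mathcal{B}$, $\tau_R$ is the fundamental $(d-1)$-cycle (up to sign) of the order complex of $(P_{\mathcal{A}})_{<R}$, which is a $(d-1)$-sphere, regarded as a cycle in $\overline{\overline{P}}_{\mathcal{A}}$. $L_{\mathcal{A}}$ is the intersection semilattice: all nonempty intersections $\bigcap\mathcal{A}'$ of subfamilies $\mathcal{A}'\subseteq\mathcal{A}$, ordered by reverse inclusion, with minimum $\hat 0=\mathbb{R}^d$. The map $z:\overline{\overline{P}}_{\mathcal{A}}\to L_{\mathcal{A}}\setminus\{\hat0\}$ sends a cell to its affine span; it is order-reversing and hence induces a simplicial map of order complexes, and $z_*$ is the induced map on $\widetilde H_{d-1}$. Homology of a poset means homology of its order complex. *)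

(* Defs.v *)
From HB Require Import structures.
From mathcomp Require Import all_boot all_order all_algebra perm.
From mathcomp Require Import generic_quotient ring_quotient.
From mathcomp Require Import all_classical reals topology normedtype.

Set Implicit Arguments.
Unset Strict Implicit.
Unset Printing Implicit Defensive.

Import Order.TTheory GRing.Theory Num.Theory.
Import numFieldNormedType.Exports.
Import Quotient.Exports.

Local Open Scope classical_set_scope.
Local Open Scope ring_scope.

(** * Reduced simplicial homology with integer coefficients

A simplicial complex on V is given by the set K : set (set V) of its simplices,
the empty simplex included.  Everything is indexed by the number n of vertices
of a simplex, that is, by its dimension plus one; in particular n = 0 is the
augmentation degree -1. *)

(** A chain is an integer function on oriented simplices that changes sign with
the orientation and has finite support.  An oriented simplex being an ordering
of the vertices up to even permutations, such a function is a function of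
n-tuples of distinct vertices which is alternating under permutations. *)

Definition perm_tuple (V : Type) (n : nat) (s : 'S_n) (x : n.-tuple V) :
  n.-tuple V := [tuple tnth x (s i) | i < n].

Definition is_chain (V : choiceType) (K : set (set V)) (n : nat)
    (c : n.-tuple V -> int) : Prop :=
  [/\ finite_set [set x | c x != 0],
      forall x, c x != 0 -> uniq x /\ K [set` x]
    & forall (s : 'S_n) x, c (perm_tuple s x) = (-1) ^+ s * c x].

(** The coefficient of the oriented simplex [y] in the boundary of c is the sum
of the coefficients in c of the [v, y], since the boundary of [v, y] is [y] plus
terms on faces containing v. *)
Definition boundary (V : choiceType) (n : nat) (c : n.+1.-tuple V -> int) :
    n.-tuple V -> int :=
  fun y => \sum_(v \in [set: V]) c [tuple of v :: y].

Definition is_cycle (V : choiceType) (n : nat) :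
    (n.-tuple V -> int) -> Prop :=
  match n with
  | 0 => fun=> True
  | n'.+1 => fun c => boundary c = 0
  end.

(** The chain map [v_1, ..., v_n] |-> [f v_1, ..., f v_n]: a simplex mapped
bijectively onto {y_1, ..., y_n} has exactly one ordering that is sent to y.  When
f collapses a simplex, y has a repetition and the sum vanishes because c is
alternating. *)
Definition push_chain (V W : choiceType) (f : V -> W) (n : nat)
    (c : n.-tuple V -> int) : n.-tuple W -> int :=
  fun y => \sum_(x \in [set x | map_tuple f x = y]) c x.

Definition simplicial (V W : choiceType) (K : set (set V)) (K' : set (set W))
    (f : V -> W) : Prop :=
  forall s, K s -> K' (f @` s).

Section FiberSum.
Variables (T U : choiceType) (h : T -> U).

Definition fiber_sum (c : T -> int) (y : U) : int :=
  \sum_(x \in [set x | h x = y]) c x.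

Lemma fiber_sumE (r : seq T) (c : T -> int) (y : U) :
  uniq r -> (forall x, c x != 0 -> x \in r) ->
  fiber_sum c y = \sum_(x <- r | h x == y) c x.
Proof.
move=> ur cr; rewrite /fiber_sum fsbig_supp.
rewrite (fsbig_fwiden [seq x <- r | h x == y]) ?big_filter //.
- move=> x [/= <- /eqP /cr xr]; by rewrite mem_filter eqxx.
- exact: filter_uniq.
- move=> x [/=]; rewrite mem_filter => /andP[/eqP hx _] nx.
  by apply: contrapT => cx0; apply: nx; split.
Qed.

Lemma fiber_sum0 (y : U) : fiber_sum 0 y = 0.
Proof. by apply: fsbig1. Qed.

Lemma fiber_sumB (c e : T -> int) (y : U) :
  finite_set [set x | c x != 0] -> finite_set [set x | e x != 0] ->
  fiber_sum (c - e) y = fiber_sum c y - fiber_sum e y.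
Proof.
move=> /finite_seqP[r1 E1] /finite_seqP[r2 E2].
have H1 x : c x != 0 -> x \in undup (r1 ++ r2).
  move=> cx; rewrite mem_undup mem_cat.
  have xr : [set` r1] x by rewrite -E1.
  by rewrite (xr : x \in r1).
have H2 x : e x != 0 -> x \in undup (r1 ++ r2).
  move=> cx; rewrite mem_undup mem_cat orbC.
  have xr : [set` r2] x by rewrite -E2.
  by rewrite (xr : x \in r2).
rewrite !(@fiber_sumE (undup (r1 ++ r2))) ?undup_uniq //; last first.
  move=> x; rewrite !fctE; case: (eqVneq (c x) 0) => [->|/H1//].
  by rewrite sub0r oppr_eq0 => /H2.
by rewrite -sumrB.
Qed.

Lemma fiber_sum_neq0 (c : T -> int) (y : U) :
  fiber_sum c y != 0 -> exists2 x, h x = y & c x != 0.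
Proof.
move=> n0; apply: contrapT => nex; move/eqP: n0; apply.
apply: fsbig1 => x /= hx; apply/eqP; apply: contrapT => /negP cx.
by apply: nex; exists x.
Qed.

Lemma fiber_sum_finite (c : T -> int) :
  finite_set [set x | c x != 0] -> finite_set [set y | fiber_sum c y != 0].
Proof.
move=> fc; apply: sub_finite_set (finite_image h fc) => y /= /fiber_sum_neq0[x].
by move=> <- cx; exists x.
Qed.

End FiberSum.

Lemma fiber_sum_comp (S T U : choiceType) (g : T -> U) (h : S -> T)
    (c : S -> int) :
  finite_set [set x | c x != 0] ->
  fiber_sum g (fiber_sum h c) = fiber_sum (g \o h) c.
Proof.
move=> /finite_seqP[r0 E]; apply/funext => z; pose r := undup r0.
have cr x : c x != 0 -> x \in r.
  by move=> cx; rewrite mem_undup; change ([set` r0] x); rewrite -E.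
have ur : uniq r by exact: undup_uniq.
rewrite [RHS](fiber_sumE _ _ ur cr).
rewrite (@fiber_sumE _ _ _ (undup (map h r))) ?undup_uniq //; last first.
  by move=> y /fiber_sum_neq0[x <- /cr xr]; rewrite mem_undup map_f.
under eq_bigr do rewrite (fiber_sumE _ _ ur cr).
rewrite (exchange_big_dep (fun x => g (h x) == z)) /=; last first.
  by move=> y x /eqP <- /eqP <-.
rewrite big_seq_cond [RHS]big_seq_cond; apply: eq_bigr => x /andP[xr /eqP gz].
rewrite (eq_bigl (pred1 (h x))); last first.
  move=> y /=; rewrite [y == h x]eq_sym.
  by case: (h x =P y) => [<-|_]; rewrite ?gz ?eqxx ?andbF.
rewrite big_mkcond (bigD1_seq (h x)) ?undup_uniq ?mem_undup ?map_f //= eqxx.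
by rewrite big1 ?addr0 // => y /negPf ->.
Qed.

Section ChainMaps.
Variables (V W : choiceType) (f : V -> W).

Lemma push_chainE n (c : n.-tuple V -> int) :
  push_chain f c = fiber_sum (map_tuple f) c.
Proof. by []. Qed.

Lemma boundaryE (U : choiceType) n (c : n.+1.-tuple U -> int) :
  boundary c = fiber_sum (@behead_tuple n.+1 U) c.
Proof.
apply/funext => y; rewrite /boundary /fiber_sum; apply/esym.
apply: (@reindex_fsbig _ _ _ _ _ (fun v => [tuple of v :: y])); split.
- by move=> v _ /=; apply: val_inj.
- by move=> u v _ _ /(congr1 val) [].
- move=> x /= <-; exists (thead x) => //.
  by apply: val_inj; rewrite /= [in RHS](tuple_eta x).
Qed.

Lemma boundary_push n (c : n.+1.-tuple V -> int) :
  finite_set [set x | c x != 0] ->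
  boundary (push_chain f c) = push_chain f (boundary c).
Proof.
move=> fc; rewrite !push_chainE !boundaryE !fiber_sum_comp //.
congr fiber_sum; apply/funext => x /=; apply: val_inj => /=.
by rewrite behead_map.
Qed.

End ChainMaps.

Lemma is_chain0 (V : choiceType) (K : set (set V)) n :
  is_chain K (0 : n.-tuple V -> int).
Proof.
split=> [|x|s x]; rewrite ?fctE ?eqxx ?mulr0 //.
by apply: (@sub_finite_set _ _ set0) => // x /=; rewrite eqxx.
Qed.

Lemma is_chainB (V : choiceType) (K : set (set V)) n
    (c e : n.-tuple V -> int) :
  is_chain K c -> is_chain K e -> is_chain K (c - e).
Proof.
move=> [c1 c2 c3] [e1 e2 e3].
have ce x : (c - e) x != 0 -> c x != 0 \/ e x != 0.
  rewrite !fctE; case: (eqVneq (c x) 0) => [->|]; last by left.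
  by rewrite sub0r oppr_eq0; right.
split=> [|x /ce[/c2|/e2]//|s x].
- apply: (@sub_finite_set _ _ ([set x | c x != 0] `|` [set x | e x != 0])) => //.
  by rewrite finite_setU.
- by rewrite !fctE c3 e3 mulrBr.
Qed.

Lemma boundary0 (V : choiceType) n :
  boundary (0 : n.+1.-tuple V -> int) = 0.
Proof. by rewrite boundaryE; apply/funext => y; rewrite fiber_sum0. Qed.

Lemma boundaryB (V : choiceType) n (c e : n.+1.-tuple V -> int) :
  finite_set [set x | c x != 0] -> finite_set [set x | e x != 0] ->
  boundary (c - e) = boundary c - boundary e.
Proof.
by move=> fc fe; rewrite !boundaryE; apply/funext => y; rewrite fiber_sumB.
Qed.

Lemma push_chain_is_chain (V W : choiceType) (K : set (set V))
    (K' : set (set W)) (f : V -> W) n (c : n.-tuple V -> int) :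
  simplicial K K' f -> is_chain K c -> is_chain K' (push_chain f c).
Proof.
move=> fK [c1 c2 c3]; rewrite push_chainE.
have alt (s : 'S_n) y : fiber_sum (map_tuple f) c (perm_tuple s y) =
    (-1) ^+ s * fiber_sum (map_tuple f) c y.
  have pK (U : Type) (t : 'S_n) (x : n.-tuple U) :
      perm_tuple t (perm_tuple t^-1 x) = x.
    by apply: eq_from_tnth => i; rewrite !tnth_mktuple permK.
  have pK' (U : Type) (t : 'S_n) (x : n.-tuple U) :
      perm_tuple t^-1 (perm_tuple t x) = x.
    by apply: eq_from_tnth => i; rewrite !tnth_mktuple permKV.
  have mp (t : 'S_n) (x : n.-tuple V) :
      map_tuple f (perm_tuple t x) = perm_tuple t (map_tuple f x).
    by apply: eq_from_tnth => i; rewrite tnth_map !tnth_mktuple tnth_map.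
  rewrite /fiber_sum mulr_fsumr.
  rewrite (@reindex_fsbig _ _ _ _ _ (perm_tuple s) [set x | map_tuple f x = y]).
    by apply: eq_fsbigr => x _; rewrite c3.
  split=> [x /= <-|x x' _ _ E|x /= xy]; first by rewrite mp.
    by rewrite -(pK' _ s x) E pK'.
  by exists (perm_tuple s^-1 x); rewrite /= ?pK // mp xy pK'.
split=> [|y ny|//]; first exact: fiber_sum_finite.
split; last first.
  have [x <- /c2[_ Kx]] := fiber_sum_neq0 ny.
  suff -> : [set` map_tuple f x] = f @` [set` x] by exact: fK.
  apply/seteqP; split=> [w /= /mapP[v vx ->]|w [v /= vx <-]]; first by exists v.
  exact: map_f.
apply/tuple_uniqP => i j yij; apply/eqP; apply: contraNT ny => ij.
have E : perm_tuple (tperm i j) y = y.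
  apply: eq_from_tnth => k; rewrite tnth_mktuple.
  by case: tpermP => [->|->|//]; rewrite yij.
have := alt (tperm i j) y; rewrite E odd_tperm ij expr1 mulN1r => /eqP.
by rewrite -addr_eq0 -mulr2n mulrn_eq0.
Qed.

Section Homology.
Variables (V : choiceType) (K : set (set V)) (n : nat).

Definition cycle_pred : {pred n.-tuple V -> int} :=
  fun c => `[< is_chain K c /\ is_cycle c >].

Lemma cycle_pred_zmod : zmod_closed cycle_pred.
Proof.
split=> [|c e /asboolP[cc zc] /asboolP[ce ze]]; apply/asboolP; split.
- exact: is_chain0.
- by case: n => //= k; exact: boundary0.
- exact: is_chainB.
- case: n c e cc zc ce ze => //= k c e [fc _ _] zc [fe _ _] ze.
  by rewrite boundaryB // zc ze subrr.
Qed.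

HB.instance Definition _ :=
  GRing.isZmodClosed.Build (n.-tuple V -> int) cycle_pred cycle_pred_zmod.

Record cycles := Cycle {
  cycle_val : n.-tuple V -> int;
  _ : cycle_val \in cycle_pred }.

HB.instance Definition _ := [isSub for cycle_val].
HB.instance Definition _ := [Choice of cycles by <:].
HB.instance Definition _ := [SubChoice_isSubZmodule of cycles by <:].

Definition boundary_pred : {pred cycles} :=
  fun z => `[< exists2 b : n.+1.-tuple V -> int,
                 is_chain K b & boundary b = cycle_val z >].

Lemma boundary_pred_zmod : zmod_closed boundary_pred.
Proof.
split=> [|c e /asboolP[b bc Eb] /asboolP[b' bc' Eb']]; apply/asboolP.
  by exists 0; [exact: is_chain0 | rewrite boundary0].
exists (b - b'); first exact: is_chainB.
by case: bc bc' => [fb _ _] [fb' _ _]; rewrite boundaryB // Eb Eb'.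
Qed.

HB.instance Definition _ :=
  GRing.isZmodClosed.Build cycles boundary_pred boundary_pred_zmod.

(** Reduced homology in degree n - 1. *)
Definition homology : zmodType := Quotient.quot boundary_pred.

Definition hclass (z : cycles) : homology :=
  (\pi_(Quotient.quot boundary_pred) z)%qT.

End Homology.

Arguments cycle_pred {V} K n _.
Arguments boundary_pred {V} K n _.

(** The map on homology induced by a vertex map f.  For f simplicial it is the
usual one, on any representative ([induced_hclass] below), the default value of
[insubd] being then unused. *)
Definition induced (V W : choiceType) (K : set (set V)) (K' : set (set W))
    (f : V -> W) (n : nat) (a : homology K n) : homology K' n :=
  hclass (insubd (0 : cycles K' n)
                 (push_chain f (cycle_val (repr (a : Quotient.quot _))))).

Lemma hclass_eq (V : choiceType) (K : set (set V)) n (y z : cycles K n) :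
  hclass y = hclass z <-> y - z \in boundary_pred K n.
Proof. by rewrite Quotient.idealrBE; split=> [/eqP|/eqP]. Qed.

Lemma push_chain_cycle (V W : choiceType) (K : set (set V))
    (K' : set (set W)) (f : V -> W) n (z : cycles K n) :
  simplicial K K' f -> push_chain f (cycle_val z) \in cycle_pred K' n.
Proof.
move=> fK; case: z => c /= /asboolP[cc zc]; apply/asboolP; split.
  exact: push_chain_is_chain cc.
case: n c cc zc => //= n c [fc _ _] zc; rewrite boundary_push // zc.
by apply/funext => y; rewrite push_chainE fiber_sum0.
Qed.

Lemma induced_hclass (V W : choiceType) (K : set (set V))
    (K' : set (set W)) (f : V -> W) n (z : cycles K n)
    (fK : simplicial K K' f) :
  induced K' f (hclass z) = hclass (Cycle (push_chain_cycle z fK)).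
Proof.
rewrite /induced; set z' := repr _.
have : hclass z' = hclass z by rewrite /hclass reprK.
move=> /hclass_eq /asboolP[b cb Eb]; apply/hclass_eq/asboolP.
exists (push_chain f b); first exact: push_chain_is_chain cb.
have fin (u : cycles K n) : finite_set [set x | cycle_val u x != 0].
  by case: u => c /= /asboolP[[]].
have [fb _ _] := cb; rewrite boundary_push // Eb.
have -> : cycle_val (insubd (0 : cycles K' n) (push_chain f (cycle_val z'))
                     - Cycle (push_chain_cycle z fK)) =
          push_chain f (cycle_val z') - push_chain f (cycle_val z).
  by rewrite -[LHS]/(val _) raddfB /= insubdK // push_chain_cycle.
have -> : cycle_val (z' - z) = cycle_val z' - cycle_val z by [].
by apply/funext => y; rewrite !push_chainE !fctE; exact: fiber_sumB.
Qed.

(** * Posets *)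

Definition order_complex (T : choiceType) (P : set T) (le : T -> T -> Prop) :
    set (set T) :=
  [set s | [/\ finite_set s, s `<=` P
             & forall x y, s x -> s y -> le x y \/ le y x]].

Definition poset_length (T : choiceType) (P : set T) (le : T -> T -> Prop)
    (n : nat) : Prop :=
  (exists s : seq T,
     [/\ uniq s, order_complex P le [set` s] & size s = n.+1]) /\
  (forall s : seq T,
     uniq s -> order_complex P le [set` s] -> (size s <= n.+1)%N).

Definition zbasis (M : zmodType) (I : choiceType) (B : set I) (b : I -> M) :
    Prop :=
  forall m : M, exists! k : I -> int,
    [/\ finite_set [set i | k i != 0], [set i | k i != 0] `<=` B
      & m = \sum_(i \in B) b i *~ k i].

(** * Hyperplane arrangements *)

Section Arrangement.
Variables (R : realType) (d : nat).
Local Notation E := 'rV[R]_d.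

Definition hyperplane (H : set E) : Prop :=
  exists (a : E) (b : R),
    a != 0 /\ H = [set x : E | \sum_(i < d) a 0 i * x 0 i = b].

Definition arrangement (A : set (set E)) : Prop :=
  finite_set A /\ forall H, A H -> hyperplane H.

(** [connected_component B x] is empty when x is not in B, so the second case
forces x and y to lie off H. *)
Definition same_piece (H : set E) (x y : E) : Prop :=
  (H x /\ H y) \/ connected_component (~` H) x y.

Definition same_cell (A : set (set E)) (x y : E) : Prop :=
  forall H, A H -> same_piece H x y.

Definition cells (A : set (set E)) : set (set E) :=
  [set C | exists x : E, C = [set y | same_cell A x y]].

Definition cell_le (C D : set E) : Prop := closure C `<=` closure D.

Definition regions (A : set (set E)) : set (set E) :=
  [set C | cells A C /\ forall D, cells A D -> cell_le C D -> D = C].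

Definition bounded_regions (A : set (set E)) : set (set E) :=
  [set C | regions A C /\ bounded_set C].

Definition nonregions (A : set (set E)) : set (set E) := cells A `\` regions A.

Definition cells_below (A : set (set E)) (C : set E) : set (set E) :=
  [set D | [/\ cells A D, cell_le D C & D <> C]].

Definition intersections (A : set (set E)) : set (set E) :=
  [set X | X !=set0 /\ exists2 A', A' `<=` A & X = \bigcap_(H in A') H].

Definition flat_le (X Y : set E) : Prop := Y `<=` X.

Definition affine_span (S : set E) : set E :=
  [set y | exists (m : nat) (x : 'I_m -> E) (t : 'I_m -> R),
     [/\ forall i, S (x i), \sum_i t i = 1 & y = \sum_i t i *: x i]].

(** The fundamental cycle of the (d-1)-sphere below the region C: a generator of
its infinite cyclic (d-1)-st homology group, one of the two being chosen.  The
default value 0, not a generator, is never used on bounded regions. *)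
Definition fundamental_cycle (A : set (set E)) (C : set E) :
    cycles (order_complex (cells_below A C) cell_le) d :=
  xget 0 [set c | bijective (fun k : int => hclass c *~ k)].

(** Its class in the poset of non-maximal cells, along the inclusion. *)
Definition tau (A : set (set E)) (C : set E) :
    homology (order_complex (nonregions A) cell_le) d :=
  induced _ id (hclass (fundamental_cycle A C)).

Definition zstar (A : set (set E)) :
    homology (order_complex (nonregions A) cell_le) d ->
    homology (order_complex (intersections A `\ setT) flat_le) d :=
  induced _ affine_span (n := d).

End Arrangement.

(* Main.v *)
From mathcomp Require Import all_boot all_order all_algebra.
From mathcomp Require Import all_classical.
From mathcomp Require Import fintype finset.
From mathcomp Require Import ring lra zify.

Set Implicit Arguments.
Unset Strict Implicit.
Unset Printing Implicit Defensive.

Import Order.TTheory GRing.Theory Num.Theory.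

Local Open Scope ring_scope.

(** The arrangement is encoded by sign vectors.  The order complex of
[L \ {0}] has dimension [d - 1], so its top homology is its group of top cycles,
and such a cycle is an integer function on complete flags of flats whose sum over
any one member of the flag vanishes.  In this language [z_* tau_R] sends a flag
[F_0 < ... < F_{d-1}] to the iterated jump, first across [F_{d-1}], then along
[F_{d-1}] across [F_{d-2}], and so on down to the vertex [F_0], of the indicator
function of [R].  Directions of the flats chosen along one generic complete flag of
subspaces orient all these jumps coherently, so that no determinants are needed.

The iterated jump [T] is thus a map from functions on the bounded regions to flag
cycles.  It is injective: by induction on the dimension a function in its kernel has
no jump across any facet, and from a bounded region one reaches an unbounded one by
crossing facets that lead away from a fixed point.  It is surjective by deletion and
restriction: the restriction of a flag cycle to a hyperplane [H] is an iterated jump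
by induction, it lifts to bounded regions because one side of a bounded facet is
bounded, and a flag cycle vanishing on [H] is a flag cycle of the arrangement
without [H].  The same walk shows that a flag cycle carried by the faces of one
region [R] is a multiple of [T] of the indicator of [R]; hence this is, up to sign,
the image of the fundamental cycle. *)

(** The delicate point is the cycle condition at an inner member of a flag: a sum over all flats [Y]
    between [X] and some [K] two dimensions lower must vanish. Locally this happens in a plane. If
    all directions [u Y] lie on a line parallel to [u X], the jumps across the various [Y] take
    place at the breakpoints of a function on that line and add up to the difference of its end
    values. The same holds on the line of the [- u Y]; both lines end in the directions [u X] and
    [- u X], so the two sums cancel. Intersecting the direction of each flat with the member of a
    generic flag of subspaces that meets it in a line yields such [u].

    Deletion leaves the arrangement as it is: a set [J] of hyperplanes records on which signs a
    function may depend and against which recession directions are tested. Flats, flags and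
    directions thus stay fixed throughout the induction. *)

(** * Sign vectors, flats and their directions *)

Section SignVectors.
Variables (R : realFieldType) (E : vectType R) (I : finType).
Variables (l : I -> 'Hom(E, R^o)) (b : I -> R).

(* A cell is encoded by its sign vector [sv x], and a flat by the set [zs x] of
all hyperplanes containing it, [x] being generic in the flat.  [pt X] is such an
[x], and [0] when [X] is not a flat. *)
Definition affv (i : I) (x : E) : R := l i x - b i.
Definition sv (x : E) : {ffun I -> int} := [ffun i => sgz (affv i x)].
Definition dv (u : E) : {ffun I -> int} := [ffun i => sgz (l i u : R)].
Definition zs (x : E) : {set I} := [set i | affv i x == 0].
(** Composition of covectors, as in oriented matroids: [scomp (sv x) (dv u)] is the sign vector
    after a short step from [x] along [u], and [scomp (dv u) (sv x)] the one far out. *)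
Definition scomp (s t : {ffun I -> int}) : {ffun I -> int} :=
  [ffun i => if s i == 0 then t i else s i].
Definition dir (X : {set I}) : {vspace E} := (\bigcap_(i in X) lker (l i))%VS.
Definition flat (X : {set I}) : bool := `[< exists x, zs x = X >].
(** Larger sets of hyperplanes are smaller flats: [Y] is the one of codimension one in the other. *)
Definition cov (X Y : {set I}) : bool :=
  [&& flat X, flat Y, X \subset Y & \dim (dir X) == (\dim (dir Y)).+1].
Definition pt (X : {set I}) : E := xget 0 [set x | zs x = X]%classic.

Lemma affvD i x u : affv i (x + u) = affv i x + l i u.
Proof. by rewrite /affv linearD /= addrAC. Qed.

Lemma affvB i x y : affv i x - affv i y = l i (x - y).
Proof. by rewrite /affv linearB /= opprB addrA subrK. Qed.

Lemma lZ i t u : l i (t *: u) = t * (l i u : R).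
Proof. by rewrite linearZ. Qed.

Lemma in_zs i x : (i \in zs x) = (affv i x == 0).
Proof. by rewrite inE. Qed.

Lemma svE x i : sv x i = sgz (affv i x).
Proof. by rewrite ffunE. Qed.

Lemma dvE u i : dv u i = sgz (l i u : R).
Proof. by rewrite ffunE. Qed.

Lemma sv_eq0 x i : (sv x i == 0) = (i \in zs x).
Proof. by rewrite svE sgz_eq0 in_zs. Qed.

Lemma scompE s t i : scomp s t i = if s i == 0 then t i else s i.
Proof. by rewrite ffunE. Qed.

Lemma dvN u i : dv (- u) i = - dv u i.
Proof. by rewrite !dvE linearN /= sgzN. Qed.

Lemma dirP (X : {set I}) u : reflect (forall i, i \in X -> l i u = 0) (u \in dir X).
Proof.
rewrite memvE; apply: (iffP subv_bigcapP) => h i iX.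
  by apply/eqP; rewrite -memv_ker memvE h.
by rewrite -memvE memv_ker h.
Qed.

Lemma dirS (X Y : {set I}) : X \subset Y -> (dir Y <= dir X)%VS.
Proof.
move=> /fintype.subsetP XY; apply/subvP => u /dirP h; apply/dirP => i /XY; exact: h.
Qed.

Lemma flat_zs x : flat (zs x).
Proof. by apply/asboolP; exists x. Qed.

Lemma zs_pt X : flat X -> zs (pt X) = X.
Proof. by move=> /asboolP h; have := xgetPex 0 h. Qed.

Lemma fin_eps (P : I -> R -> Prop) :
  (forall i, exists2 e, 0 < e & forall t, 0 < t <= e -> P i t) ->
  exists2 e, 0 < e & forall t, 0 < t <= e -> forall i, P i t.
Proof.
move=> h; suff [e e0 he] : exists2 e, 0 < e &
    forall t, 0 < t <= e -> forall i, i \in enum I -> P i t.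
  by exists e => // t te i; apply: he; rewrite ?mem_enum.
elim: (enum I) => [|i s [e e0 he]]; first by exists 1.
have [e' e'0 he'] := h i.
exists (Num.min e e'); first by rewrite lt_min e0.
move=> t /andP[t0]; rewrite le_min => /andP[te te'] j.
by rewrite inE => /orP[/eqP ->|js]; [apply: he'|apply: he] => //; rewrite t0.
Qed.

Lemma sgz_eps (c v : R) : exists2 e : R, 0 < e &
  forall t, 0 < t <= e -> sgz (c + t * v) = if sgz c == 0 then sgz v else sgz c.
Proof.
rewrite sgz_eq0; case: eqVneq => [->|c0].
  by exists 1 => // t /andP[t0 _]; rewrite add0r sgzM gtr0_sgz ?mul1r.
(* The summand 1 keeps the denominator positive for [v = 0]; the factor 1/2 makes [|t * v| < |c|]
   strict, so that [c] decides the sign. *)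
pose e := `|c| / (`|v| + 1) / 2.
have v1 : 0 < `|v| + 1 by rewrite ltr_wpDl.
have ac : 0 < `|c| by rewrite normr_gt0.
have e0 : 0 < e by rewrite !divr_gt0.
exists e => // t /andP[t0 te].
have tv : `|t * v| < `|c|.
  rewrite normrM (gtr0_norm t0).
  have h1 : t * `|v| <= t * (`|v| + 1) by rewrite ler_wpM2l ?lerDl // ltW.
  have h2 : t * (`|v| + 1) <= e * (`|v| + 1) by rewrite ler_wpM2r // ltW.
  have h3 : e * (`|v| + 1) = `|c| / 2 by rewrite /e; field; rewrite lt0r_neq0.
  have h4 : `|c| / 2 < `|c| by lra.
  lra.
case: (ltrgtP c 0) c0 ac tv => // c0 _ ac tv.
  rewrite !ltr0_sgz //; have := ltr0_norm c0; have := ler_norm (t * v); lra.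
rewrite !gtr0_sgz //; have := gtr0_norm c0; have := lerNnormlW (lexx `|t * v|); lra.
Qed.

Lemma sv_eps x u : exists2 e, 0 < e &
  forall t, 0 < t <= e -> sv (x + t *: u) = scomp (sv x) (dv u).
Proof.
have [|e e0 he] := @fin_eps (fun i t => sv (x + t *: u) i = scomp (sv x) (dv u) i).
  move=> i; have [e e0 he] := sgz_eps (affv i x) (l i u).
  by exists e => // t /he; rewrite !ffunE affvD lZ.
by exists e => // t /he h; apply/ffunP.
Qed.

Lemma zs_sv x y : sv x = sv y -> zs x = zs y.
Proof. by move=> h; apply/setP => i; rewrite -!sv_eq0 h. Qed.

Lemma sv_comp x u : exists y, [/\ sv y = scomp (sv x) (dv u),
  zs y = [set i in zs x | l i u == 0 :> R] & exists2 t, 0 < t & y = x + t *: u].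
Proof.
have [e e0 he] := sv_eps x u.
have h := he e; rewrite e0 lexx in h.
exists (x + e *: u); split; [exact: h| |by exists e].
apply/setP => i; rewrite -sv_eq0 h // ffunE inE sv_eq0.
by case: ifP => // iz; rewrite ?dvE ?sgz_eq0 // sv_eq0 iz.
Qed.

Lemma sub_dir_zs x y (X : {set I}) : X \subset zs x -> X \subset zs y -> x - y \in dir X.
Proof.
move=> /fintype.subsetP hx /fintype.subsetP hy; apply/dirP => i iX.
by move: (hx _ iX) (hy _ iX); rewrite !in_zs -affvB => /eqP -> /eqP ->; rewrite subrr.
Qed.

Lemma subset_zsD (X : {set I}) x u : X \subset zs x -> u \in dir X -> X \subset zs (x + u).
Proof.
move=> /fintype.subsetP hx /dirP hu; apply/fintype.subsetP => i iX; rewrite in_zs affvD hu //.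
by move: (hx _ iX); rewrite in_zs addr0.
Qed.

Lemma dir_nonzero (X : {set I}) x i : zs x = X -> i \notin X ->
  forall y, X \subset zs y -> i \in zs y -> exists2 u, u \in dir X & l i u != 0 :> R.
Proof.
move=> zx iX y Xy iy; exists (x - y).
  by apply: sub_dir_zs; rewrite ?zx.
by rewrite -affvB; move: iX iy; rewrite -zx !in_zs => h /eqP ->; rewrite subr0.
Qed.

Lemma dim_cut (X : {set I}) i u : u \in dir X -> l i u != 0 :> R ->
  \dim (dir X) = (\dim (dir (i |: X))).+1.
Proof.
move=> uX iu.
have -> : dir (i |: X) = (dir X :&: lker (l i))%VS.
  apply/eqP; rewrite eqEsubv; apply/andP; split; apply/subvP => v.
    move=> /dirP h; rewrite memv_cap memv_ker h ?setU11 // eqxx andbT.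
    by apply/dirP => j jX; rewrite h // setU1r.
  rewrite memv_cap memv_ker => /andP[/dirP h /eqP h']; apply/dirP => j.
  by rewrite !inE => /orP[/eqP ->|/h].
rewrite -(limg_ker_dim (l i) (dir X)) -addn1; congr addn; apply/eqP.
rewrite eqn_leq; apply/andP; split.
  by apply: leq_trans (dimvS (subvf _)) _; rewrite dimvf.
rewrite lt0n dimv_eq0; apply: contra iu => /eqP h0.
by have := memv_img (l i) uX; rewrite h0 memv0.
Qed.

Lemma covP X Y : cov X Y ->
  [/\ flat X, flat Y, X \subset Y & \dim (dir X) = (\dim (dir Y)).+1].
Proof. by move=> /and4P[-> -> -> /eqP ->]. Qed.

Lemma dir_eq_sub (X Y : {set I}) : flat X -> flat Y -> X \subset Y ->
  (dir X <= dir Y)%VS -> X = Y.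
Proof.
move=> /asboolP[x zx] /asboolP[y zy] XY dXY; apply/eqP; rewrite finset.eqEsubset XY /=.
have h : x - y \in dir Y.
  by apply: (subvP dXY); apply: sub_dir_zs; rewrite ?zx ?zy.
by rewrite -zx -[x](subrK y) addrC; apply: subset_zsD => //; rewrite zy.
Qed.

Lemma dim_lt (X Y : {set I}) : flat X -> flat Y -> X \subset Y -> X != Y ->
  (\dim (dir Y) < \dim (dir X))%N.
Proof.
move=> fX fY XY; apply: contraNltn => h; apply/eqP.
by apply: dir_eq_sub => //; rewrite -(eqP (_ : dir Y == dir X)) // eqEdim dirS.
Qed.

(** By a dimension count, a single hyperplane [i] of [Y] off [X] already cuts [Y] out:
    [dir Y = dir (i |: X)]. *)
Lemma cov_dir (X Y : {set I}) i u : cov X Y -> i \in Y -> i \notin X -> u \in dir X ->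
  l i u = 0 -> u \in dir Y.
Proof.
move=> /covP[/asboolP[x zx] /asboolP[y zy] XY dm] iY iX uX iu.
have [||v vX iv] := dir_nonzero zx iX (y := y); rewrite ?zy //.
have : \dim (dir Y) = \dim (dir (i |: X)).
  by apply: succn_inj; rewrite -dm (dim_cut vX iv).
have sub : i |: X \subset Y by rewrite subUset sub1set iY.
move=> /eqP h; have := eqEdim (dir Y) (dir (i |: X)).
rewrite dirS //= (eqP h) leqnn => /eqP ->; apply/dirP => j.
by rewrite !inE => /orP[/eqP ->//|]; exact/dirP.
Qed.

Lemma cov_uniq (X Y Y' : {set I}) i : cov X Y -> cov X Y' -> i \notin X -> i \in Y ->
  i \in Y' -> Y = Y'.
Proof.
move=> c c' iX iY iY'; have [_ fY XY _] := covP c; have [_ fY' XY' _] := covP c'.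
wlog suff : Y Y' c c' iY iY' fY fY' XY XY' / Y \subset Y'.
  by move=> h; apply/eqP; rewrite finset.eqEsubset (h Y Y') // (h Y' Y).
move: (fY) (fY') => /asboolP[y zy] /asboolP[y' zy'].
have h : y' - y \in dir X by apply: sub_dir_zs; rewrite ?zy ?zy'.
have : l i (y' - y) = 0.
  rewrite -affvB; move: iY iY'; rewrite -zy -zy' !in_zs => /eqP -> /eqP ->.
  by rewrite subrr.
move=> /(cov_dir c iY iX h) h'.
by rewrite -zy' -[y'](subrK y) addrC; apply: subset_zsD => //; rewrite zy.
Qed.

End SignVectors.

(** * Vectors and flags of subspaces in general position *)

Section GenericFlag.
Variables (R : realFieldType) (E : vectType R).

(** A space over an infinite field is no finite union of proper subspaces. A vector [n] that is good
    for the tail is shifted along some [w] outside the head [S]; each other subspace excludes at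
    most one multiple of [w]. *)
Lemma avoid_subspaces (U : {vspace E}) (s : seq {vspace E}) :
  (forall S, S \in s -> ~~ (U <= S)%VS) ->
  exists2 n, n \in U & forall S, S \in s -> n \notin S.
Proof.
elim: s => [|S s ih] h; first by exists 0; rewrite ?mem0v.
have [|n nU ns] := ih; first by move=> S' S's; apply: h; rewrite inE S's orbT.
have [nS|nS] := boolP (n \in S); last first.
  by exists n => // S'; rewrite inE => /orP[/eqP ->|/ns].
have /subvPn[w wU wS] : ~~ (U <= S)%VS by apply: h; rewrite inE eqxx.
pose bad (S' : {vspace E}) : R := xget 0 [set t | n + t *: w \in S']%classic.
(* Larger than every excluded multiple, and nonzero, which takes the vector out of [S]. *)
pose t : R := 1 + \sum_(S' <- s) `|bad S'|.
have t1 : 1 <= t by rewrite lerDl sumr_ge0.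
have t0 : t != 0 by rewrite lt0r_neq0 // (lt_le_trans ltr01).
exists (n + t *: w); first by rewrite memvD ?memvZ.
move=> S'; rewrite inE => /orP[/eqP ->|S's].
  apply: contra wS => /(memvB)/(_ nS); rewrite addrAC subrr add0r.
  by move=> /(memvZ t^-1); rewrite scalerA mulVf ?scale1r.
apply: contra (ns _ S's) => tS.
have bS : n + bad S' *: w \in S' 
  by apply: (@xgetPex _ 0 [set t | n + t *: w \in S']%classic); exists t.
have neq : t - bad S' != 0.
  rewrite subr_eq0 gt_eqF // (le_lt_trans (ler_norm _)) // /t.
  rewrite (big_rem S') //= addrCA ltrDl (lt_le_trans ltr01) // lerDl.
  by rewrite sumr_ge0.
have wS' : w \in S'.
  have := memvB tS bS; rewrite opprD addrACA subrr add0r -scalerBl.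
  by move=> /(memvZ (t - bad S')^-1); rewrite scalerA mulVf ?scale1r.
by have := memvB tS (memvZ t wS'); rewrite addrK.
Qed.

(** The spans of the tails of [s] form a flag that meets every [W] only in zero as soon as the
    dimensions permit. The list grows at the front, by a vector outside the sums [W + <<s>>] whose
    dimensions add up to less than that of the space. *)
Lemma generic_flag_prefix (Ws : seq {vspace E}) (j : nat) :
  (j <= \dim (fullv : {vspace E}))%N ->
  exists s : seq E, [/\ size s = j, free s &
    forall m W, W \in Ws -> (m <= j)%N ->
      (\dim W + (j - m) <= \dim (fullv : {vspace E}))%N ->
      forall x, x \in W -> x \in <<drop m s>>%VS -> x = 0].
Proof.
elim: j => [_|j ih jd].
  exists [::]; split=> [//||m W _ m0 _ x _]; first exact: nil_free.
  by rewrite span_nil memv0 => /eqP.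
have [s [ss fs hs]] := ih (ltnW jd).
(* The zero space is listed as well, which makes the new vector independent of [s]. *)
pose L := [seq (W + <<s>>)%VS | W <- 0%VS :: Ws &
            (\dim W + j < \dim (fullv : {vspace E}))%N].
have [|n _ hn] := @avoid_subspaces fullv L.
  move=> S /mapP[W]; rewrite mem_filter => /andP[hW _] ->.
  apply/negP => /dimvS; apply/negP; rewrite -ltnNge.
  apply: leq_ltn_trans hW; apply: leq_trans (dimv_add_leqif _ _) _.
  by rewrite leq_add2l -ss dim_span.
have ns : n \notin <<s>>%VS.
  have := hn (0 + <<s>>)%VS; rewrite add0v; apply; apply/mapP; exists 0%VS.
    by rewrite mem_filter dimv0 add0n jd inE eqxx.
  by rewrite add0v.
exists (n :: s); split=> [/=||[|m] W hW mj hd x xW]; first by rewrite ss.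
- by rewrite free_cons ns.
- rewrite drop0 span_cons => /memv_addP[y /vlineP[al ->] [z zs xE]].
  have hn' : n \notin (W + <<s>>)%VS.
    apply: hn; apply/mapP; exists W => //; rewrite mem_filter inE hW orbT andbT.
    by move: hd; rewrite subn0 addnS.
  case: (eqVneq al 0) => [al0|al0]; last first.
    case/negP: hn'; have -> : n = al^-1 *: x + - (al^-1 *: z).
      by rewrite xE scalerDr scalerA mulVf // scale1r addrK.
    by apply: memv_add; rewrite ?memvN memvZ.
  apply: (hs 0%N W) => //; last by rewrite drop0 xE al0 scale0r add0r.
  by rewrite subn0; move: hd; rewrite subn0 addnS => /ltnW.
- by move=> /= xs; apply: (hs m W).
Qed.

End GenericFlag.

(** * A coherent choice of directions for the flats *)

Section GenericDirections.
Variables (R : realFieldType) (E : vectType R) (I : finType).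
Variables (l : I -> 'Hom(E, R^o)) (b : I -> R).
Local Notation dir := (dir l).
Local Notation flat := (flat l b).
Local Notation cov := (cov l b).

(** The third condition puts the directions of all [Y] below [X] on one line parallel to [u X]; the
    fourth keeps this line off the directions of the flats one step further down. Both serve the
    telescoping in [jump_sum_plane]. *)
Definition generic_dirs (u : {set I} -> E) : Prop :=
  [/\ forall X, (0 < \dim (dir X))%N -> u X \in dir X,
      forall X Y, cov X Y -> u X \notin dir Y,
      forall X Y Y', cov X Y -> cov X Y' -> (0 < \dim (dir Y))%N ->
        exists t, u Y' = u Y + t *: u X
    & forall X Y K, cov X Y -> cov Y K -> forall t, u Y + t *: u X \notin dir K].

Lemma generic_dirs_exist : exists u, generic_dirs u.
Proof.
pose Ws := [seq dir X | X : {set I}].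
have inWs X : dir X \in Ws by apply: codom_f.
have [s [ss fs hs]] := generic_flag_prefix Ws (leqnn _).
set D := \dim (fullv : {vspace E}) in ss hs.
(* With [m] the dimension of [dir X], the member of dimension [D - m + 1] of the generic flag meets
   [dir X] in a line; [u X] is its vector with coefficient 1 on the [m.-1]-th entry of [s]. *)
pose P X := [set w | w \in dir X /\
   w - nth 0 s (\dim (dir X)).-1 \in <<drop (\dim (dir X)) s>>%VS]%classic.
pose u X := xget 0 (P X).
have dimD X : (\dim (dir X) <= D)%N by rewrite dimvS ?subvf.
have disj X m x : (\dim (dir X) <= m <= D)%N -> x \in dir X ->
    x \in <<drop m s>>%VS -> x = 0.
  move=> /andP[h1 h2] xX xs; apply: (hs m _ (inWs X)) => //.
  by rewrite -/D; lia.
have span_drop m : (m < D)%N ->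
    <<drop m s>>%VS = (<[nth 0%R s m]> + <<drop m.+1 s>>)%VS.
  by move=> mD; rewrite (drop_nth 0) ?ss // span_cons.
have uP X : (0 < \dim (dir X))%N -> P X (u X).
  move=> X0; apply: xgetPex; set m := \dim (dir X) in X0.
  have mE : m = m.-1.+1 by rewrite prednK.
  have mD : (m.-1 < D)%N by rewrite prednK ?dimD.
  have : (dir X :&: <<drop m.-1 s>>)%VS != 0%VS.
    rewrite -dimv_eq0 -lt0n.
    have h := dimv_sum_cap (dir X) <<drop m.-1 s>>%VS.
    have hf : \dim <<drop m.-1 s>>%VS = (D - m.-1)%N.
      apply/eqP; rewrite -ss -size_drop; apply: (_ : free _).
      by move: fs; rewrite -{1}(cat_take_drop m.-1 s) => /catr_free.
    have hD : (\dim (dir X + <<drop m.-1 s>>)%VS <= D)%N by rewrite dimvS ?subvf.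
    rewrite hf -/m in h; lia.
  rewrite -vpick0; set w := vpick _ => w0.
  have : w \in (dir X :&: <<drop m.-1 s>>)%VS by exact: memv_pick.
  rewrite memv_cap span_drop // -mE => /andP[wX].
  move=> /memv_addP[y /vlineP[al ->] [z zs wE]].
  have al0 : al != 0.
    apply: contra w0 => /eqP al0; apply/eqP; apply: (disj X m) => //.
      by rewrite leqnn dimD.
    by rewrite wE al0 scale0r add0r.
  exists (al^-1 *: w); split; first by rewrite memvZ.
  by rewrite wE scalerDr scalerA mulVf // scale1r addrAC subrr add0r memvZ.
have un X : (0 < \dim (dir X))%N -> u X != 0.
  move=> X0; have [uX uN] := uP X X0; apply/eqP => u0.
  move: uN; rewrite u0 sub0r memvN => h.
  have mD : ((\dim (dir X)).-1 < D)%N by rewrite prednK ?dimD.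
  have : free (drop (\dim (dir X)).-1 s).
    by move: fs; rewrite -{1}(cat_take_drop (\dim (dir X)).-1 s) => /catr_free.
  by rewrite (drop_nth 0) ?ss // free_cons prednK // h.
have uN X : (0 < \dim (dir X))%N -> u X \in <<drop (\dim (dir X)).-1 s>>%VS.
  move=> X0; have [_ h] := uP X X0.
  rewrite span_drop; last by rewrite prednK ?dimD.
  rewrite prednK // -[u X](subrK (nth 0 s (\dim (dir X)).-1)) addrC.
  by rewrite memv_add ?memv_line.
have U1 X Y : cov X Y -> u X \notin dir Y.
  move=> /covP[_ _ _ dm]; have X0 : (0 < \dim (dir X))%N by rewrite dm.
  apply: contra (un X X0) => uY; apply/eqP; apply: (disj Y (\dim (dir X)).-1) => //.
    by rewrite {1}dm leqnn (leq_trans (leq_pred _)) ?dimD.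
  exact: uN.
exists u; split=> //.
- by move=> X /uP[].
- move=> X Y Y' /covP[_ _ XY dm] /covP[_ _ XY' dm'] Y0.
  have dE : \dim (dir Y') = \dim (dir Y) by apply: succn_inj; rewrite -dm -dm'.
  have Y'0 : (0 < \dim (dir Y'))%N by rewrite dE.
  have X0 : (0 < \dim (dir X))%N by rewrite dm.
  have [uY nY] := uP Y Y0; have [uY' nY'] := uP Y' Y'0; have [uX nX] := uP X X0.
  set dY := \dim (dir Y) in dm dE Y0 nY; rewrite dE in nY'; rewrite dm in nX.
  (* The leading coefficients cancel, so the difference lies in the next member of the flag, which
     meets [dir X] in the line of [u X]. As [u X] has leading coefficient 1, [t] is that of the
     difference. *)
  have : u Y' - u Y \in <<drop dY s>>%VS.
    have -> : u Y' - u Y = (u Y' - nth 0 s dY.-1) - (u Y - nth 0 s dY.-1).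
      by rewrite opprB addrA subrK.
    exact: memvB.
  have dD : (dY < D)%N by rewrite -dm dimD.
  rewrite span_drop // => /memv_addP[y /vlineP[t ->] [z zs yE]].
  exists t; apply/eqP; rewrite addrC -subr_eq -subr_eq0; apply/eqP.
  apply: (disj X dY.+1); rewrite ?dm ?leqnn //.
    rewrite memvB ?memvZ // memvB //.
      exact: (subvP (dirS l XY')).
    exact: (subvP (dirS l XY)).
  have -> : u Y' - u Y - t *: u X = z - t *: (u X - nth 0 s dY).
    by rewrite yE scalerBr opprB addrA [z + _]addrC.
  by rewrite memvB ?memvZ.
- move=> X Y K cXY cYK t.
  have [_ _ XY dm] := covP cXY; have [_ _ YK dm'] := covP cYK.
  have Y0 : (0 < \dim (dir Y))%N by rewrite dm'.
  have X0 : (0 < \dim (dir X))%N by rewrite dm.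
  have [uY nY] := uP Y Y0; have [uX nX] := uP X X0.
  apply/negP => h.
  (* The vector lies in a member of the generic flag that meets [dir K] only in zero; but then [u Y]
     is zero or [u X] lies in [dir Y]. *)
  have e0 : u Y + t *: u X = 0.
    apply: (disj K (\dim (dir Y)).-1) => //.
      by rewrite {1}dm' leqnn (leq_trans (leq_pred _)) ?dimD.
    rewrite memvD ?uN // memvZ //; have := uN X X0.
    rewrite dm /= => h'; rewrite span_drop; last by rewrite prednK ?dimD.
    by rewrite prednK //; move: h'; apply: subvP; apply: addvSr.
  case: (eqVneq t 0) => [t0|t0].
    by move: e0 (un Y Y0); rewrite t0 scale0r addr0 => ->; rewrite eqxx.
  case/negP: (U1 _ _ cXY); have : t *: u X \in dir Y.
    by rewrite -(addKr (u Y) (t *: u X)) e0 addr0 memvN.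
  by move=> /(memvZ t^-1); rewrite scalerA mulVf ?scale1r.
Qed.

End GenericDirections.

(** * Telescoping along a line *)

Section Telescoping.
Variables (R : realFieldType) (I : finType) (al be : I -> R).

Definition line_sv (t : R) : {ffun I -> int} := [ffun i => sgz (al i + t * be i)].
Definition slope_sv : {ffun I -> int} := [ffun i => sgz (be i)].
Definition nslope_sv : {ffun I -> int} := [ffun i => - sgz (be i)].
Definition base_sv : {ffun I -> int} := [ffun i => sgz (al i)].

Lemma root_between (x y t t' : R) : t < t' -> y != 0 ->
  (x + t * y < 0 < x + t' * y) \/ (x + t' * y < 0 < x + t * y) ->
  exists2 r, t < r < t' & x + r * y = 0.
Proof.
move=> tt' y0 h; exists (- x / y); last by rewrite divfK // subrr.
case: (ltrgtP y 0) y0 => // y0 _.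
  rewrite ltr_ndivlMr // ltr_ndivrMr //; nra.
rewrite ltr_pdivlMr // ltr_pdivrMr //; nra.
Qed.

Lemma line_sv_between t t' : t < t' ->
  (forall r i, t < r < t' -> be i != 0 -> al i + r * be i != 0) ->
  scomp (line_sv t) slope_sv = scomp (line_sv t') nslope_sv.
Proof.
move=> tt' h; apply/ffunP => i; rewrite !ffunE.
have nr : be i != 0 -> ~ ((al i + t * be i < 0 < al i + t' * be i) \/
    (al i + t' * be i < 0 < al i + t * be i)).
  move=> b0 /(root_between tt' b0)[r rt /eqP e]; move: (h r i rt b0).
  by rewrite e.
case: (sgzP (be i)) nr => [->|b0|b0] nr; first by rewrite !mulr0 addr0 oppr0.
- case: (sgzP (al i + t * be i)) => h1; case: (sgzP (al i + t' * be i)) => h2 //=;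
  exfalso; try nra; apply: nr; rewrite ?gt_eqF //; first [by right; apply/andP | by left; apply/andP].
- case: (sgzP (al i + t * be i)) => h1; case: (sgzP (al i + t' * be i)) => h2 //=;
  exfalso; try nra; apply: nr; rewrite ?lt_eqF //; first [by right; apply/andP | by left; apply/andP].
Qed.

Lemma line_sv_top t :
  (forall r i, t < r -> be i != 0 -> al i + r * be i != 0) ->
  scomp (line_sv t) slope_sv = scomp slope_sv base_sv.
Proof.
move=> h; apply/ffunP => i; rewrite !ffunE.
have nr : be i != 0 -> t < - al i / be i -> False.
  by move=> b0 /h/(_ b0); rewrite divfK // subrr eqxx.
case: (sgzP (be i)) nr => [->|b0|b0] nr.
- by rewrite mulr0 addr0 ?oppr0 /=; case: ifP => // /eqP.
- case: (sgzP (al i + t * be i)) => h1 //=; exfalso; apply: nr; rewrite ?gt_eqF //;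
  by rewrite ltr_pdivlMr //; lra.
- case: (sgzP (al i + t * be i)) => h1 //=; exfalso; apply: nr; rewrite ?lt_eqF //;
  by rewrite ltr_ndivlMr //; lra.
Qed.

Lemma line_sv_bottom t :
  (forall r i, r <= t -> be i != 0 -> al i + r * be i != 0) ->
  scomp (line_sv t) slope_sv = scomp nslope_sv base_sv.
Proof.
move=> h; apply/ffunP => i; rewrite !ffunE.
have nr : be i != 0 -> - al i / be i <= t -> False.
  by move=> b0 /h/(_ b0); rewrite divfK // subrr eqxx.
case: (sgzP (be i)) nr => [->|b0|b0] nr.
- by rewrite mulr0 addr0 ?oppr0 /=; case: ifP => // /eqP.
- case: (sgzP (al i + t * be i)) => h1 //=; exfalso; apply: nr; rewrite ?gt_eqF //;
  by rewrite ler_pdivrMr //; lra.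
- case: (sgzP (al i + t * be i)) => h1 //=; exfalso; apply: nr; rewrite ?lt_eqF //;
  by rewrite ler_ndivrMr //; lra.
Qed.

(** [scomp (line_sv t) slope_sv] is the sign vector just after [t], and the one with [nslope_sv]
    that just before [t]. They differ only at zeros of some [al i + t * be i], so other members of
    [B] contribute 0. The right-hand side compares the sign vectors at plus and minus infinity. *)
Lemma telescope (k : {ffun I -> int} -> int) (B : seq R) : uniq B ->
  (forall t i, be i != 0 -> al i + t * be i = 0 -> t \in B) ->
  \sum_(t <- B) (k (scomp (line_sv t) slope_sv) - k (scomp (line_sv t) nslope_sv))
  = k (scomp slope_sv base_sv) - k (scomp nslope_sv base_sv).
Proof.
move=> uB hB; pose S := sort <=%R B.
rewrite (perm_big S) /=; last by rewrite perm_sym perm_sort.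
have hS t i : be i != 0 -> al i + t * be i = 0 -> t \in S.
  by move=> b0 e; rewrite mem_sort (hB t i).
have sS : sorted <%R S by rewrite lt_sorted_uniq_le sort_uniq uB sort_sorted //; apply: le_total.
(* A starting point to the left of all breakpoints: the sign vector just after it is the one at
   minus infinity. *)
pose t0 := - (1 + \sum_(t <- S) `|t|).
have t0S t : t \in S -> t0 < t.
  move=> tS; rewrite /t0 ltrNl (big_rem t) //=.
  have := ler_norm (- t); rewrite normrN.
  have : 0 <= \sum_(y <- rem t S) `|y| by apply: sumr_ge0.
  lra.
have <- : scomp (line_sv t0) slope_sv = scomp nslope_sv base_sv.
  apply: line_sv_bottom => r i rt b0; apply/eqP => /(hS _ _ b0)/t0S.
  by rewrite ltNge rt.
have pS : path <%R t0 S.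
  by rewrite lt_path_sortedE sS andbT; apply/allP.
have {}hS r i : t0 < r -> be i != 0 -> al i + r * be i = 0 -> r \in S.
  by move=> _; apply: hS.
clearbody t0 S; move: t0 pS hS {t0S sS}; elim: S => [|t S ih] t0 /=.
  move=> _ h; rewrite big_nil line_sv_top ?subrr // => r i rt b0.
  by apply/eqP => /(h _ _ rt b0).
move=> /andP[t0t pS] h; rewrite big_cons (ih t) //; last first.
  move=> r i tr b0 e; have := h r i (lt_trans t0t tr) b0 e.
  by rewrite inE gt_eqF.
rewrite (@line_sv_between t0 t) // ; first by ring.
move=> r i /andP[t0r rt] b0; apply/eqP => /(h _ _ t0r b0); rewrite inE lt_eqF //=.
move=> rS; move: pS; rewrite lt_path_sortedE => /andP[/allP/(_ _ rS)].
by rewrite ltNge ltW.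
Qed.

End Telescoping.

(** * Iterated jumps along flags *)

Section FlagTransform.
Variables (R : realFieldType) (E : vectType R) (I : finType).
Variables (l : I -> 'Hom(E, R^o)) (b : I -> R) (u : {set I} -> E).
Local Notation dir := (dir l).
Local Notation flat := (flat l b).
Local Notation cov := (cov l b).
Local Notation sv := (sv l b).
Local Notation dv := (dv l).
Local Notation zs := (zs l b).
Local Notation pt := (pt l b).
Local Notation affv := (affv l b).
Local Notation svec := {ffun I -> int}.

Definition jump (v : E) (k : svec -> int) (s : svec) : int :=
  k (scomp s (dv v)) - k (scomp s (dv (- v))).

(* Flags are listed from the largest flat down to the vertex. *)
Fixpoint ftrans (s : seq {set I}) (X : {set I}) (k : svec -> int) : int :=
  match s with
  | [::] => if \dim (dir X) == 0%N then k (sv (pt X)) else 0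
  | Y :: s' => if cov X Y then ftrans s' Y (jump (u X) k) else 0
  end.

Definition flagp (X : {set I}) (s : seq {set I}) : bool :=
  path cov X s && (\dim (dir (last X s)) == 0%N).

(** The head [X] of the flag is left implicit. The sum runs over all sets [Y]; those that do not
    complete a flag contribute 0 by the first clause. *)
Definition flag_cycle (X : {set I}) (c : seq {set I} -> int) : Prop :=
  (forall s, c s != 0 -> flagp X s) /\
  (forall s1 s2, \sum_(Y : {set I}) c (s1 ++ Y :: s2) = 0).

(* Boundedness in the subarrangement [J], as absence of recession directions. *)
Definition bnd (J X : {set I}) (s : svec) : Prop :=
  forall v, v \in dir X ->
    (forall i, i \in J -> dv v i = 0 \/ dv v i = s i) -> v = 0.

Definition bsupp (J X : {set I}) (k : svec -> int) : Prop :=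
  forall x, zs x = X -> k (sv x) != 0 -> bnd J X (sv x).

(** A short step from [Y] along [v] leaves every hyperplane that contains [Y] but not [X]: one
    parallel to [v] would put [v] in [dir Y] by [cov_dir]. *)
Lemma scomp_facet X Y y v : cov X Y -> zs y = Y -> v \in dir X -> v \notin dir Y ->
  exists2 x, zs x = X & sv x = scomp (sv y) (dv v).
Proof.
move=> cXY zy vX vY; have [x [sx zx _]] := sv_comp l b y v.
exists x => //; rewrite zx zy; apply/setP => i; rewrite inE.
have [_ _ /subsetP XY _] := covP cXY.
apply/andP/idP => [[iY /eqP iv]|iX]; last by rewrite XY //; move/dirP: vX => ->.
apply/negPn/negP => iX; case/negP: vY; exact: (cov_dir cXY iY iX).
Qed.

Lemma jump_eq v k k' s :
  k (scomp s (dv v)) = k' (scomp s (dv v)) ->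
  k (scomp s (dv (- v))) = k' (scomp s (dv (- v))) -> jump v k s = jump v k' s.
Proof. by rewrite /jump => -> ->. Qed.

Lemma jump_sum (J : Type) (r : seq J) (P : pred J) (k : J -> svec -> int) v s :
  jump v (fun s => \sum_(j <- r | P j) k j s) s = \sum_(j <- r | P j) jump v (k j) s.
Proof. by rewrite /jump -sumrB. Qed.

Lemma ftrans_sum (J : Type) (r : seq J) (P : pred J) (k : J -> svec -> int) s X :
  ftrans s X (fun t => \sum_(j <- r | P j) k j t) = \sum_(j <- r | P j) ftrans s X (k j).
Proof.
elim: s X k => [|Y s ih] X k /=; case: ifP => _ //; try by rewrite big1.
by rewrite -ih; congr ftrans; apply/funext => t; exact: jump_sum.
Qed.

Lemma ftransZ (a : int) k s X : ftrans s X (fun t => a * k t) = a * ftrans s X k.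
Proof.
elim: s X k => [|Y s ih] X k /=; case: ifP => _ //; rewrite ?mulr0 //.
by rewrite -ih; congr ftrans; apply/funext => t; rewrite /jump mulrBr.
Qed.

Lemma ftransB k k' s X :
  ftrans s X (fun t => k t - k' t) = ftrans s X k - ftrans s X k'.
Proof.
elim: s X k k' => [|Y s ih] X k k' /=; case: ifP => _ //; rewrite ?subr0 //.
by rewrite -ih; congr ftrans; apply/funext => t; rewrite /jump; ring.
Qed.

Lemma ftransD k k' s X :
  ftrans s X (fun t => k t + k' t) = ftrans s X k + ftrans s X k'.
Proof.
elim: s X k k' => [|Y s ih] X k k' /=; case: ifP => _ //; rewrite ?addr0 //.
by rewrite -ih; congr ftrans; apply/funext => t; rewrite /jump; ring.
Qed.

Hypothesis gu : generic_dirs l b u.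

Lemma cov_dim_gt0 X Y : cov X Y -> (0 < \dim (dir X))%N.
Proof. by move=> /covP[_ _ _ ->]. Qed.

Lemma u_in X Y : cov X Y -> u X \in dir X.
Proof. by move=> /cov_dim_gt0; case: gu => + _ _ _; apply. Qed.

Lemma u_notin X Y : cov X Y -> u X \notin dir Y.
Proof. by case: gu => _ + _ _; apply. Qed.

Lemma facet_up X Y y : cov X Y -> zs y = Y ->
  exists2 x, zs x = X & sv x = scomp (sv y) (dv (u X)).
Proof.
by move=> c zy; apply: (scomp_facet c zy); [exact: u_in c|exact: u_notin].
Qed.

Lemma facet_down X Y y : cov X Y -> zs y = Y ->
  exists2 x, zs x = X & sv x = scomp (sv y) (dv (- u X)).
Proof.
move=> c zy; apply: (scomp_facet c zy); rewrite memvN; [exact: u_in c|exact: u_notin].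
Qed.

Lemma ftrans_ext s X k k' : flat X ->
  (forall x, zs x = X -> k (sv x) = k' (sv x)) -> ftrans s X k = ftrans s X k'.
Proof.
elim: s X k k' => [|Y s ih] X k k' fX h /=.
  by case: ifP => // _; rewrite h // zs_pt.
case: ifP => // c; apply: ih => [|y zy]; first by have [] := covP c.
have [x zx sx] := facet_up c zy; have [x' zx' sx'] := facet_down c zy.
by apply: jump_eq; rewrite -?sx -?sx' h.
Qed.

Lemma ftrans0 s X k : flat X -> (forall x, zs x = X -> k (sv x) = 0) ->
  ftrans s X k = 0.
Proof.
move=> fX h; rewrite (@ftrans_ext s X k (fun t => 0 * k t)) ?ftransZ ?mul0r //.
by move=> x zx; rewrite mul0r h.
Qed.

Lemma ftrans_flagp s X k : ftrans s X k != 0 -> flagp X s.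
Proof.
rewrite /flagp; elim: s X k => [|Y s ih] X k /=; case: ifP => //=; rewrite ?eqxx //.
by move=> _ /ih.
Qed.

(** A recession direction of the face [y] vanishes wherever [sv y] does, hence is also one of the
    cell [x]. *)
Lemma bnd_facet J X Y y x v : cov X Y -> zs y = Y -> sv x = scomp (sv y) (dv v) ->
  bnd J X (sv x) -> bnd J Y (sv y).
Proof.
move=> c zy sx bx w wY h; apply: bx => [|i iJ].
  by have [_ _ XY _] := covP c; exact: (subvP (dirS l XY)).
rewrite sx scompE; have [h0|h0] := h i iJ; first by left.
by case: eqP => e; [left; rewrite h0 e|right; rewrite h0].
Qed.

Lemma bsupp_jump J X Y k : cov X Y -> bsupp J X k -> bsupp J Y (jump (u X) k).
Proof.
move=> c bk y zy; rewrite /jump => jn.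
have [x zx sx] := facet_up c zy; have [x' zx' sx'] := facet_down c zy.
case: (eqVneq (k (sv x)) 0) => [k0|/(bk _ zx)]; last exact: bnd_facet c zy sx.
case: (eqVneq (k (sv x')) 0) => [k0'|/(bk _ zx')]; last exact: bnd_facet c zy sx'.
by move: jn; rewrite -sx -sx' k0 k0' subrr eqxx.
Qed.

(** With [t = e^-1], the value [affv i (x + t *: v)] is [t] times [l i v + e * affv i x], a small
    perturbation of [l i v]. *)
Lemma sv_infty x v : exists y,
  [/\ sv y = scomp (dv v) (sv x), zs y = [set i in zs x | l i v == 0 :> R]
    & exists2 t, 0 < t & y = x + t *: v].
Proof.
have [|e e0 he] := @fin_eps R I (fun i t => sgz (l i v + t * affv i x) =
   if sgz (l i v : R) == 0 then sgz (affv i x) else sgz (l i v : R)).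
  by move=> i; exact: sgz_eps.
have h i : sv (x + e^-1 *: v) i = scomp (dv v) (sv x) i.
  rewrite !ffunE -(he e) ?e0 ?lexx // affvD lZ.
  have -> : affv i x + e^-1 * l i v = e^-1 * (l i v + e * affv i x).
    by rewrite mulrDr mulrA mulVf ?mul1r ?lt0r_neq0 // addrC.
  by rewrite sgzM gtr0_sgz ?mul1r // invr_gt0.
exists (x + e^-1 *: v); split; first by apply/ffunP => i; rewrite h.
  apply/setP => i; rewrite -(sv_eq0 l b) h scompE [in RHS]inE.
  have e' : (dv v i == 0) = (l i v == 0 :> R) by rewrite dvE sgz_eq0.
  by rewrite -e'; case: ifP => h0; rewrite ?h0 ?andbT ?andbF ?sv_eq0.
by exists e^-1; rewrite ?invr_gt0.
Qed.

(** The cell met far out along [v] has [v] as a recession direction. *)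
Lemma unbounded_infty k X x v : bsupp [set: I] X k -> zs x = X -> v \in dir X ->
  v != 0 -> k (scomp (dv v) (sv x)) = 0.
Proof.
move=> bk zx vX v0; have [y [sy zy _]] := sv_infty x v.
have zyX : zs y = X.
  rewrite zy zx; apply/setP => i; rewrite inE.
  by case: (boolP (i \in X)) => // iX; move/dirP: vX => ->; rewrite ?eqxx.
apply/eqP; apply/negPn/negP => kn; case/negP: v0; apply/eqP.
apply: (bk y zyX) => [|//|i _]; rewrite sy // scompE.
by case: eqP => h; [left|right].
Qed.

(** The vertices are the breakpoints of [k] along the line [X]; the end terms belong to the
    unbounded cells at both ends, where [k] vanishes. *)
Lemma jump_sum_line X k : \dim (dir X) = 1%N -> bsupp [set: I] X k ->
  \sum_(Y | cov X Y) jump (u X) k (sv (pt Y)) = 0.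
Proof.
move=> dX bk; have [/existsP[Y0 c0]|] := boolP [exists Y, cov X Y]; last first.
  by rewrite negb_exists => /forallP h; rewrite big1 // => Y c; case/negP: (h Y).
have [fX _ _ _] := covP c0; have uX := u_in c0.
have un0 : u X != 0 by apply: contra (u_notin c0) => /eqP ->; exact: mem0v.
pose x0 := pt X; have zx0 : zs x0 = X by exact: zs_pt.
have lin v : v \in dir X -> exists t, v = t *: u X.
  move=> vX; have : (<[u X]> == dir X)%VS by rewrite eqEdim -memvE uX dX dim_vline un0.
  by move=> /eqP e; move: vX; rewrite -e => /vlineP.
have tP Y : exists t, cov X Y -> pt Y = x0 + t *: u X.
  case: (boolP (cov X Y)) => [c|_]; last by exists 0.
  have [_ fY XY _] := covP c.
  have [|t e] := lin (pt Y - x0); first by apply: (@sub_dir_zs _ _ _ l b); rewrite ?zx0 ?zs_pt.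
  by exists t => _; rewrite -e addrC subrK.
pose tt Y := projT1 (cid (tP Y)).
have ttP Y : cov X Y -> pt Y = x0 + tt Y *: u X by exact: projT2 (cid (tP Y)).
pose B := [seq tt Y | Y <- enum (cov X)].
have uB : uniq B.
  rewrite map_inj_in_uniq ?enum_uniq // => Y Y'; rewrite !mem_enum => c c' e.
  have [_ fY _ _] := covP c; have [_ fY' _ _] := covP c'.
  by rewrite -(zs_pt fY) -(zs_pt fY') (ttP _ c) (ttP _ c') e.
pose al i := affv i x0; pose be i : R := l i (u X).
have hB t i : be i != 0 -> al i + t * be i = 0 -> t \in B.
  move=> bi e; pose y := x0 + t *: u X.
  have iy : i \in zs y by rewrite in_zs affvD lZ -/(al i) -/(be i) e.
  have XY : X \subset zs y by apply: subset_zsD; rewrite ?zx0 ?memvZ.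
  have iX : i \notin X by apply: contra bi => iX; move/dirP: uX => /(_ i iX) h; rewrite /be h.
  have nXY : X != zs y by apply: contraNneq iX => ->.
  have dY := dim_lt fX (flat_zs l b y) XY nXY.
  have dY0 : \dim (dir (zs y)) = 0%N by move: dY; rewrite dX; case: (\dim _).
  have c : cov X (zs y) by rewrite /cov fX flat_zs XY dX dY0.
  have yE : y = pt (zs y).
    apply/eqP; rewrite -subr_eq0 -memv0.
    move/eqP: dY0; rewrite dimv_eq0 => /eqP <-.
    by apply: (@sub_dir_zs _ _ _ l b); rewrite ?zs_pt ?flat_zs.
  apply/mapP; exists (zs y); rewrite ?mem_enum //.
  have := ttP _ c; rewrite -yE => /addrI/eqP; rewrite -subr_eq0 -scalerBl scaler_eq0.
  by rewrite (negPf un0) orbF subr_eq0 => /eqP.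
have := telescope k uB hB.
rewrite big_map big_enum_cond /= => h.
have lE t : line_sv al be t = sv (x0 + t *: u X).
  by apply/ffunP => i; rewrite !ffunE affvD lZ.
have sE : slope_sv be = dv (u X) by apply/ffunP => i; rewrite !ffunE.
have nE : nslope_sv be = dv (- u X) by apply/ffunP => i; rewrite dvN !ffunE.
have bE : base_sv al = sv x0 by apply/ffunP => i; rewrite !ffunE.
transitivity (k (scomp (dv (u X)) (sv x0)) - k (scomp (dv (- u X)) (sv x0))); last first.
  by rewrite !(unbounded_infty bk zx0) ?oppr_eq0 ?memvN ?subr0.
rewrite -sE -nE -bE -h; apply: eq_big => [Y|Y c]; first by rewrite andbT.
by rewrite /jump lE sE nE -ttP.
Qed.

End FlagTransform.

(** * Iterated jumps form a flag cycle *)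

Section TransformCycle.
Variables (R : realFieldType) (E : vectType R) (I : finType).
Variables (l : I -> 'Hom(E, R^o)) (b : I -> R) (u : {set I} -> E).
Hypothesis gu : generic_dirs l b u.
Local Notation dir := (dir l).
Local Notation flat := (flat l b).
Local Notation cov := (cov l b).
Local Notation sv := (sv l b).
Local Notation dv := (dv l).
Local Notation zs := (zs l b).
Local Notation pt := (pt l b).
Local Notation affv := (affv l b).
Local Notation svec := {ffun I -> int}.
Local Notation jump := (jump l).
Local Notation ftrans := (ftrans l b u).
Local Notation flagp := (flagp l b).
Local Notation flag_cycle := (flag_cycle l b).
Local Notation bnd := (bnd l).
Local Notation bsupp := (bsupp l b).

(** When [K] is a flat, the smallest flat that contains it and whose directions include [w]. *)
Definition star (K : {set I}) (w : E) : {set I} := [set i in K | l i w == 0 :> R].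

Lemma star_flat z K w : zs z = K -> flat (star K w).
Proof.
by move=> zz; have [x [_ zx _]] := sv_comp l b z w; rewrite /star -zz -zx flat_zs.
Qed.

Lemma star_dir (K : {set I}) w : w \in dir (star K w).
Proof. by apply/dirP => i; rewrite inE => /andP[_ /eqP]. Qed.

Lemma star_cov X Y K : cov X Y -> cov Y K -> star K (u Y) = Y.
Proof.
move=> c c'; have [_ fK YK _] := covP c'; have [x [_ zx _]] := sv_comp l b (pt K) (u Y).
apply/setP => i; rewrite inE; apply/andP/idP => [[iK /eqP iv]|iY].
  apply/negPn/negP => iY; case/negP: (u_notin gu c').
  exact: (cov_dir c' iK iY (u_in gu c')).
by split; [exact: (subsetP YK)|have /dirP -> := u_in gu c'].
Qed.

Lemma star_between X K w i : flat X -> flat K -> X \subset K ->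
  \dim (dir X) = (\dim (dir K)).+2 -> w \in dir X -> w \notin dir K ->
  i \in star K w -> i \notin X -> cov X (star K w) /\ cov (star K w) K.
Proof.
move=> fX fK XK dXK wX wK iS iX; have fS := star_flat w (zs_pt fK).
have XS : X \subset star K w.
  apply/subsetP => j jX; rewrite inE (subsetP XK) //=; by move/dirP: wX => /(_ j jX) ->.
have SK : star K w \subset K by apply/subsetP => j; rewrite inE => /andP[].
have d1 : (\dim (dir (star K w)) < \dim (dir X))%N.
  by apply: (dim_lt fX fS XS); apply: contraNneq iX => ->.
have d2 : (\dim (dir K) < \dim (dir (star K w)))%N.
  by apply: (dim_lt fS fK SK); apply: contraNneq wK => <-; exact: star_dir.
rewrite /cov fX fS fK XS SK /=; split; apply/eqP; lia.
Qed.

(** Near [z] only the hyperplanes of [K] matter, and modulo [dir K] the flat [X] is a plane crossed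
    by the lines spanned by the [u Y]. The outer jump splits the sum into a telescoping sum along
    the line of the [u Y] minus one along the line of the [- u Y]. *)
Lemma jump_sum_plane X K k z : zs z = K ->
  \sum_(Y | cov X Y && cov Y K) jump (u Y) (jump (u X) k) (sv z) = 0.
Proof.
move=> zK; have [/existsP[Y0 /andP[c0 c0']]|] :=
  boolP [exists Y, cov X Y && cov Y K]; last first.
  by rewrite negb_exists => /forallP h; rewrite big1 // => Y c; case/negP: (h Y).
have [fX fY0 XY0 dX] := covP c0; have [_ fK YK0 dY] := covP c0'.
have XK : X \subset K := subset_trans XY0 YK0.
have dXK : \dim (dir X) = (\dim (dir K)).+2 by rewrite dX dY.
have uX := u_in gu c0; set u0 := u Y0.
have u0Y : u0 \in dir Y0 := u_in gu c0'.
have u0X : u0 \in dir X := subvP (dirS l XY0) _ u0Y.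
have uXK : u X \notin dir K.
  by apply: contra (u_notin gu c0); exact: (subvP (dirS l YK0)).
have tP Y : exists t, cov X Y -> u Y = u0 + t *: u X.
  case: (boolP (cov X Y)) => [c|_]; last by exists 0.
  by case: gu => _ _ /(_ X Y0 Y c0 c (cov_dim_gt0 c0'))[t e] _; exists t.
pose tt Y := projT1 (cid (tP Y)).
have ttP Y : cov X Y -> u Y = u0 + tt Y *: u X by exact: projT2 (cid (tP Y)).
pose P Y := cov X Y && cov Y K.
(* Hyperplanes off [K] are switched off: their sign at [z] is nonzero and decides. *)
pose al i : R := if i \in K then l i u0 else 0.
pose be i : R := if i \in K then l i (u X) else 0.
have inj : {in enum P &, injective tt}.
  move=> Y Y'; rewrite !mem_enum => /andP[c1 c1'] /andP[c2 c2'] e.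
  by rewrite -(star_cov c1 c1') -(star_cov c2 c2') (ttP _ c1) (ttP _ c2) e.
(* Every breakpoint is some [tt Y]: the flat [star K w] lies strictly between [X] and [K], and its
   chosen direction can only be [w]. *)
have hB t i : be i != 0 -> al i + t * be i = 0 -> exists2 Y, P Y & tt Y = t.
  rewrite /al /be; case: ifP => iK; last by rewrite eqxx.
  move=> bi e; pose w := u0 + t *: u X.
  have wK : w \notin dir K by case: gu => _ _ _; apply; [exact: c0|exact: c0'].
  have wX : w \in dir X by rewrite memvD ?memvZ.
  have iS : i \in star K w by rewrite inE iK linearD /= lZ e eqxx.
  have iX : i \notin X by apply: contra bi => iX; move/dirP: uX => -> //.
  have [c c'] := star_between fX fK XK dXK wX wK iS iX.
  exists (star K w); first by apply/andP.
  have := memvB (u_in gu c') (star_dir K w).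
  rewrite (ttP _ c) opprD addrACA subrr add0r -scalerBl => h.
  apply/eqP; rewrite -subr_eq0; apply: contraNT (u_notin gu c) => n0.
  by move: h => /(memvZ (tt (star K w) - t)^-1); rewrite scalerA mulVf ?scale1r.
(* As [- u Y] is [- u0 + (- tt Y) *: u X], the breakpoints on the opposite line are the
   negatives. *)
pose B := [seq tt Y | Y <- enum P]; pose B' := [seq - tt Y | Y <- enum P].
have uB : uniq B by rewrite map_inj_in_uniq ?enum_uniq.
have uB' : uniq B'.
  by rewrite map_inj_in_uniq ?enum_uniq // => Y Y' h h' /oppr_inj; exact: inj.
pose k1 s := k (scomp (sv z) s).
have k1E (s s' : svec) : (forall i, i \in K -> s i = s' i) -> k1 s = k1 s'.
  move=> h; rewrite /k1; congr k; apply/ffunP => i; rewrite !scompE sv_eq0 zK.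
  by case: ifP => // /h.
have hB1 t i : be i != 0 -> al i + t * be i = 0 -> t \in B.
  by move=> bi /(hB _ _ bi)[Y PY <-]; rewrite map_f // mem_enum.
have hB2 t i : be i != 0 -> - al i + t * be i = 0 -> t \in B'.
  move=> bi e; have [|Y PY tY] := hB (- t) i bi; first by lra.
  by rewrite -[t]opprK -tY (map_f (fun Y => - tt Y)) // mem_enum.
have T1 := telescope k1 uB hB1; have T2 := telescope k1 uB' hB2.
rewrite !big_map !big_enum_cond /= in T1 T2.
transitivity (\sum_(Y | P Y)
   (k1 (scomp (line_sv al be (tt Y)) (slope_sv be)) -
    k1 (scomp (line_sv al be (tt Y)) (nslope_sv be))) -
  \sum_(Y | P Y)
   (k1 (scomp (line_sv (fun i => - al i) be (- tt Y)) (slope_sv be)) -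
    k1 (scomp (line_sv (fun i => - al i) be (- tt Y)) (nslope_sv be)))).
  rewrite -sumrB; apply: eq_bigr => Y /andP[c c'].
  have A (s t t' : svec) : (forall i, i \in K -> t i = t' i) ->
      k (scomp (scomp (sv z) s) t) = k1 (scomp s t').
    move=> h; rewrite /k1; congr k; apply/ffunP => i; rewrite !scompE sv_eq0 zK.
    have := sv_eq0 l b z i; rewrite zK; case: (boolP (i \in K)) => iK e /=.
      by rewrite h.
    by rewrite e.
  have e1 i : i \in K -> dv (u Y) i = line_sv al be (tt Y) i.
    by move=> iK; rewrite !ffunE (ttP _ c) linearD /= lZ /al /be iK.
  have e2 i : i \in K -> dv (- u Y) i = line_sv (fun i => - al i) be (- tt Y) i.
    move=> iK; rewrite !ffunE (ttP _ c) linearN linearD /= lZ /al /be iK.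
    by congr sgz; lra.
  have e3 i : i \in K -> dv (u X) i = slope_sv be i.
    by move=> iK; rewrite !ffunE /be iK.
  have e4 i : i \in K -> dv (- u X) i = nslope_sv be i.
    by move=> iK; rewrite dvN !ffunE /be iK.
  rewrite /jump (A _ _ _ e3) (A _ _ _ e4) (A _ _ _ e3) (A _ _ _ e4).
  by congr (_ - _ - (_ - _)); apply: k1E => i iK; rewrite !scompE ?e1 ?e2.
have T1' : \sum_(Y | P Y)
   (k1 (scomp (line_sv al be (tt Y)) (slope_sv be)) -
    k1 (scomp (line_sv al be (tt Y)) (nslope_sv be))) =
   k1 (scomp (slope_sv be) (base_sv al)) - k1 (scomp (nslope_sv be) (base_sv al)).
  by rewrite -T1; apply: eq_bigl => Y; rewrite andbT.
have T2' : \sum_(Y | P Y)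
   (k1 (scomp (line_sv (fun i => - al i) be (- tt Y)) (slope_sv be)) -
    k1 (scomp (line_sv (fun i => - al i) be (- tt Y)) (nslope_sv be))) =
   k1 (scomp (slope_sv be) (base_sv (fun i => - al i))) -
   k1 (scomp (nslope_sv be) (base_sv (fun i => - al i))).
  by rewrite -T2; apply: eq_bigl => Y; rewrite andbT.
rewrite T1' T2'.
(* At the ends [be] decides the sign, and [al] only where [be] vanishes. By genericity of [u X] this
   happens only on [X], where [al] vanishes too; so both lines have the same ends. *)
have al0 i : i \in K -> be i = 0 -> al i = 0.
  rewrite /be /al => iK; rewrite iK => bi.
  have iS : i \in star K (u X) by rewrite inE iK bi eqxx.
  have [iX|iX] := boolP (i \in X); first by move/dirP: u0X => ->.
  have [c c'] := star_between fX fK XK dXK uX uXK iS iX.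
  by case/negP: (u_notin gu c); exact: star_dir.
apply/eqP; rewrite subr_eq0; apply/eqP.
by congr (_ - _); apply: k1E => i iK; rewrite !scompE !ffunE ?oppr_eq0 !sgz_eq0;
  case: (be i =P 0) => // /(al0 _ iK) ->; rewrite oppr0.
Qed.

(** The prefix [s1] is peeled off by [bsupp_jump]. What remains is the condition at the first place:
    on a line if nothing follows, in a plane modulo [K] otherwise. *)
Lemma ftrans_fcycle X k : flat X -> bsupp [set: I] X k ->
  flag_cycle X (fun s => ftrans s X k).
Proof.
move=> fX bk; split=> [s|s1 s2]; first exact: ftrans_flagp.
elim: s1 X k fX bk => [|Z s1 ih] X k fX bk /=; last first.
  case: (boolP (cov X Z)) => c; last by rewrite big1.
  by apply: ih; [have [] := covP c|exact: bsupp_jump].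
case: s2 => [|K s2] /=.
  have [/existsP[Y /andP[c /eqP dY]]|] :=
      boolP [exists Y, cov X Y && (\dim (dir Y) == 0%N)]; last first.
    rewrite negb_exists => /forallP h; rewrite big1 // => Y _.
    by have := h Y; case: (cov X Y) => //= /negPf ->.
  have dX : \dim (dir X) = 1%N by have [_ _ _ ->] := covP c; rewrite dY.
  apply: etrans (jump_sum_line gu dX bk); rewrite [RHS]big_mkcond /=; apply: eq_bigr => Y' _.
  case: ifP => // c'; have [_ _ _ dY'] := covP c'.
  by move: dY'; rewrite dX => -[<-].
transitivity (\sum_(Y | cov X Y && cov Y K) ftrans s2 K (jump (u Y) (jump (u X) k))).
  rewrite [RHS]big_mkcond /=; apply: eq_bigr => Y _.
  by case: (cov X Y); case: (cov Y K).
rewrite -ftrans_sum.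
have [/existsP[Y /andP[c c']]|] := boolP [exists Y, cov X Y && cov Y K]; last first.
  rewrite negb_exists => /forallP h; rewrite ftrans_sum big1 // => Y c.
  by case/negP: (h Y).
apply: (ftrans0 gu); first by have [] := covP c'.
by move=> z zK; exact: jump_sum_plane.
Qed.

End TransformCycle.

(** * Walks through cells, and injectivity *)

Section Walk.
Variables (R : realFieldType) (E : vectType R) (I : finType).
Variables (l : I -> 'Hom(E, R^o)) (b : I -> R) (u : {set I} -> E).
Hypothesis gu : generic_dirs l b u.
Local Notation dir := (dir l).
Local Notation flat := (flat l b).
Local Notation cov := (cov l b).
Local Notation sv := (sv l b).
Local Notation dv := (dv l).
Local Notation zs := (zs l b).
Local Notation pt := (pt l b).
Local Notation affv := (affv l b).
Local Notation svec := {ffun I -> int}.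
Local Notation jump := (jump l).
Local Notation ftrans := (ftrans l b u).
Local Notation flagp := (flagp l b).
Local Notation flag_cycle := (flag_cycle l b).
Local Notation bnd := (bnd l).
Local Notation bsupp := (bsupp l b).

Lemma sgz_cases (a c : R) : c != 0 -> sgz a != 0 -> sgz a != sgz c -> a * c < 0.
Proof. by case: (sgzP a) => // h1; case: (sgzP c) => // h2 _ _ _; nra. Qed.

Lemma sgz_same (a c : R) : 0 < a * c -> sgz a = sgz c.
Proof. by move=> /gtr0_sgz; rewrite sgzM; case: (sgzP a); case: (sgzP c). Qed.

(** The ray from [p] through [x] leaves the bounded cell, so far out it violates a facet inequality
    [h]. Along the ray [affv h] moves from its sign at [x] towards zero and beyond, so [p] lies on
    the same side of [h] as [x]. *)
Lemma facet_toward X x p : zs x = X -> X \subset zs p -> (0 < \dim (dir X))%N ->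
  bnd [set: I] X (sv x) ->
  exists Y y h, [/\ cov X Y /\ zs y = Y, h \in Y, h \notin X,
    0 < affv h p * affv h x & forall i, i \notin Y -> sv y i = sv x i].
Proof.
move=> zx Xp dX bx.
have xn i : i \notin X -> sv x i != 0 by rewrite sv_eq0 zx.
pose P (K : {set I}) := `[< forall y, X \subset zs y ->
  (forall i, i \in K -> sv y i = sv x i) -> forall i, i \notin X -> sv y i = sv x i >].
have PC : P (~: X).
  by apply/asboolP => y _ h i iX; apply: h; rewrite inE.
(* The facets of a cell are the members of an irredundant system of inequalities. *)
have [K /minsetP[/asboolP PK Kmin] KX] := minset_exists PC.
have {}KX i : i \in K -> i \notin X by move=> /(subsetP KX); rewrite inE.
(* Any nonzero direction will do when [x = p]. *)
have [w [wX w0 wp]] : exists w, [/\ w \in dir X, w != 0 & x != p -> w = x - p].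
  case: (eqVneq x p) => [_|xp].
    by exists (vpick (dir X)); rewrite memv_pick vpick0 -dimv_eq0 -lt0n dX.
  exists (x - p); split=> //; last by rewrite subr_eq0.
  by apply: (@sub_dir_zs _ _ _ l b) => //; rewrite zx.
have [i [iw1 iw2]] : exists i, dv w i != 0 /\ dv w i != sv x i.
  apply: contrapT => h; case/negP: w0; apply/eqP; apply: bx => // i _.
  case: (eqVneq (dv w i) 0) => [|h1]; first by left.
  by right; apply/eqP; apply: contrapT => /negP h2; apply: h; exists i.
have iX : i \notin X.
  apply: contra iw1 => iX; rewrite dvE; move/dirP: wX => /(_ i iX) ->.
  by rewrite sgz0.
have [yo [syo _ [t t0 yoE]]] := sv_infty l b x w.
have Xyo : X \subset zs yo by rewrite yoE; apply: subset_zsD; rewrite ?zx ?memvZ.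
have [h [hK hn]] : exists h, h \in K /\ sv yo h != sv x h.
  apply: contrapT => nh; case/negP: iw2; apply/eqP.
  have <- : sv yo i = dv w i by rewrite syo scompE (negPf iw1).
  apply: (PK yo Xyo) => // j jK; apply/eqP; apply: contrapT => /negP nj.
  by apply: nh; exists j.
have hX := KX h hK; have rn := xn h hX; set r := affv h x.
have r0 : r != 0 by move: rn; rewrite svE sgz_eq0.
have [hw1 hw2] : dv w h != 0 /\ dv w h != sv x h.
  by move: hn; rewrite syo scompE; case: ifP => [_|h0]; rewrite ?eqxx // h0.
have lr : l h w * r < 0 by apply: sgz_cases; rewrite -?dvE -?svE.
have hp : 0 < affv h p * r.
  case: (eqVneq x p) => [<-|xp]; first by rewrite -expr2 exprn_even_gt0.
  have -> : affv h p = r - l h w.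
    by rewrite (wp xp) -(affvB l b) opprB addrC subrK.
  by rewrite mulrBl subr_gt0 (lt_trans lr) // -expr2 exprn_even_gt0.
(* By minimality of [K] some [y'] violates [h] but no other inequality of [K]; the segment from [x]
   to [y'] meets [h] inside the facet, at the parameter [la]. *)
have [y' [Xy' y'K hy']] : exists y', [/\ X \subset zs y',
    forall j, j \in K -> j != h -> sv y' j = sv x j & sv y' h != sv x h].
  have : ~ P (K :\ h).
    by move=> /Kmin /(_ (subD1set _ _)) e; move: hK; rewrite -e !inE eqxx.
  move=> /negP/asboolPn/existsNP[y' /not_implyP[Xy' /not_implyP[y'K ny']]].
  exists y'; split=> // [j jK jh|]; first by apply: y'K; rewrite !inE jh.
  apply/eqP => e; apply: ny'; apply: PK => // j jK.
  by case: (eqVneq j h) => [->//|jh]; apply: y'K; rewrite !inE jh.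
set q := affv h y' in hy'.
have qr : q * r <= 0.
  case: (eqVneq (sgz q) 0) => [/eqP|qn].
    by rewrite sgz_eq0 => /eqP ->; rewrite mul0r.
  apply/ltW/(sgz_cases r0 qn); move: hy'; rewrite !svE; exact.
have rq : r - q != 0.
  apply: contraTneq qr => /eqP; rewrite subr_eq0 => /eqP <-.
  by rewrite -expr2 -ltNge exprn_even_gt0.
pose la := r / (r - q).
have la0 : 0 < la.
  have -> : la = (r * (r - q)) / (r - q) ^+ 2 by rewrite /la; field.
  rewrite divr_gt0 ?exprn_even_gt0 //.
  have : 0 < r ^+ 2 by rewrite exprn_even_gt0.
  nra.
have la1 : la <= 1.
  rewrite -subr_ge0; have -> : 1 - la = (q ^+ 2 - q * r) / (r - q) ^+ 2.
    by rewrite /la; field.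
  rewrite divr_ge0 ?sqr_ge0 // subr_ge0 (le_trans qr) ?sqr_ge0 //.
pose y := x + la *: (y' - x).
have yE j : affv j y = (1 - la) * affv j x + la * affv j y'.
  by rewrite affvD lZ -(affvB l b); ring.
have hy : affv h y = 0 by rewrite yE -/r -/q /la; field.
have yK j : j \in K -> j != h -> sv y j = sv x j.
  move=> jK jh; have := y'K j jK jh; have := xn j (KX j jK).
  rewrite !svE yE; case: (sgzP (affv j x)) => // h1 _; case: (sgzP (affv j y')) => // h2 _.
    by apply/gtr0_sgz; nra.
  by apply/ltr0_sgz; nra.
have Xy : X \subset zs y.
  apply: subset_zsD; rewrite ?zx // memvZ //.
  by apply: (@sub_dir_zs _ _ _ l b) => //; rewrite zx.
have xyX : x - y \in dir X by apply: (@sub_dir_zs _ _ _ l b) => //; rewrite zx.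
have hxy : l h (x - y) = r :> R by rewrite -(affvB l b) hy subr0.
(* From a point of [h] that satisfies the other inequalities of [K], a short step along [x - y]
   enters the cell; so its nonzero signs off [X] are those of [x]. *)
have toward y1 : X \subset zs y1 -> affv h y1 = 0 ->
    (forall j, j \in K -> j != h -> sv y1 j = sv x j) ->
    forall j, j \notin X -> sv y1 j != 0 -> sv y1 j = sv x j.
  move=> Xy1 hy1 y1K j jX j0.
  have [y2 [sy2 _ [t2 _ y2E]]] := sv_comp l b y1 (x - y).
  have Xy2 : X \subset zs y2 by rewrite y2E; apply: subset_zsD; rewrite ?memvZ.
  have := PK y2 Xy2 _ j jX; rewrite sy2 scompE (negPf j0); apply => m mK.
  rewrite scompE; case: (eqVneq m h) => [->|mh].
    by rewrite sv_eq0 in_zs hy1 eqxx dvE hxy svE.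
  by rewrite (y1K m mK mh); case: ifP => // /negP; case; apply/negP/xn/KX.
have yY i' : i' \notin zs y -> sv y i' = sv x i'.
  move=> iY; apply: toward => //; last by rewrite sv_eq0.
  by apply: contra iY; exact: (subsetP Xy).
(* This gives codimension one: if a hyperplane [j] through [y] were not parallel to [v], moving [y]
   within [h] along [v] or [- v] would produce the wrong sign at [j]. *)
have cutY v : v \in dir X -> l h v = 0 -> v \in dir (zs y).
  move=> vX hv; apply/dirP => j jY; apply/eqP; apply/negPn/negP => jv.
  have jX : j \notin X by apply: contra jv => jX; move/dirP: vX => /(_ j jX) ->.
  wlog jvx : v vX hv jv / dv v j != sv x j.
    move=> hw; have [e|] := eqVneq (dv v j) (sv x j); last exact: hw.
    apply: (hw (- v)); first by rewrite memvN.
    - by rewrite linearN /= hv oppr0.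
    - by rewrite linearN /= oppr_eq0.
    - by rewrite dvN e eqNr xn.
  have [y1 [sy1 _ [t1 _ y1E]]] := sv_comp l b y v.
  have y1j : sv y1 j = dv v j by rewrite sy1 scompE sv_eq0 jY.
  case/negP: jvx; rewrite -y1j; apply/eqP; apply: toward => //.
  - by rewrite y1E; apply: subset_zsD; rewrite ?memvZ.
  - by rewrite y1E affvD hy lZ hv mulr0 addr0.
  - move=> m mK mh; rewrite sy1 scompE (yK m mK mh).
    by case: ifP => // /negP; case; apply/negP/xn/KX.
  - by rewrite y1j dvE sgz_eq0.
exists (zs y), y, h; split=> //; last by rewrite in_zs hy.
split=> //; rewrite /cov -{1}zx !flat_zs Xy /=; apply/eqP.
rewrite (@dim_cut _ _ _ l X h (x - y)) //; last by rewrite hxy.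
congr _.+1; congr (\dim _); apply/eqP; rewrite eqEsubv; apply/andP; split.
  apply/subvP => v vX; apply: cutY; last by move/dirP: vX => ->; rewrite ?setU11.
  by apply: (subvP (dirS l _)) vX; exact: subsetUr.
by apply: dirS; rewrite subUset sub1set in_zs hy eqxx.
Qed.

(** [dir Y] is a hyperplane in [dir X], so on [dir X] the functionals of [Y] are all
    proportional. *)
Lemma cov_prop X Y h i v : cov X Y -> h \in Y -> h \notin X -> i \in Y ->
  v \in dir X -> l i v * l h (u X) = l h v * l i (u X) :> R.
Proof.
move=> c hY hX iY vX; have uX := u_in gu c.
have lh : l h (u X) != 0 :> R.
  apply/eqP => h0; case/negP: (u_notin gu c); exact: (cov_dir c hY hX uX).
have : v - (l h v / l h (u X)) *: u X \in dir Y.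
  apply: (cov_dir c hY hX); first by rewrite memvB ?memvZ.
  by rewrite linearB /= lZ divfK // subrr.
move=> /dirP/(_ i iY); rewrite linearB /= lZ => /eqP; rewrite subr_eq0 => /eqP ->.
by rewrite mulrAC divfK.
Qed.

Lemma cov_affv X Y y h : cov X Y -> zs y = Y -> h \in Y -> h \notin X ->
  forall i, i \in Y -> exists c : R, forall p, X \subset zs p ->
    affv i p = c * affv h p.
Proof.
move=> c zy hY hX i iY; exists (l i (u X) / l h (u X)) => p Xp.
have [_ _ XY _] := covP c.
have lh : l h (u X) != 0 :> R.
  apply/eqP => h0; case/negP: (u_notin gu c); exact: (cov_dir c hY hX (u_in gu c)).
have py : p - y \in dir X by apply: (@sub_dir_zs _ _ _ l b) => //; rewrite zy.
have aE j : j \in Y -> affv j p = l j (p - y).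
  by rewrite -zy in_zs -(affvB l b) => /eqP ->; rewrite subr0.
rewrite !aE // mulrAC; apply: (mulIf lh); rewrite divfK //.
by rewrite (cov_prop c hY hX iY py) mulrC.
Qed.

(** For the functionals of [Y], the vector from [y] to [x] is a multiple [a] of [u X]; the sign of
    [a] selects the side. *)
Lemma facet_side X Y x y : cov X Y -> zs x = X -> zs y = Y ->
  (forall i, i \notin Y -> sv y i = sv x i) ->
  sv x = scomp (sv y) (dv (u X)) \/ sv x = scomp (sv y) (dv (- u X)).
Proof.
move=> c zx zy yx; have [fX fY XY dm] := covP c; have uX := u_in gu c.
have [h hY hX] : exists2 h, h \in Y & h \notin X.
  by apply/subsetPn; apply/negP => YX; have := dimvS (dirS l YX); rewrite dm ltnn.
have lh : l h (u X) != 0 :> R.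
  apply/eqP => h0; case/negP: (u_notin gu c); exact: (cov_dir c hY hX uX).
have xy : x - y \in dir X by apply: (@sub_dir_zs _ _ _ l b) => //; rewrite ?zx ?zy.
have aE j : j \in Y -> affv j x = l j (x - y).
  by rewrite -zy in_zs -(affvB l b) => /eqP ->; rewrite subr0.
pose a := affv h x / l h (u X).
have a0 : a != 0.
  by rewrite mulf_neq0 ?invr_neq0 //; move: hX; rewrite -zx in_zs.
have iE i : i \in Y -> affv i x = a * l i (u X).
  move=> iY; apply: (mulIf lh); rewrite /a [RHS]mulrAC divfK // !aE //.
  exact: (cov_prop c hY hX iY xy).
have yi i : (sv y i == 0) = (i \in Y) by rewrite sv_eq0 zy.
case: (ltrgtP a 0) a0 => // a0 _; [right|left]; apply/ffunP => i; rewrite scompE yi;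
  case: ifPn => [iY|/yx ->] //; rewrite ?dvN svE dvE (iE _ iY) sgzM.
  by rewrite ltr0_sgz // mulN1r.
by rewrite gtr0_sgz // mul1r.
Qed.

(* Crossing facets away from [p] increases the number of hyperplanes that
separate the cell from [p], so an unbounded cell is reached. *)
Lemma walk_away X p k (Q : svec -> Prop) : flat X -> (0 < \dim (dir X))%N ->
  X \subset zs p -> bsupp [set: I] X k ->
  (forall x y Y h, zs x = X -> Q (sv x) -> cov X Y -> zs y = Y -> h \in Y ->
     h \notin X -> 0 < affv h p * affv h x ->
     (forall i, i \notin Y -> sv y i = sv x i) -> jump (u X) k (sv y) = 0) ->
  (forall x h, zs x = X -> affv h p * affv h x < 0 -> Q (sv x)) ->
  forall x, zs x = X -> Q (sv x) -> k (sv x) = 0.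
Proof.
move=> fX dX Xp bk hj hQ x.
pose sep x := [set i | affv i p * affv i x < 0].
have [n] := ubnP (#|I| - #|sep x|)%N; elim: n x => // n ih x hn zx Qx.
apply/eqP; apply/negPn/negP => kx.
have [Y [y [h [[c zy] hY hX hp yx]]]] := facet_toward zx Xp dX (bk x zx kx).
have j0 := hj x y Y h zx Qx c zy hY hX hp yx.
(* [x'] is the neighbour of [x] across the facet. Without a jump it carries the same value, and [h]
   is one more hyperplane that separates it from [p]. *)
have [x' [zx' kk sx']] : exists x', [/\ zs x' = X, k (sv x) = k (sv x')
   & forall i, sv x' i = if i \in Y then - sv x i else sv x i].
  have yi i : (sv y i == 0) = (i \in Y) by rewrite sv_eq0 zy.
  have [x1 z1 s1] := facet_up gu c zy; have [x2 z2 s2] := facet_down gu c zy.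
  have k12 : k (sv x1) = k (sv x2).
    by apply/eqP; rewrite -subr_eq0 s1 s2; apply/eqP.
  have [e|e] := facet_side c zx zy yx; [exists x2|exists x1];
    split=> //; rewrite ?e -?s1 -?s2 // => i; rewrite ?s1 ?s2 !scompE yi;
    case: ifP => //; by rewrite dvN ?opprK.
case/negP: kx; rewrite kk; apply/eqP.
have hx' : affv h p * affv h x' < 0.
  have := sx' h; rewrite hY !svE; move: hp.
  by case: (sgzP (affv h x)) => h1 hp; case: (sgzP (affv h x')) => // h2 _; nra.
apply: ih => //; last exact: (hQ x' h).
move: hn; rewrite ltnS; apply: leq_trans; apply: ltn_sub2l; last first.
  apply: proper_card; apply/properP; split; last first.
    by exists h; rewrite !inE // ltNge ltW.
  apply/subsetP => i; rewrite !inE => hi.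
  have iY : i \notin Y.
    apply/negP => iY; have [a aE] := cov_affv c zy hY hX iY.
    have [_ _ XY _] := covP c.
    by move: hi; rewrite !aE ?zx //; nra.
  have := sx' i; rewrite (negPf iY) !svE; move: hi.
  by case: (sgzP (affv i x)) => h1 hi; case: (sgzP (affv i x')) => // h2 _; nra.
rewrite -cardsT; apply: proper_card; apply/properP; split; first exact: subsetT.
by exists h; rewrite !inE // -leNgt ltW.
Qed.

Lemma dim0_eq X x y : \dim (dir X) = 0%N -> X \subset zs x -> X \subset zs y -> x = y.
Proof.
move=> /eqP; rewrite dimv_eq0 => /eqP d0 hx hy; apply/eqP.
by rewrite -subr_eq0 -memv0 -d0 (@sub_dir_zs _ _ _ l b).
Qed.

Lemma ftrans_inj X k : flat X -> bsupp [set: I] X k ->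
  (forall s, ftrans s X k = 0) -> forall x, zs x = X -> k (sv x) = 0.
Proof.
have [n] := ubnP (\dim (dir X)); elim: n X k => // n ih X k hn fX bk h0.
case: (posnP (\dim (dir X))) => [d0|dX] x zx.
  have := h0 [::]; rewrite /= d0 eqxx => <-; congr (k (sv _)).
  by apply: (dim0_eq d0); rewrite ?zx ?zs_pt.
apply: (@walk_away X x k (fun=> True)) => //; first by rewrite zx.
move=> x' y Y h _ _ c zy _ _ _ _; have [_ fY _ dm] := covP c.
apply: (ih Y) => //; first by rewrite -ltnS -dm.
  exact: bsupp_jump.
by move=> s; have := h0 (Y :: s); rewrite /= c.
Qed.

Definition sle (s t : svec) : Prop := forall i, s i = 0 \/ s i = t i.

Definition has_face (r : svec) (X : {set I}) : Prop :=
  exists2 y, zs y = X & sle (sv y) r.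

(** Walk away from a point [p] of the face of [r] in [X]. A cell separated from [p] is no face of
    [r], so the walk stays among the cells in question. The facets crossed are no faces of [r]
    either: on [Y] the cell has the signs of [p], so it would itself be a face. Hence induction on
    the dimension removes the jumps. *)
Lemma ftrans_faces X k r : flat X -> bsupp [set: I] X k ->
  (forall s Z, Z \in X :: s -> ~ has_face r Z -> ftrans s X k = 0) ->
  forall x, zs x = X -> ~ sle (sv x) r -> k (sv x) = 0.
Proof.
have [n] := ubnP (\dim (dir X)); elim: n X k => // n ih X k hn fX bk h0.
have [[p zp pr]|nX] := pselect (has_face r X); last first.
  move=> x zx _; apply: ftrans_inj zx => // s.
  by apply: (h0 s X); rewrite ?mem_head.
case: (posnP (\dim (dir X))) => [d0|dX] x zx xr.
  by case: xr; rewrite (dim0_eq d0 (x := x) (y := p)) ?zx ?zp.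
apply: (@walk_away X p k (fun s => ~ sle s r)) => //; first by rewrite zp.
  move=> {}x y Y h {}zx {}xr c zy hY hX hp yx; have [_ fY XY dm] := covP c.
  apply: (ih Y) => //; first by rewrite -ltnS -dm.
  - exact: bsupp_jump.
  - by move=> s Z Zs nZ; have := h0 (Y :: s) Z; rewrite /= c; apply=> //; rewrite inE Zs orbT.
  move=> yr; apply: xr => i; have [iY|iY] := boolP (i \in Y); last by rewrite -yx.
  have [iX|iX] := boolP (i \in X); first by left; apply/eqP; rewrite sv_eq0 zx.
  have [a aE] := cov_affv c zy hY hX iY.
  suff -> : sv x i = sv p i by [].
  have an : a != 0.
    apply: contraNneq iX => a0.
    by rewrite -zx in_zs (aE x) ?zx // a0 mul0r.
  rewrite !svE (aE x) ?zx // (aE p) ?zp // !sgzM; congr (_ * _).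
  by apply: sgz_same; rewrite mulrC.
move=> x' h zx' /ltr0_sgz; rewrite sgzM -!svE => hh /(_ h)[e|e].
  by rewrite e mulr0 in hh.
have [e'|e'] := pr h; first by rewrite e' mul0r in hh.
rewrite e' e in hh; have : 0 <= r h * r h by rewrite -expr2 sqr_ge0.
by rewrite hh.
Qed.

End Walk.

(** * Surjectivity by deletion and restriction *)

Section Surjectivity.
Variables (R : realFieldType) (E : vectType R) (I : finType).
Variables (l : I -> 'Hom(E, R^o)) (b : I -> R) (u : {set I} -> E).
Hypothesis gu : generic_dirs l b u.
Local Notation dir := (dir l).
Local Notation flat := (flat l b).
Local Notation cov := (cov l b).
Local Notation sv := (sv l b).
Local Notation dv := (dv l).
Local Notation zs := (zs l b).
Local Notation pt := (pt l b).
Local Notation affv := (affv l b).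
Local Notation svec := {ffun I -> int}.
Local Notation jump := (jump l).
Local Notation ftrans := (ftrans l b u).
Local Notation flagp := (flagp l b).
Local Notation flag_cycle := (flag_cycle l b).
Local Notation bnd := (bnd l).
Local Notation bsupp := (bsupp l b).

Lemma flagp_cat X s1 Y Z s2 : flagp X (s1 ++ Y :: Z :: s2) -> cov Y Z.
Proof. by rewrite /flagp cat_path /= => /andP[/and4P[_ _ ->]]. Qed.

Lemma fcycle_cons X Y c : cov X Y -> flag_cycle X c -> flag_cycle Y (fun s => c (Y :: s)).
Proof.
move=> cXY [cs cz]; split=> [s /cs|s1 s2]; last exact: (cz (Y :: s1)).
by rewrite /flagp /= cXY.
Qed.

Lemma fcycleB X c c' : flag_cycle X c -> flag_cycle X c' -> flag_cycle X (fun s => c s - c' s).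
Proof.
move=> [cs cz] [cs' cz']; split=> [s|s1 s2]; last by rewrite sumrB cz cz' subrr.
by case: (eqVneq (c s) 0) => [->|/cs//]; rewrite sub0r oppr_eq0 => /cs'.
Qed.

(* Condition [hQ] holds for the flats of a subarrangement, which are closed
under nonempty intersections. *)
Lemma fcycle_support X c (Q : {set I} -> Prop) : flag_cycle X c ->
  (forall Y Y' Z, Q Y -> Q Y' -> Y != Y' -> cov Y Z -> cov Y' Z -> Q Z) ->
  (forall Y s, ~ Q Y -> c (Y :: s) = 0) ->
  forall s1 Z s2, ~ Q Z -> c (s1 ++ Z :: s2) = 0.
Proof.
move=> [cs cz] hQ h0; elim/last_ind => [|s1 Y ih] Z s2 nZ; first exact: h0.
rewrite cat_rcons; have [QY|nQY] := pselect (Q Y); last exact: ih.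
apply/eqP; apply/negPn/negP => cn; have cYZ := flagp_cat (cs _ cn).
have := cz s1 (Z :: s2); rewrite (bigD1 Y) //= big1 ?addr0.
  by apply/eqP.
move=> Y' nY'; have [QY'|nQY'] := pselect (Q Y'); last exact: ih.
apply/eqP; apply/negPn/negP => cn'; apply: nZ; apply: (hQ Y Y') => //.
  by rewrite eq_sym.
exact: (flagp_cat (cs _ cn')).
Qed.

(** Induction on what follows a member off [h]. By [cov_uniq] only one flat inside [h] can come
    next; in the cycle condition its competitors stay off [h] and vanish by induction, so its
    coefficient vanishes as well. *)
Lemma fcycle_concentrated X c h : flag_cycle X c -> h \notin X ->
  (forall s, c s != 0 -> h \in last X s) -> forall s, c s = 0.
Proof.
move=> [cs cz] hX h0 s.
suff gen s2 s1 : h \notin last X s1 -> c (s1 ++ s2) = 0 by apply: (gen s [::]).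
elim: s2 s1 => [|V s2 ih] s1 hs1.
  by rewrite cats0; apply/eqP; apply/negPn/negP => /h0; apply/negP.
have ih' (V' : {set I}) : h \notin V' -> c (s1 ++ V' :: s2) = 0.
  by move=> hV'; rewrite -cat_rcons; apply: ih; rewrite last_rcons.
have [hV|/ih'//] := boolP (h \in V).
have covV (W : {set I}) : c (s1 ++ W :: s2) != 0 -> cov (last X s1) W.
  by move=> /cs; rewrite /flagp cat_path /= => /andP[/and3P[_ ->]].
apply/eqP; apply/negPn/negP => cn; have cV := covV _ cn.
have := cz s1 s2; rewrite (bigD1 V) //= big1 ?addr0; first by apply/eqP.
move=> W nW; have [hW|/ih'//] := boolP (h \in W).
apply/eqP; apply/negPn/negP => /covV cW; case/negP: nW; apply/eqP.
exact: (cov_uniq cW cV hs1).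
Qed.

(* [subflat J X] are the flats cut out of [X] by hyperplanes of [J]. *)
Definition subflat (J X Y : {set I}) : Prop :=
  forall q, X \subset zs q -> Y :&: J \subset zs q -> Y \subset zs q.

(** As [Y] and [Y'] are distinct, a dimension count gives [dir Z = dir Y :&: dir Y']: the flat [Z]
    is their intersection. *)
Lemma subflat_meet J X Y Y' Z : subflat J X Y -> subflat J X Y' -> Y != Y' ->
  cov Y Z -> cov Y' Z -> subflat J X Z.
Proof.
move=> sY sY' nY c c' q Xq Zq.
have [fY fZ YZ dm] := covP c; have [fY' _ YZ' dm'] := covP c'.
have Yq : Y \subset zs q by apply: sY => //; apply: subset_trans (setSI _ _) Zq.
have Yq' : Y' \subset zs q by apply: sY' => //; apply: subset_trans (setSI _ _) Zq.
have : (dir Y :&: dir Y' == dir Z)%VS.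
  rewrite eq_sym eqEdim subv_cap !dirS //= -ltnS -dm ltn_neqAle dimvS ?capvSl // andbT.
  apply: contra nY => /eqP e.
  have e1 : dir Y = (dir Y :&: dir Y')%VS.
    by apply/esym/eqP; rewrite eqEdim capvSl e /=.
  have dYY' : dir Y = dir Y'.
    by apply/eqP; rewrite eqEdim dm dm' leqnn andbT e1 capvSr.
  have zZ := zs_pt fZ.
  have aux (V W : {set I}) : flat W -> dir V = dir W -> V \subset Z -> W \subset Z ->
      V \subset W.
    move=> fW e2 VZ WZ; have zW := zs_pt fW.
    have hh : pt W - pt Z \in dir V.
      by rewrite e2; apply: (@sub_dir_zs _ _ _ l b); rewrite ?zW ?zZ.
    by rewrite -{1}zW -[pt W](subrK (pt Z)) addrC; apply: subset_zsD => //; rewrite zZ.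
  by rewrite eqEsubset (aux Y Y') // (aux Y' Y).
move=> /eqP eZ; rewrite -[q](subrK (pt Z)) addrC; apply: subset_zsD; rewrite ?zs_pt //.
rewrite -eZ memv_cap !(@sub_dir_zs _ _ _ l b) // zs_pt //.
Qed.

Lemma bnd_sub (J J' X : {set I}) s : J \subset J' -> bnd J X s -> bnd J' X s.
Proof. by move=> /subsetP JJ bs v vX h; apply: bs => // i /JJ; exact: h. Qed.

Definition depends_on (J : {set I}) (k : svec -> int) : Prop :=
  forall s s' : svec, (forall i, i \in J -> s i = s' i) -> k s = k s'.

Lemma jump_depends0 J X Y k y : depends_on J k -> cov X Y -> zs y = Y ->
  (Y :\: X) :&: J = set0 -> jump (u X) k (sv y) = 0.
Proof.
move=> dk c zy e; rewrite /jump; apply/eqP; rewrite subr_eq0; apply/eqP/dk => i iJ.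
rewrite !scompE sv_eq0 zy; case: ifP => // iY; rewrite dvN.
have iX : i \in X.
  by apply/negPn/negP => iX; have := in_set0 i; rewrite -e !inE iX iY iJ.
by rewrite dvE; have /dirP -> := u_in gu c; rewrite ?sgz0.
Qed.

(** Two terms without opposite signs cannot cancel. *)
Lemma sgz_cone (p q a c : R) (s : int) : 0 < p -> 0 < q ->
  sgz a = 0 \/ sgz a = s -> sgz c = 0 \/ sgz c = s ->
  (sgz (p * a + q * c) = 0 \/ sgz (p * a + q * c) = s) /\
  (p * a + q * c = 0 -> a = 0).
Proof.
move=> p0 q0; case: (sgzP a) => ha; case: (sgzP c) => hc [] // e1 [] // e2;
  rewrite -?e1 -?e2; split; try by [].
all: try by rewrite ha hc; left; rewrite !mulr0 addr0 sgz0.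
all: try by right; apply: gtr0_sgz; nra.
all: try by right; apply: ltr0_sgz; nra.
all: try by move=> h; nra.
all: by move: e2; rewrite -e1.
Qed.

(* The positive combination of the two recession directions that is parallel to
the facet is a recession direction of the facet, hence zero. *)
Lemma both_sides_unbounded (J X Y : {set I}) y h (sp sm : svec) : cov X Y -> zs y = Y ->
  h \in Y -> h \notin X -> h \in J -> (Y :\: X) :&: J = [set h] ->
  bnd J Y (sv y) ->
  (forall i, i \in J -> i != h -> sp i = sv y i) ->
  (forall i, i \in J -> i != h -> sm i = sv y i) -> sm h = - sp h ->
  ~ bnd J X sp -> ~ bnd J X sm ->
  exists2 w, w \in dir X & w != 0 /\ forall i, i \in J -> i != h -> l i w = 0.
Proof.
move=> c zy hY hX hJ YJ bY spE smE spm.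
have unb s : ~ bnd J X s -> exists w, [/\ w \in dir X, w != 0 &
    forall i, i \in J -> dv w i = 0 \/ dv w i = s i].
  move=> nb; apply: contrapT => nw; apply: nb => w wX hw; apply/eqP.
  by apply/negPn/negP => w0; apply: nw; exists w.
move=> /unb[v [vX v0 hv]] /unb[w [wX w0 hw]].
have [_ _ XY _] := covP c.
have YX i : i \in J -> i \in Y -> i != h -> i \in X.
  move=> iJ iY ih; apply/negPn/negP => iX.
  by have := in_set1 i h; rewrite -YJ !inE iX iY iJ (negPf ih).
have recY z : z \in dir X -> l h z = 0 ->
    (forall i, i \in J -> i != h -> dv z i = 0 \/ dv z i = sv y i) -> z = 0.
  move=> zX hz hi; apply: bY; first exact: (cov_dir c hY hX).
  move=> i iJ; case: (eqVneq i h) => [->|ih]; last exact: hi.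
  by left; rewrite dvE hz sgz0.
have hn z s : z \in dir X -> z != 0 -> (forall i, i \in J -> i != h -> s i = sv y i) ->
    (forall i, i \in J -> dv z i = 0 \/ dv z i = s i) -> dv z h = s h /\ dv z h != 0.
  move=> zX z0 sE hz.
  have zh0 : dv z h != 0.
    rewrite dvE sgz_eq0; apply: contra z0 => /eqP zh; apply/eqP; apply: recY => // i iJ ih.
    by rewrite -(sE i iJ ih); exact: hz.
  by split=> //; have [e|//] := hz h hJ; rewrite e eqxx in zh0.
have [vh vh0] := hn v sp vX v0 spE hv; have [wh wh0] := hn w sm wX w0 smE hw.
set p := l h v : R; set q := l h w : R.
have pq : p * q < 0.
  have : dv w h = - dv v h by rewrite wh vh.
  rewrite !dvE -/p -/q; move: vh0 wh0; rewrite !dvE -/p -/q.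
  by case: (sgzP p) => // h1 _; case: (sgzP q) => // h2 _ _; nra.
(* The weights make [l h z] vanish, since [p] and [q] have opposite signs. *)
pose z := `|q| *: v + `|p| *: w.
have p0 : 0 < `|p| by rewrite normr_gt0; apply: contraTneq pq => ->; rewrite mul0r ltxx.
have q0 : 0 < `|q| by rewrite normr_gt0; apply: contraTneq pq => ->; rewrite mulr0 ltxx.
have lz i : l i z = `|q| * l i v + `|p| * l i w :> R by rewrite linearD /= !lZ.
have z0 : z = 0.
  apply: recY; first by rewrite memvD ?memvZ.
    rewrite lz -/p -/q; case: (ltrP 0 p) => hp.
      have hq : q < 0 by nra.
      by rewrite (gtr0_norm hp) (ltr0_norm hq); ring.
    have hq : 0 < q by nra.
    by rewrite (ler0_norm hp) (gtr0_norm hq); ring.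
  move=> i iJ ih; have := hv i iJ; have := hw i iJ.
  rewrite (spE i iJ ih) (smE i iJ ih) !dvE lz => hw' hv'.
  by have [] := sgz_cone q0 p0 hv' hw'.
(* As [z = 0] and nothing cancels, [l i v] vanishes for every [i] in [J] other than [h]. *)
exists v => //; split=> // i iJ ih.
have : l i z = 0 :> R by rewrite z0 linear0.
rewrite lz => e; have := hv i iJ; have := hw i iJ.
rewrite (spE i iJ ih) (smE i iJ ih) !dvE => hw' hv'.
by have [_] := sgz_cone q0 p0 hv' hw'; apply.
Qed.

Lemma flagp_sub X s : flagp X s -> X \subset last X s.
Proof.
rewrite /flagp => /andP[+ _]; elim: s X => [|Y s ih] X //= /andP[c /ih].
by apply: subset_trans; have [] := covP c.
Qed.

Lemma subflat_cov (J X Y : {set I}) j : cov X Y -> j \in Y -> j \notin X -> j \in J ->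
  subflat J X Y.
Proof.
move=> c jY jX jJ q Xq YJq; have [_ fY XY _] := covP c; have zY := zs_pt fY.
have hq : q - pt Y \in dir X by apply: (@sub_dir_zs _ _ _ l b); rewrite ?zY.
have : q - pt Y \in dir Y.
  apply: (cov_dir c jY jX hq); rewrite -(affvB l b).
  have : j \in zs q by apply: (subsetP YJq); rewrite inE jY.
  rewrite in_zs => /eqP ->; move: jY; rewrite -{1}zY in_zs => /eqP ->.
  by rewrite subrr.
by move=> /(subset_zsD (b := b) (x := pt Y)); rewrite zY addrC subrK; apply.
Qed.

Definition sset (s : svec) (h : I) (a : int) : svec :=
  [ffun i => if i == h then a else s i].

Lemma bnd_ext (J X : {set I}) (s s' : svec) : (forall i, i \in J -> s i = s' i) ->
  bnd J X s -> bnd J X s'.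
Proof. by move=> e bs v vX hv; apply: bs => // i iJ; rewrite e //; exact: hv. Qed.

(* One side of each bounded cell of [Y] is bounded, by [both_sides_unbounded]. *)
Lemma jump_lift (J X Y : {set I}) h kY : cov X Y -> h \in J -> (Y :\: X) :&: J = [set h] ->
  depends_on J kY -> bsupp J Y kY ->
  ~ (exists2 w, w \in dir X & w != 0 /\ forall i, i \in J -> i != h -> l i w = 0) ->
  exists k, [/\ depends_on J k, bsupp J X k &
    forall y, zs y = Y -> jump (u X) k (sv y) = kY (sv y)].
Proof.
move=> c hJ YJ dY bY nw; have [_ _ XY _] := covP c.
have [hY hX] : h \in Y /\ h \notin X.
  by have := set11 h; rewrite -YJ !inE => /andP[/andP[]].
have YX i : i \in J -> i \in Y -> i != h -> i \in X.
  move=> iJ iY ih; apply/negPn/negP => iX.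
  by have := in_set1 i h; rewrite -YJ !inE iX iY iJ (negPf ih).
have uX := u_in gu c.
set eta := dv (u X) h.
have eta1 : eta * eta = 1.
  have : l h (u X) != 0 :> R.
    by apply/eqP => h0; case/negP: (u_notin gu c); exact: (cov_dir c hY hX uX).
  by rewrite /eta dvE; case: (sgzP (l h (u X) : R)) => // ->; rewrite eqxx.
have etaN : - eta != eta.
  by rewrite eqNr; apply/eqP => e0; move: eta1; rewrite e0.
(* [e] is the side of [h] that receives the value: [eta], the side of [u X], if it is bounded, and
   the other one if not. The factor [e s * eta] in [k] corrects the sign of the jump. *)
pose e s := if `[< bnd J X (sset s h eta) >] then eta else - eta.
(* [kY] is cut off at sign vectors not induced on [J] by a cell of [Y], because its support is known
   to be bounded only on cells of [Y]. *)
pose ky s := if `[< exists y, zs y = Y /\ forall i, i \in J -> sv y i = sset s h 0 i >]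
  then kY (sset s h 0) else 0.
pose k (s : svec) := if s h == e s then e s * eta * ky s else 0.
have ssE (s s' : svec) a : (forall i, i \in J -> i != h -> s i = s' i) ->
    forall i, i \in J -> sset s h a i = sset s' h a i.
  by move=> h' i iJ; rewrite !ffunE; case: ifP => // ih; rewrite h' ?ih.
have eE (s s' : svec) : (forall i, i \in J -> i != h -> s i = s' i) -> e s = e s'.
  move=> h'; rewrite /e; congr (if _ then _ else _); apply: asbool_equiv_eq.
  by split; apply: bnd_ext => i iJ; rewrite (ssE s s').
have kyE (s s' : svec) : (forall i, i \in J -> i != h -> s i = s' i) -> ky s = ky s'.
  move=> h'; rewrite /ky (dY _ _ (ssE s s' 0 h')); congr (if _ then _ else _).
  apply: asbool_equiv_eq.
  by split=> -[y [zy hy]]; exists y; split=> // i iJ; rewrite hy // (ssE s s').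
exists k; split.
- move=> s s' h'; rewrite /k h' // (eE s s') ?(kyE s s') //; by move=> i iJ _; exact: h'.
- move=> x zx; rewrite /k; case: (sv x h =P e (sv x)) => hx; last by rewrite eqxx.
  rewrite !mulf_eq0 !negb_or.
  move=> /andP[_]; rewrite /ky; case: ifP => // /asboolP[y [zy hy]] kn.
  have by_ : bnd J Y (sv y).
    by apply: bY => //; rewrite (dY _ _ hy).
  have sx a : sv x h = a -> sv x = sset (sv x) h a.
    by move=> <-; apply/ffunP => i; rewrite [in RHS]ffunE; case: (i =P h) => // ->.
  move: hx; rewrite /e; case: ifP => [/asboolP be hx|/asboolP nbe hx].
    by rewrite (sx _ hx).
  rewrite (sx _ hx); apply: contrapT => nbe'; apply: nw.
  apply: (both_sides_unbounded c zy hY hX hJ YJ by_ _ _ _ nbe nbe').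
  + by move=> i iJ ih; rewrite hy // !ffunE (negPf ih).
  + by move=> i iJ ih; rewrite hy // !ffunE (negPf ih).
  + by rewrite !ffunE eqxx.
- move=> y zy; have yh : sv y h = 0 by apply/eqP; rewrite sv_eq0 zy.
  have agree v : v \in dir X -> forall i, i \in J -> i != h ->
      scomp (sv y) (dv v) i = sv y i.
    move=> vX i iJ ih; rewrite scompE; case: ifP => // /eqP y0; rewrite y0.
    have iY : i \in Y by rewrite -zy -(sv_eq0 l b) y0.
    by rewrite dvE; move/dirP: vX => ->; rewrite ?sgz0 ?YX.
  have kyy : ky (sv y) = kY (sv y).
    have ey i : i \in J -> sv y i = sset (sv y) h 0 i.
      by move=> _; rewrite [in RHS]ffunE; case: (i =P h) => // ->.
    rewrite /ky -(dY _ _ ey); case: ifP => // /asboolP; case; by exists y.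
  have uX' : - u X \in dir X by rewrite memvN.
  rewrite /jump /k !(kyE _ _ (agree _ uX)) !(kyE _ _ (agree _ uX')).
  rewrite !(eE _ _ (agree _ uX)) !(eE _ _ (agree _ uX')) kyy.
  have -> : scomp (sv y) (dv (u X)) h = eta by rewrite scompE yh eqxx.
  have -> : scomp (sv y) (dv (- u X)) h = - eta by rewrite scompE yh eqxx dvN.
  have [->|->] : e (sv y) = eta \/ e (sv y) = - eta.
    by rewrite /e; case: ifP; [left|right].
    by rewrite eqxx (negPf etaN) eta1 mul1r subr0.
  by rewrite eq_sym (negPf etaN) eqxx mulNr eta1 mulN1r sub0r opprK.
Qed.

(** The hypothesis says that [c] starts only with flats cut out of [X] by [J]. Induction on the
    dimension of [X], then on [#|J|], removing one [h] from [J] at a time. *)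
Lemma ftrans_surj X J c : flat X -> flag_cycle X c ->
  (forall Y s, (Y :\: X) :&: J = set0 -> c (Y :: s) = 0) ->
  exists k, [/\ depends_on J k, bsupp J X k & forall s, c s = ftrans s X k].
Proof.
have [n] := ubnP (\dim (dir X)); elim: n X J c => // n ihn X J c hn fX fc.
have [cs cz] := fc.
have ccov Y s : c (Y :: s) != 0 -> cov X Y by move=> /cs /andP[/= /andP[]].
case: (posnP (\dim (dir X))) => [d0 _|dX].
  exists (fun=> c [::]); split=> // [x zx _ v vX _|[|Y s] /=].
  - by apply/eqP; move/eqP: d0; rewrite dimv_eq0 => /eqP d0; rewrite -memv0 -d0.
  - by rewrite d0.
  - have ncov : ~~ cov X Y by apply/negP => /cov_dim_gt0; rewrite d0.
    rewrite (negPf ncov); apply/eqP; apply/negPn/negP => /ccov; exact/negP.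
have c0 : c [::] = 0.
  by apply/eqP; apply/negPn/negP => /cs /andP[_ /=]; rewrite (gtn_eqF dX).
have [m] := ubnP #|J|; elim: m J c fc cs cz ccov c0 => // m ihm J c fc cs cz ccov c0 hm hJ.
have triv : (forall s, c s = 0) ->
    exists k, [/\ depends_on J k, bsupp J X k & forall s, c s = ftrans s X k].
  move=> h; exists (fun=> 0); split=> // s.
  by rewrite h (ftrans0 gu).
case: (set_0Vmem J) => [J0|[h hJ']].
  by apply: triv => -[|Y s] //; apply: hJ; rewrite J0 setI0.
have mJ : (#|J :\ h| < m)%N by move: hm; rewrite (cardsD1 h J) hJ'.
have subJ : J :\ h \subset J by exact: subD1set.
have wk k : depends_on (J :\ h) k /\ bsupp (J :\ h) X k -> depends_on J k /\ bsupp J X k.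
  move=> [dk bk]; split=> [s s' e|x zx /(bk x zx)]; last exact: bnd_sub.
  by apply: dk => i /(subsetP subJ); exact: e.
have [[Y [cY YJ]]|nY] :=
    pselect (exists Y, cov X Y /\ (Y :\: X) :&: J = [set h]); last first.
  have [|k [dk bk kE]] := ihm (J :\ h) c fc cs cz ccov c0 mJ.
    move=> Y s e; apply/eqP; apply/negPn/negP => cn; have cY := ccov _ _ cn.
    have [hY|hY] := boolP (h \in Y :\: X); last first.
      case/negP: cn; rewrite hJ //; apply/setP => i; have := in_set0 i; rewrite -e !inE.
      by case: (eqVneq i h) hY => [->|//]; rewrite !inE => /negPf ->.
    apply: nY; exists Y; split=> //; apply/setP => i; have := in_set0 i; rewrite -e.
    move: hY; rewrite !inE; case: (eqVneq i h) => [->|//] -> /=.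
    by rewrite hJ'.
  by have [dk' bk'] := wk k (conj dk bk); exists k.
have [_ fY XY dm] := covP cY.
have [hY hX] : h \in Y /\ h \notin X.
  by have := set11 h; rewrite -YJ !inE => /andP[/andP[]].
(* [c] lives on flags of the subarrangement [J]. *)
have supp : forall s1 Z s2, ~ subflat J X Z -> c (s1 ++ Z :: s2) = 0.
  apply: (fcycle_support fc) => [Z Z' W q q' n' c1 c2|Z s nZ].
    exact: (subflat_meet q q' n' c1 c2).
  apply/eqP; apply/negPn/negP => cn; have cZ := ccov _ _ cn; apply: nZ.
  case: (set_0Vmem ((Z :\: X) :&: J)) => [e|[j]].
    by case/negP: cn; rewrite hJ.
  rewrite !inE => /andP[/andP[jX jZ] jJ]; exact: (subflat_cov cZ jZ jX jJ).
(* If the members of [J] other than [h] share a direction [w] of [X], every vertex of the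
   subarrangement lies on [h], and [c] vanishes by [fcycle_concentrated]. *)
have [[w wX [w0 hw]]|nw] := pselect (exists2 w, w \in dir X &
    w != 0 /\ forall i, i \in J -> i != h -> l i w = 0).
  apply: triv; apply: (fcycle_concentrated fc hX) => s cn.
  have /andP[ps /eqP dL] := cs _ cn; have XL := flagp_sub (cs _ cn).
  case/lastP: s cn ps dL XL => [|s L]; first by rewrite c0 eqxx.
  rewrite last_rcons -cats1 cat_path /= => cn /and3P[_ cL _] dL XL.
  have [_ fL _ _] := covP cL; have zL := zs_pt fL.
  apply/negPn/negP => hL; suff nQ : ~ subflat J X L by case/negP: cn; rewrite supp.
  move=> /(_ (pt L + w)); rewrite subset_zsD ?zL // => /(_ isT).
  have -> : L :&: J \subset zs (pt L + w).
    apply/subsetP => i; rewrite inE => /andP[iL iJ]; rewrite in_zs affvD.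
    move: (iL); rewrite -{1}zL in_zs => /eqP ->.
    by rewrite hw ?addr0 //; apply: contraNneq hL => <-.
  move=> /(_ isT) Lw; case/negP: w0; rewrite -memv0.
  have := @sub_dir_zs _ _ _ l b (pt L + w) (pt L) L Lw; rewrite zL subxx => /(_ isT).
  by rewrite addrAC subrr add0r; move/eqP: dL; rewrite dimv_eq0 => /eqP ->.
(* Restriction: the flags through [Y] form a flag cycle of [Y], to which the induction on the
   dimension applies. *)
have [||kY [dY bY kYE]] := ihn Y J (fun s => c (Y :: s)) _ fY (fcycle_cons cY fc).
- by rewrite -ltnS -dm.
- move=> Z s e; apply/eqP; apply/negPn/negP => cn.
  have cYZ : cov Y Z by move/cs: (cn) => /andP[/= /and3P[]].
  have [_ fZ YZ dmZ] := covP cYZ.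
  case/negP: cn; rewrite (supp [:: Y] Z s) // => sZ.
  have /dimvS : (dir Y <= dir Z)%VS; last by rewrite dmZ ltnn.
  apply: dirS; rewrite -(zs_pt fY); apply: sZ; rewrite zs_pt //.
  apply/subsetP => i; rewrite inE => /andP[iZ iJ]; apply/negPn/negP => iY.
  by have := in_set0 i; rewrite -e !inE iY iZ iJ.
have [k' [dk' bk' jk']] := jump_lift cY hJ' YJ dY bY nw.
have bk'T : bsupp [set: I] X k'.
  by move=> x zx /(bk' x zx); apply: bnd_sub; exact: subsetT.
have fk' := ftrans_fcycle gu fX bk'T.
have ftY s : ftrans (Y :: s) X k' = c (Y :: s).
  by rewrite /= cY kYE; apply: (ftrans_ext gu).
(* Nothing is left on [Y], the only flat of codimension one in [X] that lies on [h]; so the deletion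
   [J :\ h] suffices for [c']. *)
pose c' s := c s - ftrans s X k'.
have fc' : flag_cycle X c' := fcycleB fc fk'.
have [cs' cz'] := fc'.
have ccov' Z s : c' (Z :: s) != 0 -> cov X Z by move=> /cs' /andP[/= /andP[]].
have c0' : c' [::] = 0.
  by apply/eqP; apply/negPn/negP => /cs' /andP[_ /=]; rewrite (gtn_eqF dX).
have [|k2 [dk2 bk2 k2E]] := ihm (J :\ h) c' fc' cs' cz' ccov' c0' mJ.
  move=> Z s e; apply/eqP; apply/negPn/negP => cn; have cZ := ccov' _ _ cn.
  have [hZ|hZ] := boolP (h \in Z).
    have ZY := cov_uniq cZ cY hX hZ hY.
    by move: cn; rewrite ZY /c' ftY subrr eqxx.
  have e' : (Z :\: X) :&: J = set0.
    apply/setP => i; have := in_set0 i; rewrite -e !inE.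
    by case: (eqVneq i h) => [->|//]; rewrite (negPf hZ) andbF.
  case/negP: cn; rewrite /c' hJ // /= cZ (ftrans0 gu) ?subr0 //.
    by have [] := covP cZ.
  by move=> y zy; exact: (jump_depends0 dk' cZ zy e').
have [dk2' bk2'] := wk k2 (conj dk2 bk2).
exists (fun s => k' s + k2 s); split.
- by move=> s s' e; rewrite (dk' s s') // (dk2' s s').
- move=> x zx; case: (eqVneq (k' (sv x)) 0) => [->|/(bk' x zx)//].
  by rewrite add0r; exact: bk2'.
- by move=> s; rewrite ftransD -k2E /c' addrC subrK.
Qed.

End Surjectivity.

Require Import Defs.
From HB Require Import structures.
From mathcomp Require Import perm.
From mathcomp Require Import generic_quotient ring_quotient.
From mathcomp Require Import all_classical reals topology normedtype derive.
From mathcomp Require Import fintype finset.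

Import numFieldNormedType.Exports.
Import Quotient.Exports.

(** * Alternating chains and functions on ranked sequences *)

Section AlternatingChains.
Variables (V : choiceType) (r : V -> nat).

Definition alternating (n : nat) (c : n.-tuple V -> int) : Prop :=
  forall (s : 'S_n) x, c (perm_tuple s x) = (-1) ^+ s * c x.

Definition ranked (n : nat) (y : n.-tuple V) : Prop := forall i, r (tnth y i) = i.

(** Antisymmetrisation. If [G] is supported on [ranked] tuples, [alt G] agrees with it there
    ([alt_ranked]); this turns functions on flags into simplicial chains. *)
Definition alt (n : nat) (G : seq V -> int) (y : n.-tuple V) : int :=
  \sum_(s : 'S_n) (-1) ^+ s * G (perm_tuple s y).

Lemma perm_tupleM n (s t : 'S_n) (y : n.-tuple V) :
  perm_tuple s (perm_tuple t y) = perm_tuple (s * t)%g y.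
Proof. by apply: eq_from_tnth => i; rewrite !tnth_mktuple permM. Qed.

Lemma perm_tuple1 n (y : n.-tuple V) : perm_tuple 1%g y = y.
Proof. by apply: eq_from_tnth => i; rewrite tnth_mktuple perm1. Qed.

Lemma alt_alternating n G : alternating (alt (n := n) G).
Proof.
move=> t y; rewrite /alt mulr_sumr [RHS](reindex_inj (mulIg t)).
apply: eq_bigr => s _. rewrite perm_tupleM mulrA odd_permM signr_addb mulrCA.
by rewrite -expr2 sqrr_sign mulr1.
Qed.

Lemma alt_ranked n (G : seq V -> int) (y : n.-tuple V) :
  (forall y' : n.-tuple V, G y' != 0 -> ranked y') -> ranked y -> alt G y = G y.
Proof.
move=> hG hy; rewrite /alt (bigD1 (1%g : 'S_n)) // big1.
  by rewrite perm_tuple1 odd_perm1 expr0 mul1r; exact: addr0.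
move=> s /andP[_ s1]; apply/eqP; rewrite mulf_eq0; apply/orP; right; apply/negPn/negP => /hG h.
case/negP: s1; apply/eqP/permP => i; rewrite perm1; apply/val_inj.
by have := h i; rewrite tnth_mktuple hy.
Qed.

Lemma ranked_perm n (y : n.-tuple V) : (forall i, (r (tnth y i) < n)%N) ->
  injective (fun i => r (tnth y i)) -> exists s : 'S_n, ranked (perm_tuple s y).
Proof.
move=> hlt hinj; pose f i := Ordinal (hlt i).
have finj : injective f by move=> i j /(congr1 val) /= /hinj.
exists (perm finj)^-1%g => i; rewrite tnth_mktuple.
by rewrite -[X in _ = nat_of_ord X](permKV (perm finj) i) permE.
Qed.

Lemma alternating_eq n (c e : n.-tuple V -> int) : alternating c -> alternating e ->
  (forall y, ranked y -> c y = e y) ->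
  (forall y, c y != 0 -> exists s : 'S_n, ranked (perm_tuple s y)) ->
  (forall y, e y != 0 -> exists s : 'S_n, ranked (perm_tuple s y)) -> c = e.
Proof.
move=> ac ae h hc he; apply/funext => y.
have aux (s : 'S_n) : ranked (perm_tuple s y) -> c y = e y.
  move=> /h; rewrite ac ae => /(congr1 ( *%R ((-1) ^+ s))).
  by rewrite !mulrA -!expr2 !sqrr_sign !mul1r.
case: (eqVneq (c y) 0) => [c0|/hc[s /aux]//].
by case: (eqVneq (e y) 0) => [->//|/he[s /aux]].
Qed.

Lemma insert_tuple n (z : V -> n.+1.-tuple V) (j : 'I_n.+1) v0 :
  (forall v, tnth (z v) j = v) ->
  (forall v v' i, i != j -> tnth (z v) i = tnth (z v') i) ->
  forall v, z v = take j (z v0) ++ v :: drop j.+1 (z v0) :> seq V.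
Proof.
move=> zj zi v; rewrite -{1}(cat_take_drop j (z v)).
rewrite (drop_nth v) ?size_tuple // -tnth_nth zj.
have nthE i : i != j :> nat -> nth v (z v) i = nth v (z v0) i.
  move=> ij; case: (ltnP i n.+1) => hi; last by rewrite !nth_default ?size_tuple.
  have := zi v v0 (Ordinal hi); rewrite !(tnth_nth v) /=; apply.
  by apply: contra ij => /eqP <-.
congr (_ ++ _ :: _); apply: (@eq_from_nth _ v); rewrite ?size_take ?size_drop ?size_tuple //.
  move=> i; rewrite ltn_ord => ij; rewrite !nth_take // nthE //.
  by rewrite ltn_eqF.
move=> i _; rewrite !nth_drop nthE // gtn_eqF //.
by rewrite addSn ltnS leq_addr.
Qed.

(** The place of [v] in the permuted tuple is [(s^-1)%g ord0], whatever [v] is. *)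
Lemma perm_tuple_insert n (s : 'S_n.+1) (y : n.-tuple V) (v0 : V) :
  exists s1 s2, forall v, perm_tuple s [tuple of v :: y] = s1 ++ v :: s2 :> seq V.
Proof.
pose z v := perm_tuple s [tuple of v :: y].
have zj v : tnth (z v) ((s^-1)%g ord0) = v by rewrite tnth_mktuple permKV.
eexists; eexists => v; apply: (@insert_tuple n z ((s^-1)%g ord0) v0) => // v1 v2 i ij.
rewrite !tnth_mktuple; case: (unliftP ord0 (s i)) => [k ->|e].
  by rewrite !tnthS.
by case/negP: ij; rewrite -e permK.
Qed.

(** Each permutation moves the summed entry to a fixed place, where the sum of [G] vanishes.
    Finiteness of the support allows the two sums to be exchanged. *)
Lemma boundary_alt n (G : seq V -> int) (v0 : V) :
  finite_set [set y : n.+1.-tuple V | G y != 0]%classic ->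
  (forall s1 s2, \sum_(v \in [set: V]%classic) G (s1 ++ v :: s2) = 0) ->
  boundary (alt (n := n.+1) G) = 0.
Proof.
move=> /finite_seqP[L EL] hG; apply/funext => y; rewrite /boundary /alt.
pose rv : seq V := undup (flatten [seq tval x | x <- L]).
have inrv (s : 'S_n.+1) v : v \notin rv -> G (perm_tuple s [tuple of v :: y]) = 0.
  move=> nv; apply/eqP; apply/negPn/negP => Gn; case/negP: nv.
  rewrite mem_undup; apply/flattenP; exists (tval (perm_tuple s [tuple of v :: y])).
    apply: (map_f (@tval n.+1 V)).
    by change ([set` L]%classic (perm_tuple s [tuple of v :: y])); rewrite -EL.
  apply/tnthP; exists ((s^-1)%g ord0); by rewrite tnth_mktuple permKV.
have fsE (f : V -> int) : (forall v, v \notin rv -> f v = 0) ->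
    \sum_(v \in [set: V]%classic) f v = \sum_(v <- rv) f v.
  move=> hf; rewrite (@fsbigE _ _ _ _ _ rv) ?undup_uniq //.
    by apply: eq_bigl => v; rewrite classical_sets.in_setT.
  by move=> v _; exact: hf.
rewrite fsE => [|v nv]; last by rewrite big1 // => s _; rewrite inrv ?mulr0.
rewrite exchange_big /= big1 // => s _; rewrite -mulr_sumr -fsE; last exact: inrv.
have [s1 [s2 hs]] := perm_tuple_insert s y v0.
by under eq_fsbigr do rewrite hs; rewrite hG mulr0.
Qed.

(** The boundary sums over the first entry; the permutation [lift_perm j ord0 1%g] carries this to
    the place after [s1], at the cost of a constant sign. *)
Lemma cycle_insert n (c : n.+1.-tuple V -> int) (v0 : V) :
  alternating c -> boundary c = 0 ->
  forall (z : V -> n.+1.-tuple V) s1 s2,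
    (forall v, z v = s1 ++ v :: s2 :> seq V) ->
    \sum_(v \in [set: V]%classic) c (z v) = 0.
Proof.
move=> ac bc z s1 s2 zE.
have sz : size (s1 ++ s2) == n.
  have := size_tuple (z v0); rewrite zE !size_cat /= addnS => -[<-]; exact: eqxx.
pose w : n.-tuple V := Tuple sz.
have jn : (size s1 < n.+1)%N by rewrite ltnS -(eqP sz) size_cat leq_addr.
pose j := Ordinal jn; pose s := lift_perm j ord0 1%g.
have zs v : z v = perm_tuple s [tuple of v :: w].
  apply: eq_from_tnth => i; rewrite tnth_mktuple.
  case: (unliftP j i) => [k ->|->].
    rewrite lift_perm_lift perm1 tnthS !(tnth_nth v0) zE /= !nth_cat /= /bump.
    case: (leqP (size s1) k) => h /=.
      by rewrite add1n ltnNge (leqW h) subSn // ltnNge h.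
    by rewrite add0n h.
  by rewrite lift_perm_id !(tnth_nth v0) zE /= nth_cat ltnn subnn.
under eq_fsbigr do rewrite zs ac.
rewrite -mulr_fsumr; have := congr1 (@^~ w) bc; rewrite /boundary /= => ->.
by rewrite mulr0.
Qed.

Lemma is_cycle_alt m (G : seq V -> int) (v0 : V) :
  finite_set [set y : m.-tuple V | G y != 0]%classic ->
  (forall s1 s2, \sum_(v \in [set: V]%classic) G (s1 ++ v :: s2) = 0) ->
  is_cycle (alt (n := m) G).
Proof. by case: m => // m; exact: boundary_alt. Qed.

Lemma is_cycle_insert m (c : m.-tuple V -> int) (v0 : V) :
  alternating c -> is_cycle c ->
  forall (z : V -> m.-tuple V) s1 s2, (forall v, z v = s1 ++ v :: s2 :> seq V) ->
    \sum_(v \in [set: V]%classic) c (z v) = 0.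
Proof.
case: m c => [|m] c ac bc z s1 s2 zE; last exact: (cycle_insert v0 ac bc zE).
by have := size_tuple (z v0); rewrite zE size_cat /= addnS.
Qed.

Lemma perm_tuple_perm n (s : 'S_n) (y : n.-tuple V) : perm_eq (perm_tuple s y) y.
Proof. by apply/tuple_permP; exists s. Qed.

Lemma perm_tuple_set n (s : 'S_n) (y : n.-tuple V) :
  [set` perm_tuple s y]%classic = [set` y]%classic.
Proof. by apply/seteqP; split=> v /=; rewrite (perm_mem (perm_tuple_perm s y)). Qed.

End AlternatingChains.

Local Open Scope classical_set_scope.

(** * Topology of cells *)

Section Cells.
Variables (R : realType) (d : nat) (I : finType).
Local Notation E := 'rV[R]_d.
Variables (l : I -> 'Hom(E, R^o)) (b : I -> R).
Local Notation sv := (sv l b).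
Local Notation dv := (dv l).
Local Notation zs := (zs l b).
Local Notation affv := (affv l b).
Local Notation dir := (dir l).

Definition hyp (i : I) : set E := [set x | affv i x = 0].
Definition cell (x : E) : set E := [set y | sv y = sv x].
Definition pts (Z : {set I}) : set E := [set y | (Z \subset zs y)%B].

Lemma sum_continuous (T : topologicalType) (J : Type) (r : seq J) (f : J -> T -> R) :
  (forall j, continuous (f j)) -> continuous (fun x => \sum_(j <- r) f j x).
Proof.
move=> cf x; elim: r => [|j r ih].
  by under eq_fun do rewrite big_nil; exact: cvg_cst.
by under eq_fun do rewrite big_cons; apply: cvgD; [exact: cf|exact: ih].
Qed.

Lemma lin_continuous i : continuous (fun x : E => l i x : R).
Proof.
have -> : (fun x : E => l i x : R) =
    (fun x => \sum_(j <- index_enum 'I_d) x 0 j * (l i (delta_mx 0 j) : R)).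
  apply/funext => x; rewrite {1}[x]row_sum_delta linear_sum /=.
  by apply: eq_bigr => j _; rewrite lZ.
apply: sum_continuous => j x.
apply: (@continuousM R E (fun x : E => x 0 j) (fun=> l i (delta_mx 0 j))).
  exact: (@coord_continuous R 1 d 0 j x).
exact: cst_continuous.
Qed.

Lemma affv_continuous i : continuous (affv i).
Proof.
move=> x; apply: (@continuousB R R E (fun x : E => l i x : R) (fun=> b i)).
  exact: lin_continuous.
exact: cst_continuous.
Qed.

Lemma line_continuous (x v : E) : continuous (fun t : R => x + t *: v).
Proof.
move=> t; apply: cvgD; first exact: cvg_cst.
by apply: cvgZr_tmp; exact: cvg_id.
Qed.

(** The image under [affv i] of a connected set off [hyp i] is an interval without 0; conversely the
    segment between two points on one side is connected and avoids [hyp i]. *)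
Lemma same_pieceP i x y : same_piece (hyp i) x y <-> sv x i = sv y i.
Proof.
rewrite !svE; split.
  case=> [[-> ->]//|[C [Cx CH cC] Cy]].
  have /connected_intervalP iC : connected (affv i @` C).
    apply: connected_continuous_connected => //.
    by apply: continuous_subspaceT; exact: affv_continuous.
  have n0 z : C z -> affv i z != 0 by move=> /CH /= /eqP.
  have hx := n0 _ Cx; have hy := n0 _ Cy.
  have no0 : ~ (affv i @` C) 0 by move=> [z /n0 /eqP nz].
  have ix : (affv i @` C) (affv i x) by exists x.
  have iy : (affv i @` C) (affv i y) by exists y.
  case: (ltrgtP (affv i x) 0) hx => // hx _; case: (ltrgtP (affv i y) 0) hy => // hy _.
  - by rewrite !ltr0_sgz.
  - by case: no0; apply: (iC _ _ ix iy); rewrite !ltW.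
  - by case: no0; apply: (iC _ _ iy ix); rewrite !ltW.
  - by rewrite !gtr0_sgz.
move=> e; case: (eqVneq (affv i x) 0) => [x0|x0].
  by left; split=> //; apply/eqP; move: e; rewrite x0 sgz0 => /eqP; rewrite eq_sym sgz_eq0.
right; exists ((fun t : R => x + t *: (y - x)) @` `[0, 1]); last first.
  by exists 1; rewrite ?scale1r ?(addrC x) ?subrK //= in_itv /= ler01 lexx.
split.
- by exists 0; rewrite ?scale0r ?addr0 //= in_itv /= ler01 lexx.
- move=> z [t /=]; rewrite in_itv /= => /andP[t0 t1] <- /= /eqP; apply/negP.
  have -> : affv i (x + t *: (y - x)) = (1 - t) * affv i x + t * affv i y.
    by rewrite affvD lZ -(affvB l b); ring.
  move: e x0; case: (sgzP (affv i x)) => // h1; case: (sgzP (affv i y)) => // h2 _ _.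
    have [t00|t0'] := eqVneq 0 t; first by rewrite -t00 subr0 mul1r mul0r addr0 gt_eqF.
    have tp : 0 < t by rewrite lt_neqAle t0' t0.
    by rewrite gt_eqF //; nra.
  have [t00|t0'] := eqVneq 0 t; first by rewrite -t00 subr0 mul1r mul0r addr0 lt_eqF.
  have tp : 0 < t by rewrite lt_neqAle t0' t0.
  by rewrite lt_eqF //; nra.
- apply: connected_continuous_connected; last first.
    by apply: continuous_subspaceT; exact: line_continuous.
  by apply/connected_intervalP; exact: interval_is_interval.
Qed.

Lemma sgz_near i y : sv y i != 0 -> \forall z \near y, sv z i = sv y i.
Proof.
rewrite svE; case: (sgzP (affv i y)) => // h _.
- have /cvgr_gt/(_ _ h) := @affv_continuous i y.
  by apply: filterS => z hz; rewrite svE gtr0_sgz.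
- have /cvgr_lt/(_ _ h) := @affv_continuous i y.
  by apply: filterS => z hz; rewrite svE ltr0_sgz.
Qed.

(** Nonzero signs persist near [y]; conversely the points [y + t *: (x - y)] with small [t > 0] lie
    in the cell and tend to [y]. *)
Lemma closure_cell x : closure (cell x) = [set y | sle (sv y) (sv x)].
Proof.
apply/seteqP; split=> y.
  move=> cy i; case: (eqVneq (sv y i) 0) => [|n0]; [by left|right].
  by have [z [<- <-]] := cy _ (sgz_near n0).
move=> yx B nB; have [e e0 he] := sv_eps l b y (x - y).
have : \forall t \near (0 : R), B (y + t *: (x - y)).
  have := @line_continuous y (x - y) 0; rewrite /continuous_at scale0r addr0.
  by move=> /(_ _ nB).
move=> /nbhs_ballP[e' /= e'0 hB]; pose t := Num.min e (e' / 2).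
have t0 : 0 < t by rewrite lt_min e0 divr_gt0.
exists (y + t *: (x - y)); split; last first.
  apply: hB; rewrite /ball /= sub0r normrN gtr0_norm // /t.
  by rewrite gt_min; apply/orP; right; lra.
rewrite /cell /= he ?t0 ?ge_min ?lexx //; apply/ffunP => i; rewrite scompE.
case: ifP => [|n0]; last by case: (yx i) => // e1; rewrite e1 eqxx in n0.
by rewrite svE dvE -(affvB l b) sgz_eq0 => /eqP ->; rewrite subr0 svE.
Qed.

Lemma sle_refl (s : {ffun I -> int}) : sle s s.
Proof. by move=> i; right. Qed.

Lemma cell_leP x y : cell_le (cell x) (cell y) <-> sle (sv x) (sv y).
Proof.
rewrite /cell_le !closure_cell; split=> [h|xy z zx]; first exact: (h x (sle_refl _)).
by move=> i; case: (zx i) => [|->]; [left|exact: xy].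
Qed.

Lemma cell_eq x y : cell x = cell y <-> sv x = sv y.
Proof.
split=> [e|e]; last by rewrite /cell e.
by have : cell x x by []; rewrite e.
Qed.

Lemma affine_span_cell x : affine_span (cell x) = pts (zs x).
Proof.
apply/seteqP; split=> y.
  move=> [m [p [t [pC t1 ->]]]]; apply/subsetP => i ix; rewrite in_zs /affv.
  have hp j : l i (p j) = b i.
    have := zs_sv (pC j); move: ix => + e; rewrite -e in_zs => /eqP h.
    by apply/eqP; rewrite -subr_eq0; apply/eqP.
  rewrite linear_sum /=; under eq_bigr do rewrite lZ hp.
  by rewrite -mulr_suml t1 mul1r subrr.
move=> xy; have [e e0 he] := sv_eps l b x (y - x).
pose z := x + e *: (y - x).
have zx : cell x z.
  rewrite /cell /= he ?e0 ?lexx //; apply/ffunP => i; rewrite scompE sv_eq0.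
  case: ifP => // ix; have /dirP : y - x \in dir (zs x).
    exact: (@sub_dir_zs _ _ _ l b).
  by move=> /(_ i ix) h; rewrite dvE h sgz0; apply/esym/eqP; rewrite sv_eq0.
(* [y] is the affine combination of the points [x] and [z] of the cell with weights [1 - e^-1] and
   [e^-1]. *)
exists 2%N, (fun j => if j == ord0 then x else z),
  (fun j => if j == ord0 then 1 - e^-1 else e^-1); split.
- by move=> j; case: ifP.
- by rewrite !big_ord_recl big_ord0 /= addr0 subrK.
- rewrite !big_ord_recl big_ord0 /= addr0 /z scalerDr scalerA mulVf ?lt0r_neq0 //.
  by rewrite scale1r scalerBl scale1r addrA subrK addrC subrK.
Qed.

(** [K] may miss hyperplanes that contain the whole intersection. A short step along a generic
    direction of [dir K] leaves all the others. *)
Lemma pts_generic (K : {set I}) : pts K !=set0 -> exists x, pts K = pts (zs x).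
Proof.
move=> [x0 Kx0].
pose bad := [seq lker (l i) | i <- enum I & ~~ (dir K <= lker (l i))%VS].
have [|n nK hn] := @avoid_subspaces R E (dir K) bad.
  by move=> S /mapP[i]; rewrite mem_filter => /andP[h _] ->.
have [x [_ zx [t _ xE]]] := sv_comp l b x0 n.
exists x; apply/seteqP; split=> y; last first.
  apply: fintype.subset_trans; rewrite xE; apply: subset_zsD => //; exact: memvZ.
move=> Ky; apply/subsetP => i; rewrite zx inE => /andP[ix0 /eqP in0].
have : (dir K <= lker (l i))%VS.
  apply/negPn/negP => h; have := hn (lker (l i)); rewrite memv_ker in0 eqxx => /(_ _)/negP.
  by apply=> //; apply/mapP; exists i; rewrite // mem_filter h mem_enum.
move=> /subvP/(_ (y - x0)); rewrite (@sub_dir_zs _ _ _ l b) // memv_ker => /(_ isT).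
by rewrite -(affvB l b) in_zs; move: ix0; rewrite in_zs => /eqP ->; rewrite subr0.
Qed.

Lemma sle_zs0 x y : zs x = finset.set0 -> sle (sv x) (sv y) -> sv x = sv y.
Proof.
move=> zx xy; apply/ffunP => i; case: (xy i) => // /eqP.
by rewrite sv_eq0 zx finset.in_set0.
Qed.

(** A nonzero recession direction gives a ray in the cell. Conversely, the function [f] of the proof
    vanishes only at recession directions, so it has a positive minimum on the unit sphere; since
    [f (y - x)] is bounded for [y] in the cell, homogeneity of [f] bounds [|y - x|]. *)
Lemma bounded_cellP x : zs x = finset.set0 ->
  bounded_set (cell x) <-> bnd l [set: I]%SET finset.set0 (sv x).
Proof.
move=> zx.
have xi i : sv x i * sv x i = 1.
  have : sv x i != 0 by rewrite sv_eq0 zx finset.in_set0.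
  by rewrite svE; case: (sgzP (affv i x)).
split.
  move=> [M [Mr hM]] v _ hv; apply/eqP; apply/negPn/negP => v0.
  have vn : 0 < `|v| by rewrite normr_gt0.
  (* Makes [|t *: v|] exceed [|x|] by more than the radius [|M| + 1] tested below. *)
  pose t := (`|M| + 2 + `|x|) / `|v|.
  have t0 : 0 <= t by rewrite divr_ge0 // addr_ge0 // addr_ge0.
  have cx : cell x (x + t *: v).
    apply/ffunP => i; rewrite !svE affvD lZ; have := hv i (finset.in_setT i); rewrite dvE svE.
    have := sv_eq0 l b x i; rewrite zx finset.in_set0 svE.
    case: (sgzP (affv i x)) => // h1 _; case: (sgzP (l i v : R)) => h2 [] // _.
    - by rewrite h2 mulr0 addr0 gtr0_sgz.
    - by rewrite gtr0_sgz // ltr_wpDr // mulr_ge0 // ltW.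
    - by rewrite h2 mulr0 addr0 ltr0_sgz.
    - by rewrite ltr0_sgz // ltr_wnDr // mulr_ge0_le0 // ltW.
  have := hM (`|M| + 1) _ _ cx; rewrite ltr_pwDr ?ler_norm // => /(_ isT).
  apply/negP; rewrite -ltNge.
  have tv : `|t *: v| = `|M| + 2 + `|x|.
    by rewrite normrZ ger0_norm // /t divfK // gt_eqF.
  have : `|t *: v| <= `|x + t *: v| + `|x|.
    by rewrite -{1}[t *: v](addKr x) addrC; apply: ler_normB.
  rewrite tv; lra.
move=> bx; pose f (v : E) : R := \sum_(i <- index_enum I)
  (`|l i v : R| - (sv x i)%:~R * (l i v : R)).
have s1 i : (sv x i)%:~R = 1 :> R \/ (sv x i)%:~R = -1 :> R.
  have := xi i; rewrite svE; case: (sgzP (affv i x)) => // _ _; [left|right]; by [].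
have term_ge0 i v : 0 <= `|l i v : R| - (sv x i)%:~R * (l i v : R).
  by have [->|->] := s1 i; rewrite ?mul1r ?mulN1r subr_ge0 ?ler_norm // -normrN ler_norm.
have f0 v : f v = 0 -> v = 0.
  move=> fv; apply: bx => [|i _]; first by apply/dirP => i; rewrite finset.in_set0.
  have h : `|l i v : R| = (sv x i)%:~R * (l i v : R).
    apply/eqP; rewrite -subr_eq0; move: fv => /eqP; rewrite psumr_eq0 // => /allP/(_ i).
    by rewrite mem_index_enum => /(_ isT).
  have aux (s : int) (y : R) : `|y| = s%:~R * y -> sgz y = 0 \/ sgz y = s.
    case: (sgzP y) => [->|y0|y0] h'; [by left|right|right].
      have : s%:~R = 1 :> R.
        by apply: (mulIf (lt0r_neq0 y0)); rewrite -h' mul1r ?gtr0_norm.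
      by move=> /eqP; rewrite -[1]/(1%:~R) eqr_int => /eqP.
    have : s%:~R = -1 :> R.
      by apply: (mulIf (ltr0_neq0 y0)); rewrite -h' mulN1r ?ltr0_norm.
    by move=> /eqP; rewrite -[-1]/((-1)%:~R) eqr_int => /eqP.
  by rewrite dvE; exact: aux.
have fZ t v : 0 <= t -> f (t *: v) = t * f v.
  move=> t0; rewrite /f mulr_sumr; apply: eq_bigr => i _.
  by rewrite lZ normrM ger0_norm //; ring.
have fc : continuous f.
  apply: sum_continuous => i v.
  apply: (@continuousB R R E (fun v : E => `|l i v : R|)
    (fun v : E => (sv x i)%:~R * (l i v : R))).
    apply: (@continuous_comp E R R (fun v : E => l i v : R) Num.norm).
      exact: lin_continuous.
    exact: norm_continuous.
  apply: (@continuousM R E (fun=> (sv x i)%:~R) (fun v : E => l i v : R)).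
    exact: cst_continuous.
  exact: lin_continuous.
pose S := [set v : E | `|v| = 1].
have fub y : cell x y -> f (y - x) <= 2 * \sum_(i <- index_enum I) `|affv i x|.
  move=> cy; rewrite /f mulr_sumr; apply: ler_sum => i _.
  have := congr1 (fun s : {ffun I -> int} => s i) cy; rewrite /= !svE.
  rewrite -(affvB l b); have := sv_eq0 l b x i; rewrite zx finset.in_set0 svE.
  case: (sgzP (affv i x)) => // h1 _; case: (sgzP (affv i y)) => // h2 _.
    rewrite -[1%:~R]/1 mul1r ?(gtr0_norm h1).
    by case: (ler0P (affv i y - affv i x)); lra.
  rewrite -[(-1)%:~R]/(-1) mulN1r ?(ltr0_norm h1).
  by case: (ler0P (affv i y - affv i x)); lra.
(* For [d = 0] the sphere is empty and there is no minimum to take. *)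
have [S0|/set0P S0] := eqVneq S classical_sets.set0.
  exists 0; split; first exact: real0.
  move=> M M0 y _ /=; have [->|y0] := eqVneq y 0; first by rewrite normr0 ltW.
  exfalso; suff : S (`|y|^-1 *: y) by rewrite S0.
  by rewrite /S /= normrZ normfV normr_id mulVf // normr_eq0.
have [||c cS cmin] := @compact_EVT_min E R f S S0.
- apply: bounded_closed_compact.
    by exists 1; split; [exact: real1|move=> M M1 v /= ->; exact: ltW].
  have := @closed_comp E R Num.norm [set 1]; apply; first by move=> ? _; exact: norm_continuous.
  exact: closed_eq.
- by apply: continuous_subspaceT; exact: fc.
have fc0 : 0 < f c.
  rewrite lt_neqAle sumr_ge0 ?andbT // eq_sym; apply/eqP => /f0 c0.
  by have := set_mem cS; rewrite /S /= c0 normr0 => /esym/eqP; rewrite oner_eq0.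
pose B := 2 * \sum_(i <- index_enum I) `|affv i x|.
exists (B / f c + `|x|); split; first exact: num_real.
move=> M hM y cy /=; apply: le_trans (ltW hM).
have : `|y| <= `|y - x| + `|x| by rewrite -{1}[y](subrK x) ler_normD.
move=> /le_trans; apply; rewrite lerD2r ler_pdivlMr //.
apply: le_trans (fub y cy).
have [->|yx] := eqVneq (y - x) 0; first by rewrite normr0 mul0r sumr_ge0.
have : f c <= f (`|y - x|^-1 *: (y - x)).
  by apply: cmin; apply/mem_set; rewrite /S /= normrZ normfV normr_id mulVf // normr_eq0.
rewrite fZ ?invr_ge0 // => h; have yp : 0 < `|y - x| by rewrite normr_gt0.
have := ler_wpM2l (ltW yp) h; by rewrite mulrA mulfV ?mul1r // gt_eqF.
Qed.

End Cells.

(** * Chains of the intersection semilattice as flags *)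

Section FlatChains.
Variables (R : realType) (d : nat) (I : finType).
Local Notation E := 'rV[R]_d.
Variables (l : I -> 'Hom(E, R^o)) (b : I -> R) (A : set (set E)).
Hypothesis AE : forall H, A H <-> exists i, H = hyp l b i.
Hypothesis nz : forall i, exists v, l i v != 0 :> R.
Local Notation sv := (sv l b).
Local Notation dv := (dv l).
Local Notation zs := (zs l b).
Local Notation affv := (affv l b).
Local Notation dir := (dir l).
Local Notation flat := (flat l b).
Local Notation cov := (cov l b).
Local Notation flagp := (flagp l b).
Local Notation flag_cycle := (flag_cycle l b).
Local Notation hyp := (hyp l b).
Local Notation cell := (cell l b).
Local Notation pts := (pts l b).
Local Notation Lat := (intersections A `\ [set: E]).
Local Notation KL := (order_complex Lat (@flat_le R d)).
Local Notation set0 := (finset.set0 : {set I}).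

Definition code (X : set E) : {set I} := [set i | `[< X `<=` hyp i >]]%SET.

Lemma code_pts x : code (pts (zs x)) = zs x.
Proof.
apply/setP => i; rewrite inE; apply/asboolP/idP => [h|ix y].
  by rewrite in_zs; apply/eqP; apply: h; rewrite /pts /=.
by move=> /subsetP/(_ i ix); rewrite in_zs => /eqP.
Qed.

Lemma code_flat X : flat X -> code (pts X) = X.
Proof. by move=> /asboolP[x <-]; exact: code_pts. Qed.

Lemma pts_sub X Y : flat X -> (pts X `<=` pts Y) <-> (Y \subset X)%B.
Proof.
move=> /asboolP[x <-]; split=> [h|h y]; first exact: (h x (fintype.subxx _)).
by apply: fintype.subset_trans.
Qed.

Lemma flat0 : flat set0.
Proof.
have [|x xE] := @pts_generic R d I l b set0; first by exists 0; rewrite /pts /= finset.sub0set.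
apply/asboolP; exists x; apply/setP => i; rewrite finset.in_set0; apply/negbTE/negP => ix.
have [v vn] := nz i; have : pts (zs x) (x + v) by rewrite -xE /pts /= finset.sub0set.
move=> /subsetP/(_ i ix); rewrite in_zs affvD; move: ix; rewrite in_zs => /eqP ->.
by rewrite add0r (negPf vn).
Qed.

Lemma dim_dir0 : \dim (dir set0) = d.
Proof.
have -> : dir set0 = fullv by rewrite /dir big_set0.
by rewrite dimvf /dim /= mul1n.
Qed.

Lemma LatP X : Lat X <-> exists2 Z, X = pts Z & flat Z /\ Z != set0.
Proof.
split.
  move=> [[X0 [A' A'A XE]] nX]; pose K := [set i | `[< A' (hyp i) >]]%SET.
  have XK : X = pts K.
    rewrite XE; apply/seteqP; split=> y h.
      by apply/subsetP => i; rewrite inE => /asboolP /h /= e; rewrite in_zs; apply/eqP.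
    move=> H HA; have [i Hi] := (AE H).1 (A'A _ HA); rewrite Hi in HA *.
    have : i \in zs y by apply: (subsetP h); rewrite inE; apply/asboolP.
    by rewrite in_zs => /eqP.
  have [|x xE] := @pts_generic R d I l b K; first by rewrite -XK.
  exists (zs x); first by rewrite XK xE.
  split; first exact: flat_zs.
  apply/eqP => zx; apply: nX; rewrite XK xE zx; apply/seteqP; split=> // y _.
  by rewrite /pts /= finset.sub0set.
move=> [Z -> [/asboolP[x <-] zx]]; split.
  split; first by exists x; rewrite /pts /=.
  exists [set H | exists2 i, i \in zs x & H = hyp i].
    by move=> H [i _ ->]; apply/AE; exists i.
  apply/seteqP; split=> y h.
    by move=> H [i ix ->]; have := subsetP h i ix; rewrite in_zs => /eqP.
  by apply/subsetP => i ix; rewrite in_zs; apply/eqP; apply: (h (hyp i)); exists i.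
move=> e; case/set0Pn: zx => i ix; have [v vn] := nz i.
have : pts (zs x) (x + v) by rewrite e.
move=> /subsetP/(_ i ix); rewrite in_zs affvD; move: ix; rewrite in_zs => /eqP ->.
by rewrite add0r (negPf vn).
Qed.

Lemma Lat_code X : Lat X -> [/\ pts (code X) = X, flat (code X) & code X != set0].
Proof. by move=> /LatP[Z -> [fZ Z0]]; rewrite code_flat. Qed.

(** Codimension minus one: the position, counted from 0, in a complete flag listed from hyperplanes
    down to the vertex. *)
Definition rk (X : set E) : nat := (d - (\dim (dir (code X))).+1)%N.

Lemma Lat_dim X : Lat X -> (\dim (dir (code X)) < d)%N.
Proof.
move=> /Lat_code[_ fX X0]; rewrite -[X in (_ < X)%N]dim_dir0.
by apply: (dim_lt flat0 fX); rewrite ?finset.sub0set // eq_sym.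
Qed.

Lemma KL_comparable (s : set (set E)) X Y : KL s -> s X -> s Y ->
  (code X \subset code Y)%B \/ (code Y \subset code X)%B.
Proof.
move=> [_ sL cs] sX sY; have [eX fX _] := Lat_code (sL _ sX).
have [eY fY _] := Lat_code (sL _ sY).
have [h|h] := cs X Y sX sY; [left|right]; apply/pts_sub => //; by rewrite eX eY.
Qed.

Lemma KL_rk_inj (s : set (set E)) X Y : KL s -> s X -> s Y -> rk X = rk Y -> X = Y.
Proof.
move=> Ks sX sY; have [_ sL _] := Ks.
have dX := Lat_dim (sL _ sX); have dY := Lat_dim (sL _ sY).
have [eX fX _] := Lat_code (sL _ sX); have [eY fY _] := Lat_code (sL _ sY).
rewrite /rk => e; have dE : \dim (dir (code X)) = \dim (dir (code Y)) by lia.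
rewrite -eX -eY; congr pts.
have [h|h] := KL_comparable Ks sX sY.
  by apply/eqP; apply: contra_eqT dE => n; rewrite neq_ltn (dim_lt fX fY h n) orbT.
by apply/eqP; apply: contra_eqT dE => n; rewrite neq_ltn (dim_lt fY fX h) // eq_sym.
Qed.

Lemma KL_rk n (y : n.-tuple (set E)) : uniq y -> KL [set` y] ->
  (forall i, (rk (tnth y i) < d)%N) /\ injective (fun i => rk (tnth y i)).
Proof.
move=> uy Ky; have [_ yL _] := Ky; split=> [i|i j e].
  by have := Lat_dim (yL _ (mem_tnth i y)); rewrite /rk; lia.
have := KL_rk_inj Ky (mem_tnth i y) (mem_tnth j y) e.
by move/tuple_uniqP: uy; apply.
Qed.

(** The ranks along a chain are distinct numbers below [d]. This makes top homology equal to the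
    group of top cycles. *)
Lemma KL_no_big (y : d.+1.-tuple (set E)) : uniq y -> ~ KL [set` y].
Proof.
move=> uy Ky; have [h1 h2] := KL_rk uy Ky.
pose f i := Ordinal (h1 i); have fi : injective f by move=> i j /(congr1 val) /h2.
by have := leq_card f fi; rewrite !card_ord ltnn.
Qed.

Lemma path_cov_dim X s : path cov X s -> forall j, (j < size s)%N ->
  flat (nth X s j) /\ (\dim (dir (nth X s j)) + j.+1)%N = \dim (dir X).
Proof.
elim: s X => // Y s ih X /= /andP[c ps] [|j] js /=.
  by have [_ fY _ ->] := covP c; rewrite addn1.
have [fj dj] := ih Y ps j js; rewrite (set_nth_default Y) //; split=> //.
by have [_ _ _ ->] := covP c; rewrite -dj addnS.
Qed.

Lemma flagp_size s : flagp set0 s -> size s = d.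
Proof.
rewrite /flagp => /andP[ps /eqP dl]; case: (lastP s) ps dl => [_ /=|s' L ps].
  by rewrite dim_dir0.
rewrite last_rcons => dL; have [|_] := path_cov_dim ps (j := size s').
  by rewrite size_rcons.
by rewrite nth_rcons ltnn eqxx dL dim_dir0 size_rcons.
Qed.

Lemma flagp_path_sub X s i j : path cov X s -> (i <= j < size s)%N ->
  (nth X s i \subset nth X s j)%B.
Proof.
move=> ps /andP[ij js].
have /path_sorted ss : path (fun Y Z : {set I} => (Y \subset Z)%B) X s.
  by apply: sub_path ps => Y Z /covP[].
have tr : transitive (fun Y Z : {set I} => (Y \subset Z)%B).
  by move=> Y Z W; exact: fintype.subset_trans.
have rf : reflexive (fun Y Z : {set I} => (Y \subset Z)%B).
  by move=> Y; exact: fintype.subxx.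
by apply: (sorted_leq_nth tr rf X ss); rewrite ?inE ?(leq_ltn_trans ij).
Qed.

Lemma flagp_mem s Z : flagp set0 s -> Z \in s -> flat Z /\ Z != set0.
Proof.
move=> /andP[ps _] /(nthP set0)[j js <-]; have [fj dj] := path_cov_dim ps js.
split=> //; apply/eqP => e; move: dj; rewrite e => dj; lia.
Qed.

Lemma map_code_pts s : flagp set0 s -> map code (map pts s) = s.
Proof.
move=> fs; rewrite -map_comp -[RHS]map_id; apply/eq_in_map => Z Zs /=.
by apply: code_flat; have [] := flagp_mem fs Zs.
Qed.

Lemma flag_ranked s (y : d.-tuple (set E)) : flagp set0 s -> map pts s = y ->
  [/\ uniq y, KL [set` y] & ranked rk y].
Proof.
move=> fs sy; have ss := flagp_size fs; have /andP[ps _] := fs.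
have ry : ranked rk y.
  move=> i; rewrite (tnth_nth [set: E]) -sy (nth_map set0) ?ss //.
  have si : (i < size s)%N by rewrite ss.
  have [fi di] := path_cov_dim ps si.
  rewrite /rk code_flat //; move: di; rewrite dim_dir0; lia.
have yP X : X \in y -> exists2 i, (i < d)%N & X = pts (nth set0 s i).
  rewrite -[X \in y]/(X \in (y : seq _)) -sy => /mapP[Z /(nthP set0)[i hi <-] ->].
  by exists i => //; rewrite -ss.
split=> //.
  apply/tuple_uniqP => i j e; apply/val_inj => /=.
  by rewrite -(ry i) -(ry j) e.
split; first exact: finite_seq.
  move=> X /= /yP[i id ->]; apply/LatP; exists (nth set0 s i) => //.
  by apply: (flagp_mem fs); rewrite mem_nth // ss.
move=> X Y /= /yP[i id ->] /yP[j jd ->].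
have aux (i' j' : nat) : (i' <= j')%N -> (j' < d)%N ->
    pts (nth set0 s j') `<=` pts (nth set0 s i').
  move=> ij j'd; have sj : (j' < size s)%N by rewrite ss.
  have [fj _] := path_cov_dim ps sj.
  by apply/pts_sub => //; apply: (flagp_path_sub ps); rewrite ij ss.
by case: (leqP i j) => h; [left|right]; apply: aux => //; exact: ltnW.
Qed.

(** The ranks of [y] leave no gap, so consecutive members differ by one in dimension. *)
Lemma ranked_flag (y : d.-tuple (set E)) : uniq y -> KL [set` y] -> ranked rk y ->
  flagp set0 (map code y) /\ map pts (map code y) = y.
Proof.
move=> uy Ky ry; have [_ yL _] := Ky.
have yC X : X \in y -> [/\ pts (code X) = X, flat (code X) & code X != set0].
  by move=> Xy; apply: Lat_code; exact: yL.
split; last first.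
  by rewrite -map_comp -[RHS]map_id; apply/eq_in_map => X /yC[].
have di (i : 'I_d) : (\dim (dir (code (tnth y i))) + i.+1)%N = d.
  have := ry i; have := Lat_dim (yL _ (mem_tnth i y)); rewrite /rk.
  by move: (\dim _) (ltn_ord i) => m; lia.
have nthE (i : 'I_d) : nth set0 (map code y) i = code (tnth y i).
  by rewrite (nth_map [set: E]) ?size_tuple // -tnth_nth.
apply/andP; split; last first.
  (* For [d = 0] the flag is empty and the whole space is the vertex. *)
  case: (posnP d) => d0.
    have -> : map code y = [::] by apply: size0nil; rewrite size_map size_tuple d0.
    by rewrite /= dim_dir0 d0.
  have ld : (d.-1 < d)%N by rewrite prednK.
  have := di (Ordinal ld); rewrite -nthE /= prednK // => h.
  by rewrite (last_nth set0) size_map size_tuple -[d in nth _ _ d](prednK d0) /=; apply/eqP; lia.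
apply/(pathP set0) => i; rewrite size_map size_tuple => id.
have := di (Ordinal id); have [eY fY Y0] := yC _ (mem_tnth (Ordinal id) y).
rewrite -nthE /= => dY; rewrite -nthE /= in fY.
case: i id eY fY dY Y0 => [|i] id eY fY dY Y0 /=.
  by rewrite /cov flat0 fY finset.sub0set dim_dir0 /=; apply/eqP; lia.
have id' : (i < d)%N := ltnW id.
have := di (Ordinal id'); have [eX fX X0] := yC _ (mem_tnth (Ordinal id') y).
rewrite -nthE /= => dX; rewrite -nthE /= in fX.
rewrite /cov fX fY /=; apply/andP; split; last by apply/eqP; lia.
have := KL_comparable Ky (mem_tnth (Ordinal id') y) (mem_tnth (Ordinal id) y).
rewrite -!nthE /= => -[//|h]; have := dimvS (dirS l h).
set a := \dim _ in dX *; set c := \dim _ in dY *; lia.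
Qed.

End FlatChains.

(** * Integer combinations of homology classes *)

Section HomologyArithmetic.
Variables (V : choiceType) (K : set (set V)) (n : nat).

Lemma hclass_sum (J : Type) (r : seq J) (z : J -> cycles K n) (k : J -> int) :
  hclass (\sum_(j <- r) z j *~ k j) = \sum_(j <- r) hclass (z j) *~ k j.
Proof.
by rewrite /hclass raddf_sum; apply: eq_bigr => j _; rewrite raddfMz.
Qed.

Lemma cycle_val_mulrz (z : cycles K n) (k : int) y :
  cycle_val (z *~ k) y = k * cycle_val z y.
Proof.
have nat_case m : cycle_val (z *+ m) y = m%:Z * cycle_val z y.
  elim: m => [|m ih]; first by rewrite mulr0n mul0r.
  rewrite mulrS; have -> : cycle_val (z + z *+ m) y = cycle_val z y + cycle_val (z *+ m) y by [].
  by rewrite ih -addn1 PoszD mulrDl mul1r addrC.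
case: k => m; first exact: nat_case.
rewrite NegzE mulrNz; have -> : cycle_val (- (z *~ m.+1)) y = - cycle_val (z *~ m.+1) y by [].
by rewrite -pmulrn nat_case mulNr.
Qed.

Lemma cycle_val_sum (J : Type) (r : seq J) (z : J -> cycles K n) (k : J -> int) y :
  cycle_val (\sum_(j <- r) z j *~ k j) y = \sum_(j <- r) k j * cycle_val (z j) y.
Proof.
elim: r => [|j r ih]; first by rewrite !big_nil.
by rewrite !big_cons -ih -cycle_val_mulrz.
Qed.

Lemma cycle_eq (z z' : cycles K n) : cycle_val z = cycle_val z' -> z = z'.
Proof. by move=> e; apply: val_inj. Qed.

Lemma cycle_is_chain (z : cycles K n) : is_chain K (cycle_val z) /\ is_cycle (cycle_val z).
Proof. by case: z => c /= /asboolP. Qed.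

(** Without simplices one degree higher, 0 is the only boundary. *)
Lemma hclass_inj : (forall y : n.+1.-tuple V, uniq y -> ~ K [set` y]) ->
  injective (@hclass V K n).
Proof.
move=> nK z z' /hclass_eq /asboolP[c [_ cs _] bc]; apply/eqP; rewrite -subr_eq0; apply/eqP.
apply: cycle_eq; rewrite -bc.
have -> : c = 0.
  apply/funext => y; apply/eqP; apply/negPn/negP => /cs[uy Ky]; exact: nK Ky.
exact: boundary0.
Qed.

Lemma hclass_repr (a : homology K n) : exists z : cycles K n, a = hclass z.
Proof. by exists (repr (a : Quotient.quot _)); rewrite /hclass reprK. Qed.

End HomologyArithmetic.

(** * Simplicial cycles of flats and flag cycles *)

Section FlatCycles.
Variables (R : realType) (d : nat) (I : finType).
Local Notation E := 'rV[R]_d.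
Variables (l : I -> 'Hom(E, R^o)) (b : I -> R) (A : set (set E)).
Hypothesis AE : forall H, A H <-> exists i, H = hyp l b i.
Hypothesis nz : forall i, exists v, l i v != 0 :> R.
Local Notation sv := (sv l b).
Local Notation dv := (dv l).
Local Notation zs := (zs l b).
Local Notation affv := (affv l b).
Local Notation dir := (dir l).
Local Notation flat := (flat l b).
Local Notation cov := (cov l b).
Local Notation flagp := (flagp l b).
Local Notation flag_cycle := (flag_cycle l b).
Local Notation hyp := (hyp l b).
Local Notation cell := (cell l b).
Local Notation pts := (pts l b).
Local Notation code := (code l b).
Local Notation rk := (rk l b).
Local Notation Lat := (intersections A `\ [set: E]).
Local Notation KL := (order_complex Lat (@flat_le R d)).
Local Notation set0 := (finset.set0 : {set I}).

(** On a flag [insub] succeeds, by [flagp_size]. *)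
Definition flc (c : d.-tuple (set E) -> int) (s : seq {set I}) : int :=
  if flagp set0 s then oapp c 0 (insub (map pts s)) else 0.

Lemma flcE c s (y : d.-tuple (set E)) : flagp set0 s -> map pts s = y -> flc c s = c y.
Proof. by move=> fs e; rewrite /flc fs e valK. Qed.

Lemma flag_tuple s : flagp set0 s -> exists y : d.-tuple (set E), map pts s = y.
Proof.
move=> fs; have sz : size (map pts s) == d by rewrite size_map (flagp_size fs).
by exists (Tuple sz).
Qed.

Lemma flc_sum (J : Type) (r : seq J) (c : J -> d.-tuple (set E) -> int) (k : J -> int) s :
  flc (fun y => \sum_(j <- r) k j * c j y) s = \sum_(j <- r) k j * flc (c j) s.
Proof.
rewrite /flc; case: ifP => _; last by rewrite big1 // => j _; rewrite mulr0.
by case: insub => //=; rewrite big1 // => j _; rewrite mulr0.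
Qed.

Lemma sum_flats (f : set E -> int) :
  (forall v, f v != 0 -> exists2 Y, v = pts Y & flat Y) ->
  \sum_(v \in [set: set E]) f v = \sum_(Y | flat Y) f (pts Y).
Proof.
move=> hf; pose rv := [seq pts Y | Y <- enum (fun Y => flat Y)].
rewrite (@fsbigE _ _ _ _ _ rv) //.
- rewrite big_map big_enum_cond /=; apply: eq_bigl => Y.
  by rewrite classical_sets.in_setT andbT.
- rewrite map_inj_in_uniq ?enum_uniq // => Y Y'; rewrite !mem_enum => fY fY' e.
  by rewrite -(code_flat fY) -(code_flat fY') e.
- move=> v _ nv; apply/eqP; apply/negPn/negP => /hf[Y vE fY]; case/negP: nv.
  by rewrite vE map_f // mem_enum.
Qed.

(** The other members keep their ranks and ranks in a chain are distinct, so [v] has the missing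
    rank. *)
Lemma chain_insert_flag c s1 s2 Y0 (z : set E -> d.-tuple (set E)) v :
  is_chain KL c -> (forall v, z v = map pts s1 ++ v :: map pts s2 :> seq _) ->
  flagp set0 (s1 ++ Y0 :: s2) -> c (z v) != 0 ->
  exists2 Y, v = pts Y & flagp set0 (s1 ++ Y :: s2).
Proof.
move=> [_ sc _] zE f0 cn; have [uz Kz] := sc _ cn.
have sd := flagp_size f0; rewrite size_cat /= addnS in sd.
have jn : (size s1 < d)%N by rewrite -sd ltnS leq_addr.
pose j := Ordinal jn.
have z0 : map pts (s1 ++ Y0 :: s2) = z (pts Y0) by rewrite map_cat zE.
have [_ _ r0] := flag_ranked AE nz f0 z0.
have ri i : i != j -> rk (tnth (z v) i) = i.
  move=> ij; rewrite -[RHS](r0 i); congr rk; rewrite !(tnth_nth [set: E]) !zE !nth_cat.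
  rewrite size_map; case: ltnP => // h.
  have -> : (i - size s1 = (i - size s1).-1.+1)%N; last by [].
  rewrite prednK // subn_gt0 ltn_neqAle h andbT eq_sym.
  by apply: contra ij => /eqP e; apply/eqP/val_inj.
have rz : ranked rk (z v).
  move=> i; case: (eqVneq i j) => [->|/ri//].
  have [lt inj] := KL_rk AE nz uz Kz; pose m := Ordinal (lt j).
  case: (eqVneq m j) => [/(congr1 val)//|mj].
  by have e := ri m mj; case/eqP: mj; apply: inj; rewrite e.
have [fz ez] := ranked_flag AE nz uz Kz rz.
have vz : v \in (z v : seq _) by rewrite zE mem_cat inE eqxx orbT.
have [_ zL _] := Kz; have [vE _ _] := Lat_code AE nz (zL v vz).
exists (code v) => //; move: fz; rewrite zE map_cat /=.
have := map_code_pts f0; rewrite !map_cat /= => /eqP; rewrite eqseq_cat ?size_map //.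
by move=> /andP[/eqP -> /eqP[_ ->]].
Qed.

Lemma flc_fcycle c : is_chain KL c -> is_cycle c -> flag_cycle set0 (flc c).
Proof.
move=> cc zc; have [fc sc ac] := cc; split=> [s|s1 s2].
  by rewrite /flc; case: ifP => //; rewrite eqxx.
have [[Y0 f0]|nY] := pselect (exists Y, flagp set0 (s1 ++ Y :: s2)); last first.
  by rewrite big1 // => Y _; rewrite /flc; case: ifP => // h; case: nY; exists Y.
have sz (v : set E) : size (map pts s1 ++ v :: map pts s2) == d.
  by have := flagp_size f0; rewrite !size_cat /= !size_map => ->.
pose z v : d.-tuple (set E) := Tuple (sz v).
have zE v : z v = map pts s1 ++ v :: map pts s2 :> seq _ by [].
have key v : c (z v) != 0 -> exists2 Y, v = pts Y & flagp set0 (s1 ++ Y :: s2).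
  by move=> cn; exact: (chain_insert_flag cc zE f0 cn).
have fm Y : flagp set0 (s1 ++ Y :: s2) -> flat Y.
  have Ym : Y \in s1 ++ Y :: s2 by rewrite mem_cat inE eqxx orbT.
  by move=> /flagp_mem/(_ Ym)[].
rewrite -[RHS](is_cycle_insert [set: E] ac zc zE) sum_flats; last first.
  by move=> v /key[Y vE /fm]; exists Y.
rewrite [RHS]big_mkcond /=; apply: eq_bigr => Y _.
case: (boolP (flagp set0 (s1 ++ Y :: s2))) => h.
  by rewrite (fm _ h) (flcE _ h (y := z (pts Y))) // map_cat.
rewrite /flc (negPf h); case: ifP => // fY; apply/esym/eqP/negPn/negP => /key[Y' e h'].
by case/negP: h; rewrite -(code_flat fY) e code_flat // fm.
Qed.

(** The test keeps the sequences on which [code] can be undone by [pts]. *)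
Definition flagseq (f : seq {set I} -> int) (w : seq (set E)) : int :=
  if w == map pts (map code w) then f (map code w) else 0.

Lemma flagseq_supp f w : flag_cycle set0 f -> flagseq f w != 0 ->
  flagp set0 (map code w) /\ map pts (map code w) = w.
Proof.
move=> [fs _]; rewrite /flagseq.
by case: (w =P map pts (map code w)) => [e /fs|_]; rewrite ?eqxx.
Qed.

Lemma alt_flagseq_cycle f : flag_cycle set0 f ->
  is_chain KL (alt (n := d) (flagseq f)) /\ is_cycle (alt (n := d) (flagseq f)).
Proof.
move=> fc; have [fs fz] := fc.
have supp (y : d.-tuple (set E)) : alt (flagseq f) y != 0 ->
    exists s : 'S_d, flagseq f (perm_tuple s y) != 0.
  move=> yn; apply: contrapT => h; case/negP: yn; rewrite /alt big1 // => s _.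
  by apply/eqP; rewrite mulf_eq0; apply/orP; right; apply/negPn/negP => hs; apply: h; exists s.
have fin : finite_set [set y : d.-tuple (set E) |
    exists s : 'S_d, flagseq f (perm_tuple s y) != 0].
  apply: (@sub_finite_set _ _ ((fun p : 'S_d * d.-tuple {set I} =>
      perm_tuple p.1 (map_tuple pts p.2)) @` [set: 'S_d * d.-tuple {set I}])).
    move=> y [s /(flagseq_supp fc)[h1 h2]].
    exists ((s^-1)%g, map_tuple code (perm_tuple s y)) => //=.
    have -> : map_tuple pts (map_tuple code (perm_tuple s y)) = perm_tuple s y.
      by apply: val_inj.
    by rewrite perm_tupleM mulVg perm_tuple1.
  by apply: finite_image; exact: finite_finset.
split.
  split; last exact: alt_alternating.
    by apply: sub_finite_set fin => y /supp.
  move=> y /supp[s /(flagseq_supp fc)[h1 h2]].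
  have [u1 K1 _] := flag_ranked AE nz h1 h2.
  by rewrite -(perm_uniq (perm_tuple_perm s y)) -(perm_tuple_set s y).
apply: (is_cycle_alt [set: E]).
  apply: sub_finite_set fin => y h; exists (1%g : 'S_d).
  by rewrite perm_tuple1; exact: h.
move=> s1 s2; rewrite sum_flats; last first.
  move=> v /(flagseq_supp fc)[h1 h2]; exists (code v).
    have : v \in s1 ++ v :: s2 by rewrite mem_cat inE eqxx orbT.
    move: h2; rewrite -map_comp -[RHS]map_id => /eq_in_map h /h /= e; by rewrite e.
  have : code v \in map code (s1 ++ v :: s2) by rewrite map_f // mem_cat inE eqxx orbT.
  by move=> /(flagp_mem h1)[].
have [[e1 e2]|ne] := pselect (s1 = map pts (map code s1) /\ s2 = map pts (map code s2)).
  rewrite -[RHS](fz (map code s1) (map code s2)) big_mkcond /=; apply: eq_bigr => Y _.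
  case: (boolP (flat Y)) => fY; last first.
    apply/esym/eqP/negPn/negP => /fs h; case/negP: fY.
    have Ym : Y \in map code s1 ++ Y :: map code s2 by rewrite mem_cat inE eqxx orbT.
    by have [] := flagp_mem h Ym.
  by rewrite /flagseq !map_cat /= code_flat // -e1 -e2 eqxx.
rewrite big1 // => Y fY; apply/eqP/negPn/negP => /(flagseq_supp fc)[_ h]; apply: ne.
move: h; rewrite !map_cat /= code_flat // => /eqP; rewrite eqseq_cat ?size_map //.
by move=> /andP[/eqP -> /eqP[->]].
Qed.

(** Together with [flc_fcycle] and [flc_inj] this identifies the top cycles with the flag cycles. *)
Lemma flc_alt f : flag_cycle set0 f -> flc (alt (n := d) (flagseq f)) = f.
Proof.
move=> fc; have [fs _] := fc; apply/funext => s.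
case: (boolP (flagp set0 s)) => h; last first.
  by rewrite /flc (negPf h); apply/esym/eqP/negPn/negP => /fs; exact/negP.
have [y sy] := flag_tuple h; have [_ _ ry] := flag_ranked AE nz h sy.
rewrite (flcE _ h sy) (alt_ranked (r := rk)) // => [|y' /(flagseq_supp fc)[h1 h2]].
  by rewrite /flagseq -sy map_code_pts // eqxx.
by have [] := flag_ranked AE nz h1 h2.
Qed.

Lemma flc_inj c e : is_chain KL c -> is_chain KL e -> flc c = flc e -> c = e.
Proof.
move=> [_ cs ca] [_ es ea] h.
have pr (c' : d.-tuple (set E) -> int) : (forall x, c' x != 0 -> uniq x /\ KL [set` x]) ->
    forall y, c' y != 0 -> exists s : 'S_d, ranked rk (perm_tuple s y).
  by move=> cs' y /cs'[uy Ky]; have [] := KL_rk AE nz uy Ky; exact: ranked_perm.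
apply: (alternating_eq ca ea); [|exact: pr|exact: pr].
move=> y ry.
have aux : uniq y /\ KL [set` y] -> c y = e y.
  move=> [uy Ky]; have [f1 f2] := ranked_flag AE nz uy Ky ry.
  by rewrite -(flcE c f1 f2) -(flcE e f1 f2) h.
case: (eqVneq (c y) 0) => [c0|/cs/aux//].
by case: (eqVneq (e y) 0) => [->//|/es/aux].
Qed.

End FlatCycles.

(** * The cycle around one bounded region *)

Section Spheres.
Variables (R : realType) (d : nat) (I : finType).
Local Notation E := 'rV[R]_d.
Variables (l : I -> 'Hom(E, R^o)) (b : I -> R) (A : set (set E)).
Hypothesis AE : forall H, A H <-> exists i, H = hyp l b i.
Hypothesis nz : forall i, exists v, l i v != 0 :> R.
Local Notation sv := (sv l b).
Local Notation dv := (dv l).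
Local Notation zs := (zs l b).
Local Notation affv := (affv l b).
Local Notation dir := (dir l).
Local Notation flat := (flat l b).
Local Notation cov := (cov l b).
Local Notation flagp := (flagp l b).
Local Notation flag_cycle := (flag_cycle l b).
Local Notation hyp := (hyp l b).
Local Notation cell := (cell l b).
Local Notation pts := (pts l b).
Local Notation code := (code l b).
Local Notation rk := (rk l b).
Local Notation Lat := (intersections A `\ [set: E]).
Local Notation KL := (order_complex Lat (@flat_le R d)).
Local Notation set0 := (finset.set0 : {set I}).

Variable u : {set I} -> E.
Hypothesis gu : generic_dirs l b u.
Local Notation ftrans := (ftrans l b u).
Local Notation bnd := (bnd l).
Local Notation bsupp := (bsupp l b).
Local Notation has_face := (has_face l b).
Local Notation flc := (flc l b).
Local Notation Knr := (order_complex (nonregions A) (@cell_le R d)).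

(** A nonzero jump at [y] needs an adjacent cell that is a face of [r], and then [y] is one too; so
    the support condition descends along the flag. *)
Lemma ftrans_has_face X k s (r : {ffun I -> int}) : flat X ->
  (forall x, zs x = X -> k (sv x) != 0 -> sle (sv x) r) ->
  ftrans s X k != 0 -> forall Z, Z \in s -> has_face r Z.
Proof.
elim: s X k => // Y s ih X k fX hk /=; case: ifP => [c fn Z|]; last by rewrite eqxx.
have [_ fY _ _] := covP c.
have hj y : zs y = Y -> jump l (u X) k (sv y) != 0 -> sle (sv y) r.
  move=> zy jn i; have [|yi] := eqVneq (sv y i) 0; [by left|right].
  have [x1 z1 s1] := facet_up gu c zy; have [x2 z2 s2] := facet_down gu c zy.
  have aux x v : sv x = scomp (sv y) (dv v) -> sle (sv x) r -> sv y i = r i.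
    move=> sx /(_ i); rewrite sx scompE (negPf yi) => -[e|//].
    by rewrite e eqxx in yi.
  case: (eqVneq (k (sv x1)) 0) => [k1|/(hk _ z1)/(aux _ _ s1)//].
  case: (eqVneq (k (sv x2)) 0) => [k2|/(hk _ z2)/(aux _ _ s2)//].
  by move: jn; rewrite /jump -s1 -s2 k1 k2 subrr eqxx.
rewrite inE => /orP[/eqP ->|Zs]; last exact: (ih Y _ fY hj fn).
apply: contrapT => nf; case/negP: fn; rewrite (ftrans0 gu) // => y zy.
by apply/eqP/negPn/negP => /(hj y zy) ys; apply: nf; exists y.
Qed.

Lemma same_cellP x y : same_cell A x y <-> sv x = sv y.
Proof.
split=> [h|e H /AE[i ->]]; last by apply/same_pieceP; rewrite e.
by apply/ffunP => i; apply/same_pieceP; apply: h; apply/AE; exists i.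
Qed.

Lemma cellsP C : cells A C <-> exists x, C = cell x.
Proof.
have e x : [set y | same_cell A x y] = cell x.
  by apply/seteqP; split=> y /=; [move/same_cellP|move=> h; apply/same_cellP].
by split=> -[x ->]; exists x.
Qed.

Lemma regionsP C : regions A C <-> exists2 x, C = cell x & zs x = set0.
Proof.
split.
  move=> [/cellsP[x ->] mx]; exists x => //; apply/setP => i; rewrite finset.in_set0.
  apply/negbTE/negP => ix; have [v vn] := nz i.
  have [y [sy _ _]] := sv_comp l b x v.
  have xy : sle (sv x) (sv y).
    by move=> j; rewrite sy scompE; case: eqP => [->|_]; [left|right].
  have /cell_eq e : cell y = cell x.
    by apply: mx; [apply/cellsP; exists y|apply/cell_leP].
  have := congr1 (fun s : {ffun I -> int} => s i) e; rewrite sy scompE sv_eq0 ix.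
  move=> h; move: ix; rewrite -(sv_eq0 l b) -h dvE sgz_eq0; exact/negP.
move=> [x -> zx]; split; first by apply/cellsP; exists x.
move=> D /cellsP[y ->] /cell_leP h; apply/cell_eq; by rewrite (sle_zs0 zx h).
Qed.

Lemma bregP C : bounded_regions A C <->
  exists x, [/\ C = cell x, zs x = set0 & bnd [set: I]%SET set0 (sv x)].
Proof.
split=> [[/regionsP[x -> zx] /(bounded_cellP zx)]|[x [-> zx bx]]]; first by exists x.
by split; [apply/regionsP; exists x|apply/bounded_cellP].
Qed.

Lemma nonregion_span D : nonregions A D -> exists2 y, D = cell y &
  zs y != set0 /\ affine_span D = pts (zs y).
Proof.
move=> [/cellsP[y ->] nr]; exists y => //; split; last exact: affine_span_cell.
by apply/eqP => zy; apply: nr; apply/regionsP; exists y.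
Qed.

Lemma sle_zs x y : sle (sv x) (sv y) -> (zs y \subset zs x)%B.
Proof.
move=> xy; apply/subsetP => i; rewrite -!(sv_eq0 l b); case: (xy i) => [->//|->//].
Qed.

Lemma simp_span_nonregions : simplicial Knr KL (@affine_span R d).
Proof.
move=> s [fs sn sc]; split; first exact: finite_image.
  move=> _ [D /sn/nonregion_span[y -> [y0 ->]] <-]; apply/(LatP AE nz).
  by exists (zs y) => //; split=> //; exact: flat_zs.
move=> _ _ [D sD <-] [D' sD' <-].
have [y Dy [_ ->]] := nonregion_span (sn _ sD).
have [y' Dy' [_ ->]] := nonregion_span (sn _ sD').
have := sc D D' sD sD'; rewrite Dy Dy'.
move=> [/cell_leP/sle_zs h|/cell_leP/sle_zs h]; [right|left];
  by apply/pts_sub => //; exact: flat_zs.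
Qed.

Variable x0 : E.
Hypothesis zx0 : zs x0 = set0.
Hypothesis bx0 : bnd [set: I]%SET set0 (sv x0).
Local Notation below := (cells_below A (cell x0)).
Local Notation KC := (order_complex below (@cell_le R d)).
Local Notation rho := (sv x0).

Lemma belowP D : below D <-> exists y, [/\ D = cell y, sle (sv y) rho & zs y != set0].
Proof.
split.
  move=> [/cellsP[y ->] /cell_leP yr nD]; exists y; split=> //.
  by apply/eqP => zy; apply: nD; apply/cell_eq; exact: sle_zs0 zy yr.
move=> [y [-> yr zy]]; split; [by apply/cellsP; exists y|exact/cell_leP|].
by move=> /cell_eq/zs_sv e; rewrite e zx0 eqxx in zy.
Qed.

Lemma below_nonregions : below `<=` nonregions A.
Proof.
move=> D /belowP[y [-> _ zy]]; split; first by apply/cellsP; exists y.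
by move=> /regionsP[x /cell_eq/zs_sv e zx]; rewrite e zx eqxx in zy.
Qed.

Lemma simp_id : simplicial KC Knr id.
Proof.
move=> s [fs sb sc]; rewrite image_id; split=> //.
by apply: classical_sets.subset_trans sb _; exact: below_nonregions.
Qed.

Lemma simp_span : simplicial KC KL (@affine_span R d).
Proof. by move=> s /simp_id; rewrite image_id; exact: simp_span_nonregions. Qed.

(** A face of a given region is determined by its flat, since off the flat its signs are those of
    the region. Hence [affine_span] embeds the proper faces of the region in the semilattice,
    reversing the order. *)
Lemma face_sle y y' : sle (sv y) rho -> sle (sv y') rho -> (zs y' \subset zs y)%B ->
  sle (sv y) (sv y').
Proof.
move=> yr yr' /subsetP s i; case: (eqVneq (sv y i) 0) => [|yi]; [by left|right].
have [e|->] := yr i; first by rewrite e eqxx in yi.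
have [/eqP e|->//] := yr' i.
by move: yi; rewrite sv_eq0 s // -(sv_eq0 l b).
Qed.

Lemma span_below_le D D' : below D -> below D' ->
  affine_span D `<=` affine_span D' -> cell_le D D'.
Proof.
move=> /belowP[y [-> yr _]] /belowP[y' [-> yr' _]]; rewrite !affine_span_cell.
move=> /(pts_sub _ (flat_zs l b y)) h; apply/cell_leP; exact: face_sle.
Qed.

Lemma cell_le_anti D D' : below D -> below D' -> cell_le D D' -> cell_le D' D -> D = D'.
Proof.
move=> /belowP[y [-> _ _]] /belowP[y' [-> _ _]] /cell_leP h /cell_leP h'.
apply/cell_eq/ffunP => i; case: (h i) => // e; case: (h' i) => [->//|->//].
Qed.

Lemma span_inj D D' : below D -> below D' -> affine_span D = affine_span D' -> D = D'.
Proof. by move=> bD bD' e; apply: cell_le_anti => //; apply: span_below_le; rewrite // e. Qed.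

Lemma map_span_inj n (x x' : n.-tuple (set E)) : (forall D, D \in x -> below D) ->
  (forall D, D \in x' -> below D) ->
  map_tuple (@affine_span R d) x = map_tuple (@affine_span R d) x' -> x = x'.
Proof.
move=> bx bx' e; apply: eq_from_tnth => i; apply: span_inj.
- exact/bx/mem_tnth.
- exact/bx'/mem_tnth.
- by have := congr1 (fun t => tnth t i) e; rewrite !tnth_map.
Qed.

Definition face (X : set E) : set E :=
  cell (xget 0 [set y | zs y = code X /\ sle (sv y) rho]).

Lemma faceP X : Lat X -> has_face rho (code X) ->
  below (face X) /\ affine_span (face X) = X.
Proof.
move=> /(Lat_code AE nz)[eX fX X0] [y zy yr].
have [] : [set y | zs y = code X /\ sle (sv y) rho] (xget 0 [set y | zs y = code X /\ sle (sv y) rho]).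
  by apply: xgetPex; exists y.
rewrite /face; set y' := xget _ _ => zy' yr'; rewrite affine_span_cell zy' eX.
by split=> //; apply/belowP; exists y'; rewrite zy'.
Qed.

Lemma push_at n (e : n.-tuple (set E) -> int) (x : n.-tuple (set E)) :
  (forall x', e x' != 0 -> forall D, D \in x' -> below D) ->
  (forall D, D \in x -> below D) ->
  push_chain (@affine_span R d) e (map_tuple (@affine_span R d) x) = e x.
Proof.
move=> he bx; rewrite /push_chain (@fsbigE _ _ _ _ _ [:: x]) //.
- rewrite big_mkcond big_seq1 ifT //; exact/mem_set.
- by move=> x' /=; rewrite inE => /eqP ->.
- move=> x' /= h nx; apply/eqP/negPn/negP => /he bx'; case/negP: nx.
  by rewrite inE; apply/eqP; exact: map_span_inj.
Qed.

Lemma KC_supp n (c : n.-tuple (set E) -> int) : is_chain KC c ->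
  forall x, c x != 0 -> forall D, D \in x -> below D.
Proof. by move=> [_ cs _] x /cs[_ [_ h _]] D /h. Qed.

Lemma KC_no_big (y : d.+1.-tuple (set E)) : uniq y -> ~ KC [set` y].
Proof.
move=> uy Ky; have [_ yb _] := Ky; have := simp_span Ky.
have -> : @affine_span R d @` [set` y] = [set` map_tuple (@affine_span R d) y].
  apply/seteqP; split=> X; first by move=> [D yD <-]; exact: map_f.
  by move=> /= /mapP[D yD ->]; exists D.
apply: (KL_no_big AE nz); rewrite /= map_inj_in_uniq // => D D' /yb bD /yb bD'.
exact: span_inj.
Qed.

Definition dlt (t : {ffun I -> int}) : int := if t == rho then 1 else 0.

Lemma dlt_bsupp : bsupp [set: I]%SET set0 dlt.
Proof. by move=> x zx; rewrite /dlt; case: (sv x =P rho) => [->//|]; rewrite eqxx. Qed.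

Local Notation W := (alt (n := d) (flagseq l b (fun s => ftrans s set0 dlt))).

Lemma dlt_fcycle : flag_cycle set0 (fun s => ftrans s set0 dlt).
Proof. by apply: (ftrans_fcycle gu); [exact: flat0|exact: dlt_bsupp]. Qed.

Lemma dlt_chain : is_chain KL W /\ is_cycle W.
Proof. exact: (alt_flagseq_cycle AE nz dlt_fcycle). Qed.

Lemma dlt_face (y : d.-tuple (set E)) : W y != 0 ->
  forall X, X \in y -> below (face X) /\ affine_span (face X) = X.
Proof.
move=> yn X Xy; have [[_ Ws _] _] := dlt_chain; have [_ [_ yL _]] := Ws _ yn.
apply: faceP; first exact: yL.
have [s sn] : exists s : 'S_d, flagseq l b (fun s => ftrans s set0 dlt) (perm_tuple s y) != 0.
  apply: contrapT => h; case/negP: yn; rewrite /alt big1 // => s _.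
  by apply/eqP; rewrite mulf_eq0; apply/orP; right; apply/negPn/negP => hs; apply: h; exists s.
move: sn; rewrite /flagseq; case: ifP => [_ fn|]; last by rewrite eqxx.
apply: (ftrans_has_face _ _ fn); first exact: flat0.
  move=> x _; rewrite /dlt; case: (sv x =P rho) => [-> _ i|_]; [by right|by rewrite eqxx].
by rewrite map_f // (perm_mem (perm_tuple_perm s y)).
Qed.

(** The cycle of the indicator of the region, pulled back along the embedding [affine_span]. Nothing
    is lost ([push_sphere]), because its support consists of spans of faces. *)
Definition sphere (x : d.-tuple (set E)) : int :=
  if all (fun D => `[< below D >]) x then W (map_tuple (@affine_span R d) x) else 0.

Lemma sphere_supp x : sphere x != 0 ->
  (forall D, D \in x -> below D) /\ W (map_tuple (@affine_span R d) x) != 0.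
Proof.
rewrite /sphere; case: ifP => [/allP h Wn|]; last by rewrite eqxx.
by split=> // D /h/asboolP.
Qed.

Lemma sphere_fin : finite_set [set x | sphere x != 0].
Proof.
have [[fW _ _] _] := dlt_chain.
apply: sub_finite_set (finite_image (map_tuple face) fW) => x /sphere_supp[bx Wn].
exists (map_tuple (@affine_span R d) x) => //.
apply: map_span_inj => // [D /= /mapP[X Xx ->]|]; first by have [] := dlt_face Wn Xx.
apply: eq_from_tnth => i; rewrite !tnth_map.
have Xi : tnth (map_tuple (@affine_span R d) x) i \in map_tuple (@affine_span R d) x.
  exact: mem_tnth.
by have [_] := dlt_face Wn Xi; rewrite !tnth_map.
Qed.

Lemma push_sphere : push_chain (@affine_span R d) sphere = W.
Proof.
apply/funext => y; case: (eqVneq (W y) 0) => [W0|Wn]; last first.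
  have yE : y = map_tuple (@affine_span R d) (map_tuple face y).
    apply: eq_from_tnth => i; rewrite !tnth_map.
    by have [_ ->] := dlt_face Wn (mem_tnth i y).
  have bf D : D \in map_tuple face y -> below D.
    by move=> /= /mapP[X Xy ->]; have [] := dlt_face Wn Xy.
  rewrite {1}yE push_at // => [|x /sphere_supp[]//].
  rewrite /sphere ifT -?yE //; apply/allP => D Dy; apply/asboolP; exact: bf.
rewrite W0; apply/eqP/negPn/negP; rewrite push_chainE.
by move=> /fiber_sum_neq0[x xy /sphere_supp[_]]; rewrite xy W0 eqxx.
Qed.

(** Pushing forward commutes with the boundary and is injective on chains below the region. *)
Lemma is_cycle_of_push n (e : n.-tuple (set E) -> int) :
  finite_set [set x | e x != 0] ->
  (forall x, e x != 0 -> forall D, D \in x -> below D) ->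
  is_cycle (push_chain (@affine_span R d) e) -> is_cycle e.
Proof.
case: n e => // n e fe he /=; rewrite boundary_push // => hp.
have bsup x : boundary e x != 0 -> forall D, D \in x -> below D.
  rewrite boundaryE => /fiber_sum_neq0[x' <- /he h] D Dx; apply: h; exact: mem_behead Dx.
apply/funext => x; apply/eqP/negPn/negP => xn; case/negP: (xn).
by rewrite -(push_at bsup (bsup x xn)) hp.
Qed.

Lemma sphere_cycle : sphere \in cycle_pred KC d.
Proof.
have [[_ Ws Wa] Wz] := dlt_chain; apply/asboolP; split; last first.
  apply: is_cycle_of_push; [exact: sphere_fin|by move=> x /sphere_supp[]|].
  by rewrite push_sphere.
split; first exact: sphere_fin.
  move=> x /sphere_supp[bx Wn]; have [uW [_ _ cW]] := Ws _ Wn.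
  split; first exact: map_uniq uW.
  split=> [|D /bx//|D D' Dx D'x]; first exact: finite_seq.
  have [h|h] := cW _ _ (map_f (@affine_span R d) Dx) (map_f (@affine_span R d) D'x).
    by right; apply: span_below_le h; exact: bx.
  by left; apply: span_below_le h; exact: bx.
move=> s x; rewrite /sphere (perm_all _ (perm_tuple_perm s x)); case: ifP => _.
  rewrite -Wa; congr (alt _ _); apply: eq_from_tnth => i.
  by rewrite !(tnth_map, tnth_mktuple).
by rewrite mulr0.
Qed.

Local Notation S := (Cycle sphere_cycle).

Lemma dlt_cycle : W \in cycle_pred KL d.
Proof. by apply/asboolP; exact: dlt_chain. Qed.

Local Notation Wc := (Cycle dlt_cycle).

Lemma flcZ (a : int) c s : flc (fun y => a * c y) s = a * flc c s.
Proof.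
by rewrite /flc; case: ifP => _; rewrite ?mulr0 //; case: insub => //=; rewrite mulr0.
Qed.

(** In the semilattice [c] becomes the transform of some [k], and its flags consist of spans of
    faces of the region. By [ftrans_faces], [k] vanishes on all other regions, so [c] is [k rho]
    times [sphere]. *)
Lemma sphere_generates (c : cycles KC d) : exists a, c = S *~ a.
Proof.
have [cc _] := cycle_is_chain c; pose pc := push_chain (@affine_span R d) (cycle_val c).
have /asboolP[pch pcy] : pc \in cycle_pred KL d by exact: push_chain_cycle simp_span.
have fcy := flc_fcycle AE nz pch pcy.
have [|k [_ bk kE]] := ftrans_surj gu (J := [set: I]%SET) (flat0 b nz) fcy.
  move=> Y s; rewrite finset.setD0 finset.setIT => ->.
  rewrite /flc ifF //; apply/negbTE/negP => /andP[/= /andP[c0 _] _].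
  by have [_ _ _ e] := covP c0; move: (n_Sn _ e).
have hk x : zs x = set0 -> ~ sle (sv x) rho -> k (sv x) = 0.
  apply: (ftrans_faces gu (flat0 b nz) bk) => s Z; rewrite inE => /orP[/eqP ->|Zs] nf.
    by case: nf; exists x0 => //; exact: sle_refl.
  rewrite -kE; apply/eqP/negPn/negP => fn; apply: nf.
  have [fs _] := fcy; have hs := fs _ fn; have [y sy] := flag_tuple hs.
  move: fn; rewrite (flcE _ hs sy) /pc push_chainE => /fiber_sum_neq0[x' xy cn].
  have : pts Z \in (y : seq _) by rewrite -sy map_f.
  rewrite -xy /= => /mapP[D Dx ZD].
  have /belowP[yy [DE yr _]] := KC_supp cc cn Dx.
  exists yy => //; have [fZ _] := flagp_mem hs Zs.
  by rewrite -(code_flat fZ) ZD DE affine_span_cell code_pts.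
exists (k rho).
have pcE : pc = cycle_val (Wc *~ k rho).
  have [Wch _] := cycle_is_chain (Wc *~ k rho).
  apply: (flc_inj AE nz pch Wch); apply/funext => s; rewrite kE.
  have -> : cycle_val (Wc *~ k rho) = (fun y => k rho * W y).
    by apply/funext => y; rewrite cycle_val_mulrz.
  rewrite flcZ (flc_alt AE nz dlt_fcycle) -ftransZ.
  apply: (ftrans_ext gu) => [|x zx]; first exact: (flat0 b nz).
  rewrite /dlt; case: (sv x =P rho) => [->|nx]; first by rewrite mulr1.
  by rewrite mulr0; apply: hk => // /(sle_zs0 zx).
apply: cycle_eq; apply/funext => x; rewrite cycle_val_mulrz.
have [bx|nb] := pselect (forall D, D \in x -> below D); last first.
  transitivity (0 : int).
    by apply/eqP/negPn/negP => cn; apply: nb; exact: (KC_supp cc cn).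
  apply/esym/eqP; rewrite mulf_eq0; apply/orP; right; apply/negPn/negP => /sphere_supp[h _].
  exact: nb.
rewrite -(push_at (KC_supp cc) bx) -/pc pcE cycle_val_mulrz /=; congr (_ * _).
rewrite -push_sphere; apply: push_at => // x' /sphere_supp[h _]; exact: h.
Qed.

Lemma sphere_neq0 : exists x, sphere x != 0.
Proof.
apply: contrapT => h.
have W0 y : W y = 0.
  rewrite -push_sphere push_chainE; apply/eqP/negPn/negP => /fiber_sum_neq0[x _ xn].
  by apply: h; exists x.
have : dlt (sv x0) = 0.
  apply: (ftrans_inj gu (flat0 b nz) dlt_bsupp) zx0 => s.
  have := congr1 (@^~ s) (flc_alt AE nz dlt_fcycle) => /= <-.
  by rewrite /flc; case: ifP => // _; case: insub => //=.
by rewrite /dlt eqxx.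
Qed.

Lemma hclass_mulrz (V : choiceType) (K : set (set V)) n (z : cycles K n) (k : int) :
  hclass (z *~ k) = hclass z *~ k.
Proof. by rewrite /hclass raddfMz. Qed.

Lemma sphere_mulrz_inj : injective (fun k : int => hclass S *~ k).
Proof.
move=> k k' /=; rewrite -!hclass_mulrz => /(hclass_inj KC_no_big) e.
have [x xn] := sphere_neq0; have := congr1 (fun z => cycle_val z x) e.
by rewrite !cycle_val_mulrz /= => /(mulIf xn).
Qed.

(** Guarantees that [fundamental_cycle] picks a generator and not its default value. *)
Lemma sphere_bijective : bijective (fun k : int => hclass S *~ k).
Proof.
have surj (h : homology KC d) : exists k : int, hclass S *~ k = h.
  have [c ->] := hclass_repr h; have [a ->] := sphere_generates c.
  by exists a; rewrite hclass_mulrz.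
exists (fun h => projT1 (cid (surj h))) => [k|h]; last exact: projT2 (cid (surj h)).
by apply: sphere_mulrz_inj; exact: projT2 (cid (surj _)).
Qed.

(** The chosen generator and [sphere] are integer multiples of each other, so they differ by the
    unit [e]; and [sphere] is pushed to the cycle [Z] that encodes the transform of the
    indicator. *)
Lemma zstar_tau_flags : exists (e : int) (Z : cycles KL d), [/\ e * e = 1,
  zstar (tau A (cell x0)) = hclass Z *~ e &
  flc (cycle_val Z) = (fun s => ftrans s set0 dlt)].
Proof.
pose F := fundamental_cycle A (cell x0).
have Fbij : bijective (fun k : int => hclass F *~ k).
  apply: (@xgetPex _ 0 [set c : cycles KC d | bijective (fun k : int => hclass c *~ k)]).
  by exists S; exact: sphere_bijective.
have [a Fa] := sphere_generates F; have [g _ gK] := Fbij.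
have ab : a * g (hclass S) = 1.
  apply: sphere_mulrz_inj; rewrite /= mulr1z -[RHS](gK (hclass S)) Fa.
  by rewrite hclass_mulrz mulrzA.
have aa : a * a = 1.
  have : (`|a| * `|g (hclass S)| == 1)%N by rewrite -abszM ab.
  by rewrite muln_eq1 => /andP[+ _]; case: a {Fa ab} => [[|[|n]]|[|n]].
exists a, Wc; split=> //; last by rewrite /= (flc_alt AE nz dlt_fcycle).
rewrite /zstar /tau (induced_hclass _ simp_id) (induced_hclass _ simp_span_nonregions).
rewrite -hclass_mulrz; congr hclass; apply: cycle_eq; apply/funext => y.
rewrite cycle_val_mulrz /= !push_chainE fiber_sum_comp; last first.
  by have [[]] := cycle_is_chain (fundamental_cycle A (cell x0)).
rewrite -push_sphere push_chainE /fiber_sum mulr_fsumr.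
have -> : map_tuple (@affine_span R d) \o map_tuple id = map_tuple (@affine_span R d) (n := d).
  by apply/funext => x; apply: val_inj; rewrite /= map_id.
by apply: eq_fsbigr => x _; rewrite -/F Fa cycle_val_mulrz.
Qed.

End Spheres.

(** * Hyperplanes as zero sets of affine functionals *)

Section DotProduct.
Variables (R : realType) (d : nat).

Definition dotf (a x : 'rV[R]_d) : R^o := \sum_(i < d) a 0 i * x 0 i.

Lemma dotf_linear a : linear (dotf a).
Proof.
move=> t x y; rewrite /dotf scaler_sumr -big_split; apply: eq_bigr => i _.
by rewrite !mxE mulrDr mulrCA.
Qed.

HB.instance Definition _ a :=
  GRing.isLinear.Build R 'rV[R]_d R^o _ (dotf a) (dotf_linear a).

Lemma arrangement_functionals (A : set (set 'rV[R]_d)) : arrangement A ->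
  exists n (l : 'I_n -> 'Hom('rV[R]_d, R^o)) (b : 'I_n -> R),
    (forall H, A H <-> exists i, H = hyp l b i) /\
    (forall i, exists v, l i v != 0 :> R).
Proof.
move=> [/finite_seqP[r ->] hA].
have ex (i : 'I_(size r)) : exists q : 'rV[R]_d * R, q.1 != 0 /\
    nth classical_sets.set0 r i = [set x | \sum_(j < d) q.1 0 j * x 0 j = q.2].
  have [|a [c [a0 e]]] := hA (nth classical_sets.set0 r i); first exact: mem_nth.
  by exists (a, c).
have [p hp] := boolp.choice ex.
pose l i : 'Hom('rV[R]_d, R^o) := linfun (dotf (p i).1); pose b i := (p i).2.
have lE i x : l i x = dotf (p i).1 x by rewrite lfunE.
have hE i : hyp l b i = nth classical_sets.set0 r i.
  rewrite (hp i).2; apply/seteqP; split=> x; rewrite /hyp /affv /= lE.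
    by move=> /eqP; rewrite subr_eq0 => /eqP.
  by rewrite /dotf => ->; rewrite /b subrr.
exists (size r), l, b; split.
  move=> H; split=> [/= /(nthP classical_sets.set0)[i ir <-]|[i ->]].
    by exists (Ordinal ir); rewrite hE.
  by rewrite hE /=; exact: mem_nth.
move=> i; have /rV0Pn[j aj] := (hp i).1; exists (delta_mx 0 j).
rewrite lE /dotf (bigD1 j) //= big1 ?addr0.
  by rewrite mxE !eqxx mulr1.
by move=> k kj; rewrite mxE eqxx (negPf kj) mulr0.
Qed.

End DotProduct.

(** * The classes of the bounded regions form a basis *)

Section Basis.
Variables (R : realType) (d : nat) (I : finType).
Local Notation E := 'rV[R]_d.
Variables (l : I -> 'Hom(E, R^o)) (b : I -> R) (A : set (set E)).
Hypothesis AE : forall H, A H <-> exists i, H = hyp l b i.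
Hypothesis nz : forall i, exists v, l i v != 0 :> R.
Local Notation sv := (sv l b).
Local Notation dv := (dv l).
Local Notation zs := (zs l b).
Local Notation affv := (affv l b).
Local Notation dir := (dir l).
Local Notation flat := (flat l b).
Local Notation cov := (cov l b).
Local Notation flagp := (flagp l b).
Local Notation flag_cycle := (flag_cycle l b).
Local Notation hyp := (hyp l b).
Local Notation cell := (cell l b).
Local Notation pts := (pts l b).
Local Notation code := (code l b).
Local Notation rk := (rk l b).
Local Notation Lat := (intersections A `\ [set: E]).
Local Notation KL := (order_complex Lat (@flat_le R d)).
Local Notation set0 := (finset.set0 : {set I}).

Local Notation B := (bounded_regions A).

Lemma bounded_regions_finite : finite_set B.
Proof.
(* A region is determined by its signs, shifted by one to land in ['I_3]. *)
pose F (t : {ffun I -> 'I_3}) : set E := [set y | forall i, sv y i = (t i : nat)%:Z - 1].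
apply: (@sub_finite_set _ _ (F @` [set: {ffun I -> 'I_3}])); last first.
  by apply: finite_image; exact: finite_finset.
move=> C /(bregP AE nz)[x [-> _ _]].
exists [ffun i => inord (absz (sv x i + 1))] => //.
have tE i : ([ffun i => inord (absz (sv x i + 1))] : {ffun I -> 'I_3}) i = (absz (sv x i + 1)) :> nat.
  by rewrite ffunE inordK // svE; case: (sgzP (affv i x)).
have sE i : (absz (sv x i + 1))%:Z - 1 = sv x i.
  by rewrite svE; case: (sgzP (affv i x)).
apply/seteqP; split=> y; first by move=> h; apply/ffunP => i; rewrite h tE sE.
by move=> h i; rewrite tE sE h.
Qed.

Lemma zstar_tau_basis :
  zbasis (M := homology KL d) B (fun C => zstar (tau A C)).
Proof.
have [u gu] := generic_dirs_exist l b.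
have ex C : exists q : E * cycles KL d * int, B C ->
    [/\ C = cell q.1.1, zs q.1.1 = set0, q.2 * q.2 = 1,
        zstar (tau A C) = hclass q.1.2 *~ q.2 &
        flc l b (cycle_val q.1.2) =
          (fun s => ftrans l b u s set0 (dlt l b q.1.1))].
  have [/(bregP AE nz)[x [-> zx bx]]|nB] := pselect (B C); last by exists (0, 0, 0).
  have [e [Z [ee tE fE]]] := zstar_tau_flags AE nz gu zx bx.
  by exists (x, Z, e).
have [p hp] := boolp.choice ex.
pose xx C := (p C).1.1; pose ZZ C := (p C).1.2; pose ee C := (p C).2.
have finB := bounded_regions_finite; pose r := finmap.enum_fset (fset_set B).
have rB C : C \in r <-> B C.
  have e : (C \in r) = (C \in B) by exact: (in_fset_set finB C).
  by rewrite e; split=> [/set_mem|/mem_set].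
have ur : uniq r by exact: finmap.fset_uniq.
(* [zz k] represents the combination with coefficients [k]; its flag function is the transform of
   [kk k], which takes the value [ee C * k C] on the bounded region [C]. *)
pose zz (k : set E -> int) := \sum_(C <- r) ZZ C *~ (ee C * k C).
pose kk (k : set E -> int) t := \sum_(C <- r) (ee C * k C) * dlt l b (xx C) t.
have sumE (k : set E -> int) : \sum_(C \in B) zstar (tau A C) *~ k C = hclass (zz k).
  rewrite fsbig_finite // hclass_sum big_seq [RHS]big_seq; apply: eq_bigr => C /rB BC.
  by have [_ _ _ -> _] := hp C BC; rewrite mulrzA.
have flzz (k : set E -> int) s : flc l b (cycle_val (zz k)) s = ftrans l b u s set0 (kk k).
  have -> : cycle_val (zz k) = (fun y => \sum_(C <- r) (ee C * k C) * cycle_val (ZZ C) y).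
    by apply/funext => y; rewrite cycle_val_sum.
  rewrite flc_sum ftrans_sum big_seq [RHS]big_seq; apply: eq_bigr => C /rB BC.
  by rewrite ftransZ; have [_ _ _ _ ->] := hp C BC.
have kkE (k : set E -> int) x : zs x = set0 ->
    kk k (sv x) = if `[< B (cell x) >] then ee (cell x) * k (cell x) else 0.
  move=> zx; rewrite /kk; case: asboolP => [Bx|nB].
    rewrite (bigD1_seq (cell x)) //=; last exact/rB.
    have e : sv x = sv (xx (cell x)) by have [/cell_eq] := hp _ Bx.
    rewrite /dlt -e eqxx mulr1 big_seq_cond big1 ?addr0 // => C /andP[/rB BC nC].
    have [eC _ _ _ _] := hp C BC; case: (sv x =P sv (xx C)) => [e'|]; last by rewrite mulr0.
    by case/eqP: nC; rewrite eC; apply/cell_eq; rewrite -/(xx C) -e'.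
  rewrite big_seq big1 // => C /rB BC; have [eC _ _ _ _] := hp C BC; rewrite /dlt.
  case: (sv x =P sv (xx C)) => [e'|]; last by rewrite mulr0.
  by case: nB; move: BC; rewrite {1}eC /cell /= -/(xx C) -e'.
have bE x : zs x = set0 -> B (cell x) -> bnd l [set: I]%SET set0 (sv x).
  by move=> zx /(bregP AE nz)[y [/cell_eq -> _]].
have kkb (k : set E -> int) : bsupp l b [set: I]%SET set0 (kk k).
  move=> x zx; rewrite (kkE k x zx); case: asboolP => [Bx _|]; last by rewrite eqxx.
  exact: bE.
have hinj := hclass_inj (KL_no_big AE nz).
move=> m; have [z ->] := hclass_repr m; have [zc zz0] := cycle_is_chain z.
have [|k [_ bk kE]] :=
    ftrans_surj gu (J := [set: I]%SET) (flat0 b nz) (flc_fcycle AE nz zc zz0).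
  move=> Y s; rewrite finset.setD0 finset.setIT => ->.
  rewrite /flc ifF //; apply/negbTE/negP => /andP[/= /andP[c0 _] _].
  by have [_ _ _ e] := covP c0; move: (n_Sn _ e).
(* The coefficient of [C] is the value of [k] on it, up to the sign [ee C], which is its own
   inverse. *)
pose k0 C := if `[< B C >] then ee C * k (sv (xx C)) else 0.
have k0B : [set C | k0 C != 0] `<=` B.
  by move=> C /=; rewrite /k0; case: asboolP; rewrite ?eqxx.
exists k0; split.
  split=> //; first exact: sub_finite_set k0B finB.
  rewrite sumE; congr hclass; apply: cycle_eq.
  have [zc' _] := cycle_is_chain (zz k0).
  apply: (flc_inj AE nz zc zc'); apply/funext => s; rewrite kE flzz.
  apply: (ftrans_ext gu) => [|x zx]; first exact: flat0.
  rewrite kkE //; case: asboolP => [Bx|nB].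
    have [/cell_eq e _ e1 _ _] := hp _ Bx.
    by rewrite /k0 asboolT // mulrA -/(ee _) e1 mul1r e.
  apply/eqP/negPn/negP => /(bk x zx) bx; apply: nB; apply/(bregP AE nz).
  by exists x.
(* Uniqueness: [kk k'] and [k] have the same transform, so [ftrans_inj] identifies them on every
   region. *)
move=> k' [_ k'B]; rewrite sumE => /hinj e.
apply/funext => C; have [BC|nB] := pselect (B C); last first.
  transitivity (0 : int); first by rewrite /k0 asboolF.
  by apply/esym/eqP/negPn/negP => /k'B.
have [eC zC e1 _ _] := hp C BC.
have : kk k' (sv (xx C)) = k (sv (xx C)).
  apply/eqP; rewrite -subr_eq0; apply/eqP.
  apply: (ftrans_inj gu (flat0 b nz) (k := fun t => kk k' t - k t)) zC => [x zx|s].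
    case: (eqVneq (kk k' (sv x)) 0) => [->|/(kkb k' x zx)//].
    by rewrite sub0r oppr_eq0; exact: bk.
  by rewrite ftransB -flzz -kE -e subrr.
rewrite kkE // -eC asboolT // /k0 asboolT // => <-.
by rewrite mulrA e1 mul1r.
Qed.

End Basis.

(* [finset] has shadowed the [setT] of classical sets. *)
From mathcomp Require Import all_classical reals topology normedtype.

Theorem theorem3p4 (R : realType) (d : nat) (A : set (set 'rV[R]_d))
  (arrA : arrangement A)
  (lenA : poset_length (cells A) (@cell_le R d) d) :
  zbasis (M := homology (order_complex (intersections A `\ setT) (@flat_le R d)) d)
    (bounded_regions A) (fun C => zstar (tau A C)).
Proof.
have [n [l [b [AE nz]]]] := arrangement_functionals arrA.
exact: (zstar_tau_basis AE nz).
Qed.
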